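(* In the homogeneous setting described in the context, the Hermitian scalar curvature of $J$ is the constant $$s=\mathrm{tr}\left(\mathrm{ad}_{H\xi}-H\,\mathrm{ad}_\xi\right),$$ where $\xi=\sum_{i=1}^n[e_i,e_{i+n}]_{\mathfrak g}$ and $\{e_1,\dots,e_{2n}\}$ is any symplectic basis of $(\mathfrak m,\sigma)$.
   Context: Setting: $(M,\omega)$ is a connected symplectic manifold of dimension $2n$ with a compatible almost complex structure $J$ (i.e. $J^2=-\mathrm{id}$, $\omega(J\cdot,J\cdot)=\omega$, $\omega(v,Jv)>0$ for $v\ne0$), and $g(u,v)=\omega(u,Jv)$. A connected Lie group $G$ acts transitively on $M$ preserving $\omega$ and $J$, almost effectively (no non-discrete normal subgroup of $G$ acts trivially). Fix $x\in M$ with isotropy subgroup $K\subset G$, taken to be compact. Let $\mathfrak g,\mathfrak k$ be the Lie algebras of $G,K$, with bracket $[\cdot,\cdot]_{\mathfrak g}$ and $\mathrm{ad}_X(Y)=[X,Y]_{\mathfrak g}$. Fix an $\mathrm{Ad}_K$-invariant complement $\mathfrak m$, $\mathfrak g=\mathfrak k\oplus\mathfrak m$. Each $X\in\mathfrak g$ induces the vector field on $M$ generating $z\mapsto e^{tX}z$; evaluation at $x$ gives an isomorphism $\mathfrak m\cong T_xM$, through which $\omega_x$ and $J_x$ define a symplectic form $\sigma$ and a complex structure $H$ on $\mathfrak m$. $H$ is extended to $\mathfrak g$ by $H\mathfrak k=\{0\}$, and traces are of endomorphisms of $\mathfrak g$. A symplectic basis is one with $\sigma(e_i,e_{i+n})=1$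 for $1\le i\le n$, and $\sigma(e_i,e_j)=0$ for all other pairs $i<j$. Curvature: with $4N(X,Y)=[JX,JY]-J[JX,Y]-J[X,JY]-[X,Y]$, the Chern connection $\nabla$ is the unique connection preserving $g$ with torsion $N$; $R(X,Y)=\nabla_X\nabla_Y-\nabla_Y\nabla_X-\nabla_{[X,Y]}$; the Chern-Ricci form is $\rho(X,Y)=\mathrm{tr}(JR(X,Y))$ (real trace); the Hermitian scalar curvature $s$ is the function defined by $s\,\omega^n=n\,\rho\wedge\omega^{n-1}$. *)

(* Defs.v *)
From HB Require Import structures.
From mathcomp Require Import all_boot all_order all_algebra all_fingroup.
From mathcomp Require Import all_classical all_reals all_analysis.
Set Implicit Arguments.
Unset Strict Implicit.
Unset Printing Implicit Defensive.
Import Order.TTheory GRing.Theory Num.Theory.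
Import numFieldNormedType.Exports.
Local Open Scope classical_set_scope.
Local Open Scope ring_scope.

(* MathComp-Analysis has no smooth manifolds. They are set up here with a
   preferred chart at each point, so that every tangent space T_p M is the
   model space 'rV[R]_m, read in the preferred chart at p. *)

(** * Smooth maps between normed spaces *)

(* For a finite-dimensional V and an open U this is the usual class C^k: a
   function is C^1 iff it is differentiable with continuous directional
   derivatives. *)
Fixpoint Ck (R : realType) (V W : normedModType R) (k : nat) (U : set V)
    (f : V -> W) : Prop :=
  match k with
  | 0 => forall u, U u -> {for u, continuous f}
  | k'.+1 => (forall u, U u -> differentiable f u) /\
             forall v, Ck k' U (fun u => 'd f u v)
  end.

Definition smooth_on (R : realType) (V W : normedModType R) (U : set V)
    (f : V -> W) : Prop :=
  forall k, Ck k U f.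

(** * Manifolds *)

(* [chart p] is the preferred chart at p: a homeomorphism from the open set
   [dom p], which contains p, onto the open set [cod p], with inverse
   [chartV p]. The values of [chart p] off [dom p] and of [chartV p] off
   [cod p] are irrelevant. *)
Record manifold (R : realType) (m : nat) := Manifold {
  carrier :> topologicalType;
  chart : carrier -> carrier -> 'rV[R]_m;
  chartV : carrier -> 'rV[R]_m -> carrier;
  dom : carrier -> set carrier;
  cod : carrier -> set 'rV[R]_m;
  dom_center : forall p, dom p p;
  dom_open : forall p, open (dom p);
  cod_open : forall p, open (cod p);
  chart_cod : forall p q, dom p q -> cod p (chart p q);
  chartV_dom : forall p u, cod p u -> dom p (chartV p u);
  chartK : forall p q, dom p q -> chartV p (chart p q) = q;
  chartVK : forall p u, cod p u -> chart p (chartV p u) = u;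
  chart_continuous : forall p q, dom p q -> {for q, continuous (chart p)};
  chartV_continuous : forall p u, cod p u -> {for u, continuous (chartV p)};
  chart_smooth : forall p q,
    smooth_on [set u | cod p u /\ dom q (chartV p u)] (chart q \o chartV p);
  manifold_hausdorff : hausdorff_space carrier;
  manifold_second_countable : @second_countable carrier
}.

Definition smooth_map (R : realType) (m k : nat) (M : manifold R m)
    (N : manifold R k) (f : M -> N) : Prop :=
  continuous f /\
  forall p, smooth_on [set u | cod p u /\ dom (f p) (f (chartV p u))]
                      (chart (f p) \o f \o chartV p).

(* Smoothness of a map M * N -> P in two variables. *)
Definition smooth_map2 (R : realType) (m k l : nat) (M : manifold R m)
    (N : manifold R k) (P : manifold R l) (f : M -> N -> P) : Prop :=
  continuous (fun z : M * N => f z.1 z.2) /\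
  forall p q,
    smooth_on
      [set z : 'rV[R]_m * 'rV[R]_k |
        [/\ cod p z.1, cod q z.2 & dom (f p q) (f (chartV p z.1) (chartV q z.2))]]
      (fun z : 'rV[R]_m * 'rV[R]_k =>
         chart (f p q) (f (chartV p z.1) (chartV q z.2))).

(* The differential T_p M -> T_(f p) N. *)
Definition tdiff (R : realType) (m k : nat) (M : manifold R m)
    (N : manifold R k) (f : M -> N) (p : M) : 'rV[R]_m -> 'rV[R]_k :=
  'd (chart (f p) \o f \o chartV p) (chart p p).

(* For q in [dom p], the differential at q of the chart at p, from T_q M to
   'rV[R]_m, and its inverse. *)
Definition dchart (R : realType) (m : nat) (M : manifold R m) (p q : M)
    : 'rV[R]_m -> 'rV[R]_m :=
  'd (chart p \o chartV q) (chart q q).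

Definition dchartV (R : realType) (m : nat) (M : manifold R m) (p q : M)
    : 'rV[R]_m -> 'rV[R]_m :=
  'd (chart q \o chartV p) (chart p q).

(** * Tensor fields *)

Definition smooth_fun (R : realType) (m : nat) (M : manifold R m)
    (f : M -> R) : Prop :=
  forall p, smooth_on (cod p) (fun u => f (chartV p u) : R^o).

Definition vfield (R : realType) (m : nat) (M : manifold R m) : Type :=
  M -> 'rV[R]_m.

Definition vfield_in_chart (R : realType) (m : nat) (M : manifold R m)
    (X : vfield M) (p : M) (u : 'rV[R]_m) : 'rV[R]_m :=
  dchart p (chartV p u) (X (chartV p u)).

Definition smooth_vfield (R : realType) (m : nat) (M : manifold R m)
    (X : vfield M) : Prop :=
  forall p, smooth_on (cod p) (vfield_in_chart X p).

(* X f *)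
Definition vderive (R : realType) (m : nat) (M : manifold R m)
    (X : vfield M) (f : M -> R) (p : M) : R :=
  'd (fun u => f (chartV p u) : R^o) (chart p p) (X p).

(* [X, Y] f = X (Y f) - Y (X f) *)
Definition lie_bracket (R : realType) (m : nat) (M : manifold R m)
    (X Y : vfield M) : vfield M :=
  fun p => 'd (vfield_in_chart Y p) (chart p p) (X p)
         - 'd (vfield_in_chart X p) (chart p p) (Y p).

Definition tensor2 (R : realType) (m : nat) (M : manifold R m) : Type :=
  M -> 'rV[R]_m -> 'rV[R]_m -> R.

Definition smooth_tensor2 (R : realType) (m : nat) (M : manifold R m)
    (b : tensor2 M) : Prop :=
  (forall p u, scalar (b p u)) /\ (forall p v, scalar (b p ^~ v)) /\
  forall p v w,
    smooth_on (cod p)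
      (fun u => b (chartV p u) (dchartV p (chartV p u) v)
                               (dchartV p (chartV p u) w) : R^o).

Definition endo_field (R : realType) (m : nat) (M : manifold R m) : Type :=
  M -> 'rV[R]_m -> 'rV[R]_m.

Definition smooth_endo_field (R : realType) (m : nat) (M : manifold R m)
    (J : endo_field M) : Prop :=
  (forall p, linear (J p)) /\
  forall p v,
    smooth_on (cod p)
      (fun u => dchart p (chartV p u)
                  (J (chartV p u) (dchartV p (chartV p u) v))).

Definition endo_vfield (R : realType) (m : nat) (M : manifold R m)
    (J : endo_field M) (X : vfield M) : vfield M :=
  fun p => J p (X p).

(* Trace of a linear endomorphism of 'rV[R]_k. *)
Definition trace (R : realType) (k : nat) (f : 'rV[R]_k -> 'rV[R]_k) : R :=
  \tr (lin1_mx f).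

(** * Almost Kaehler structures *)

(* The last condition is d om = 0. *)
Definition symplectic_form (R : realType) (m : nat) (M : manifold R m)
    (om : tensor2 M) : Prop :=
  [/\ smooth_tensor2 om,
      forall p u v, om p u v = - om p v u,
      forall p u, (forall v, om p u v = 0) -> u = 0
    & forall X Y Z : vfield M,
        smooth_vfield X -> smooth_vfield Y -> smooth_vfield Z ->
        forall p,
          vderive X (fun q => om q (Y q) (Z q)) p
        - vderive Y (fun q => om q (X q) (Z q)) p
        + vderive Z (fun q => om q (X q) (Y q)) p
        - om p (lie_bracket X Y p) (Z p)
        + om p (lie_bracket X Z p) (Y p)
        - om p (lie_bracket Y Z p) (X p) = 0].

Definition compatible_acs (R : realType) (m : nat) (M : manifold R m)
    (om : tensor2 M) (J : endo_field M) : Prop :=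
  [/\ smooth_endo_field J,
      forall p v, J p (J p v) = - v,
      forall p u v, om p (J p u) (J p v) = om p u v
    & forall p v, v != 0 -> 0 < om p v (J p v)].

Definition metric (R : realType) (m : nat) (M : manifold R m)
    (om : tensor2 M) (J : endo_field M) : tensor2 M :=
  fun p u v => om p u (J p v).

(** * Chern connection and curvature *)

Definition connection (R : realType) (m : nat) (M : manifold R m)
    (nabla : vfield M -> vfield M -> vfield M) : Prop :=
  (forall X Y, smooth_vfield X -> smooth_vfield Y -> smooth_vfield (nabla X Y)) /\
  (forall X Y Z : vfield M,
     smooth_vfield X -> smooth_vfield Y -> smooth_vfield Z -> forall p,
     nabla (fun q => X q + Y q) Z p = nabla X Z p + nabla Y Z p) /\
  (forall X Y Z : vfield M,
     smooth_vfield X -> smooth_vfield Y -> smooth_vfield Z -> forall p,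
     nabla X (fun q => Y q + Z q) p = nabla X Y p + nabla X Z p) /\
  (forall (f : M -> R) (X Y : vfield M),
     smooth_fun f -> smooth_vfield X -> smooth_vfield Y -> forall p,
     nabla (fun q => f q *: X q) Y p = f p *: nabla X Y p) /\
  (forall (f : M -> R) (X Y : vfield M),
     smooth_fun f -> smooth_vfield X -> smooth_vfield Y -> forall p,
     nabla X (fun q => f q *: Y q) p
     = vderive X f p *: Y p + f p *: nabla X Y p).

Definition nijenhuis (R : realType) (m : nat) (M : manifold R m)
    (J : endo_field M) (X Y : vfield M) : vfield M :=
  let JX := endo_vfield J X in
  let JY := endo_vfield J Y in
  fun p => 4^-1 *: (lie_bracket JX JY p - J p (lie_bracket JX Y p)
                    - J p (lie_bracket X JY p) - lie_bracket X Y p).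

Definition chern_connection (R : realType) (m : nat) (M : manifold R m)
    (om : tensor2 M) (J : endo_field M)
    (nabla : vfield M -> vfield M -> vfield M) : Prop :=
  let g := metric om J in
  [/\ connection nabla,
      forall X Y Z : vfield M,
        smooth_vfield X -> smooth_vfield Y -> smooth_vfield Z -> forall p,
        vderive X (fun q => g q (Y q) (Z q)) p
        = g p (nabla X Y p) (Z p) + g p (Y p) (nabla X Z p)
    & forall X Y : vfield M, smooth_vfield X -> smooth_vfield Y -> forall p,
        nabla X Y p - nabla Y X p - lie_bracket X Y p = nijenhuis J X Y p].

(* [Rm p u v w] stands for R(u, v) w. Every tangent vector extends to a global
   smooth vector field, so the condition determines [Rm], and it has a solution
   for every connection since its right-hand side is tensorial. *)
Definition curvature_tensor (R : realType) (m : nat) (M : manifold R m)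
    (nabla : vfield M -> vfield M -> vfield M)
    (Rm : M -> 'rV[R]_m -> 'rV[R]_m -> 'rV[R]_m -> 'rV[R]_m) : Prop :=
  forall X Y Z : vfield M,
    smooth_vfield X -> smooth_vfield Y -> smooth_vfield Z -> forall p,
    Rm p (X p) (Y p) (Z p)
    = nabla X (nabla Y Z) p - nabla Y (nabla X Z) p
      - nabla (lie_bracket X Y) Z p.

Definition chern_ricci_form (R : realType) (m : nat) (M : manifold R m)
    (J : endo_field M)
    (Rm : M -> 'rV[R]_m -> 'rV[R]_m -> 'rV[R]_m -> 'rV[R]_m) : tensor2 M :=
  fun p u v => trace (fun w => J p (Rm p u v w)).

(** * Exterior powers and the Hermitian scalar curvature *)

(* A k-form on 'rV[R]_m as a function of k vectors. *)
Definition form (R : realType) (m k : nat) : Type := ('I_k -> 'rV[R]_m) -> R.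

Definition wedge (R : realType) (m k l : nat) (a : form R m k) (b : form R m l)
    : form R m (k + l) :=
  fun v => ((k`! * l`!)%N%:R)^-1 *
    \sum_(t : 'S_(k + l))
      (-1) ^+ t * a (fun i => v (t (lshift l i))) * b (fun j => v (t (rshift k j))).

Definition form_of (R : realType) (m : nat) (b : 'rV[R]_m -> 'rV[R]_m -> R)
    : form R m 2 :=
  fun v => b (v ord0) (v ord_max).

(* The k-th exterior power of a 2-form; its degree (k'.+1 * 2) is convertible
   to 2 + k' * 2. *)
Fixpoint wedge_pow (R : realType) (m : nat) (b : 'rV[R]_m -> 'rV[R]_m -> R)
    (k : nat) : form R m (k * 2) :=
  match k with
  | 0 => fun _ => 1
  | k'.+1 => wedge (form_of b) (@wedge_pow R m b k')
  end.

Arguments wedge_pow {R m} b k.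

(* s om^(n+1) = (n+1) rho /\ om^n, where M has dimension 2 (n+1). *)
Definition hermitian_scalar_curvature (R : realType) (n : nat)
    (M : manifold R (n.+1 + n.+1)) (om rho : tensor2 M) (s : M -> R) : Prop :=
  forall p (v : 'I_(n.+1 * 2) -> 'rV[R]_(n.+1 + n.+1)),
    s p * wedge_pow (om p) n.+1 v
    = n.+1%:R * wedge (form_of (rho p)) (wedge_pow (om p) n) v.

(** * Lie groups *)

Record lie_group (R : realType) (d : nat) := LieGroup {
  lg_manifold :> manifold R d;
  lg_mul : lg_manifold -> lg_manifold -> lg_manifold;
  lg_inv : lg_manifold -> lg_manifold;
  lg_one : lg_manifold;
  lg_mulA : associative lg_mul;
  lg_mul1 : left_id lg_one lg_mul;
  lg_mulV : left_inverse lg_one lg_inv lg_mul;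
  lg_mul_smooth : smooth_map2 lg_mul;
  lg_inv_smooth : smooth_map lg_inv
}.

Arguments lg_one {R d} l.

(* The Lie algebra of G is its tangent space 'rV[R]_d at the identity, with the
   bracket of left-invariant vector fields. *)
Definition left_invariant (R : realType) (d : nat) (G : lie_group R d)
    (X : 'rV[R]_d) : vfield G :=
  fun a => tdiff (fun b : G => lg_mul a b) (lg_one G) X.

Arguments left_invariant {R d} G X.

Definition lie_alg_bracket (R : realType) (d : nat) (G : lie_group R d)
    (X Y : 'rV[R]_d) : 'rV[R]_d :=
  lie_bracket (left_invariant G X) (left_invariant G Y) (lg_one G).

Definition Ad (R : realType) (d : nat) (G : lie_group R d) (a : G)
    : 'rV[R]_d -> 'rV[R]_d :=
  tdiff (fun b : G => lg_mul (lg_mul a b) (lg_inv a)) (lg_one G).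

(* c t = exp (t X); a continuous homomorphism from R to a Lie group is
   automatically smooth. *)
Definition one_parameter_subgroup (R : realType) (d : nat) (G : lie_group R d)
    (X : 'rV[R]_d) (c : R -> G) : Prop :=
  [/\ continuous c,
      forall t u, c (t + u) = lg_mul (c t) (c u)
    & is_derive (0 : R^o) (1 : R^o)
        (fun t : R^o => chart (lg_one G) (c t)) X].

(* The Lie algebra of a closed subgroup K: all X with exp (t X) in K for all t. *)
Definition lie_subalg (R : realType) (d : nat) (G : lie_group R d) (K : set G)
    : set 'rV[R]_d :=
  [set X | exists2 c, one_parameter_subgroup X c & forall t, K (c t)].

(** * Homogeneous almost Kaehler manifolds *)

Definition smooth_action (R : realType) (d m : nat) (G : lie_group R d)
    (M : manifold R m) (act : G -> M -> M) : Prop :=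
  [/\ smooth_map2 act,
      forall z, act (lg_one G) z = z
    & forall a b z, act (lg_mul a b) z = act a (act b z)].

Definition transitive_action (G M : Type) (act : G -> M -> M) : Prop :=
  forall z w, exists a, act a z = w.

Definition normal_subgroup (R : realType) (d : nat) (G : lie_group R d)
    (N : set G) : Prop :=
  [/\ N (lg_one G),
      forall a b, N a -> N b -> N (lg_mul a b),
      forall a, N a -> N (lg_inv a)
    & forall a b, N b -> N (lg_mul (lg_mul a b) (lg_inv a))].

Definition discrete_subset (T : topologicalType) (A : set T) : Prop :=
  forall a, A a -> exists2 U, open U & U `&` A = [set a].

Definition almost_effective (R : realType) (d m : nat) (G : lie_group R d)
    (M : manifold R m) (act : G -> M -> M) : Prop :=
  forall N : set G, normal_subgroup N ->
    (forall a, N a -> forall z, act a z = z) -> discrete_subset N.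

Definition preserves_form (R : realType) (d m : nat) (G : lie_group R d)
    (M : manifold R m) (act : G -> M -> M) (om : tensor2 M) : Prop :=
  forall a z u v,
    om (act a z) (tdiff (act a) z u) (tdiff (act a) z v) = om z u v.

Definition preserves_acs (R : realType) (d m : nat) (G : lie_group R d)
    (M : manifold R m) (act : G -> M -> M) (J : endo_field M) : Prop :=
  forall a z u, tdiff (act a) z (J z u) = J (act a z) (tdiff (act a) z u).

Definition isotropy (R : realType) (d m : nat) (G : lie_group R d)
    (M : manifold R m) (act : G -> M -> M) (x : M) : set G :=
  [set a | act a x = x].

(* The value at z of the vector field on M induced by X, i.e. the velocity at
   t = 0 of t |-> exp (t X) z: the image of X, the velocity of exp (t X), under
   the differential at the identity of the orbit map a |-> a z. *)
Definition induced_vfield (R : realType) (d m : nat) (G : lie_group R d)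
    (M : manifold R m) (act : G -> M -> M) (X : 'rV[R]_d) : vfield M :=
  fun z => tdiff (act ^~ z) (lg_one G) X.

(* mm is an Ad_K-invariant complement of the Lie algebra of K. *)
Definition reductive_complement (R : realType) (d : nat) (G : lie_group R d)
    (K : set G) (mm : {vspace 'rV[R]_d}) : Prop :=
  [/\ forall X, exists Y Z, [/\ lie_subalg K Y, Z \in mm & X = Y + Z],
      forall X, lie_subalg K X -> X \in mm -> X = 0
    & forall a X, K a -> X \in mm -> Ad a X \in mm].

(* sigma: the form om_x carried over to mm by evaluation at x. *)
Definition induced_form (R : realType) (d m : nat) (G : lie_group R d)
    (M : manifold R m) (act : G -> M -> M) (om : tensor2 M) (x : M)
    (X Y : 'rV[R]_d) : R :=
  om x (induced_vfield act X x) (induced_vfield act Y x).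

(* H: J_x carried over to mm by evaluation at x, extended by zero on the Lie
   algebra of the isotropy group. *)
Definition induced_acs (R : realType) (d m : nat) (G : lie_group R d)
    (M : manifold R m) (act : G -> M -> M) (J : endo_field M) (x : M)
    (mm : {vspace 'rV[R]_d}) (H : 'rV[R]_d -> 'rV[R]_d) : Prop :=
  [/\ linear H,
      forall X, lie_subalg (isotropy act x) X -> H X = 0,
      forall X, X \in mm -> H X \in mm
    & forall X, X \in mm ->
        induced_vfield act (H X) x = J x (induced_vfield act X x)].

(* Indices run from 0, so that e_(i+n) is paired with e_i for i < n. *)
Definition symplectic_basis (R : realType) (d n : nat)
    (sigma : 'rV[R]_d -> 'rV[R]_d -> R) (mm : {vspace 'rV[R]_d})
    (e : 'I_(n + n) -> 'rV[R]_d) : Prop :=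
  basis_of mm (codom e) /\
  forall i j : 'I_(n + n), (i < j)%N ->
    sigma (e i) (e j) = if (j == i + n :> nat)%N then 1 else 0.

(* Main.v *)
Require Import Defs.
From HB Require Import structures.
From mathcomp Require Import all_boot all_order all_algebra all_fingroup.
From mathcomp Require Import all_classical all_reals all_analysis.
From mathcomp Require Import ring lra zify.
Import Order.TTheory GRing.Theory Num.Theory.
Import numFieldNormedType.Exports.
Local Open Scope classical_set_scope.
Local Open Scope ring_scope.
Set Implicit Arguments.
Unset Strict Implicit.
Unset Printing Implicit Defensive.
Import Defs.

(* Write X' for the field induced by X in g and D_X = nabla_X' - L_X'. Since
   L_X' preserves om, J and hence nabla, the endomorphism D_X is tensorial,
   commutes with J (d om = 0 and the torsion condition force nabla J = 0), is
   skew for om, and R(X', Y') = [D_X, D_Y] - D_[X,Y]. As tr (J [D_X, D_Y]) = 0,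
   rho(X', Y') = - tr (J D_[X,Y]). The torsion identity
   D_X Y' - D_Y X' = N(X', Y') + [X,Y]' turns tr (J D_Z), computed in a symplectic
   basis, into om(Z', J xi') plus the trace over m of J o ad_Z, the Nijenhuis
   terms vanishing because they anticommute with J. Contracting rho with om gives
   s = - om(xi', J xi') - tr (H ad_xi), and the first term is tr ad_(H xi) by
   d om = 0 and [k, m] in m. The fields X' span every tangent space, so no
   tangent vector has to be extended by a cut-off. *)

(** * Differentials and C^k maps *)

(** A connection acts here on global smooth fields only, so pointwise statements about it have to be
    obtained without local frames. Tensoriality and invariance of nabla both come from the Koszul
    formula with torsion: at a zero of a field its terms vanish or cancel, and on induced fields
    every derivative in it turns into a bracket. The curvature computation uses the invariance of om
    and J in infinitesimal form, obtained without flows by differentiating an identity in a fixed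
    chart with respect to the group variable; the symmetry of second derivatives carries the
    argument. The map X |-> X' reverses brackets, [X', Y'] = - [X, Y]', because a left action is
    generated by right-invariant fields; this is the source of the signs in the curvature formula.
    The inclusion of [k, m] in m rests on the derivative of Ad at the identity being ad, which is
    why left- and right-invariant fields are compared in a chart. Constancy of s is not proved
    separately: the computation is made at every point a x, with the frame Ad_a e_i, and each term
    is carried back to x. *)

Section Differentials.
Variable R : realType.
Implicit Types V W U : normedModType R.

Lemma near_eq_differentiable V W (f g : V -> W) (u : V) :
  (\forall z \near u, f z = g z) -> differentiable f u ->
  differentiable g u /\ 'd g u = 'd f u :> (V -> W).
Proof.
move=> fg df.
have fgu : f u = g u := nbhs_singleton fg.
have E : g \o shift u = cst (g u) + 'd f u +o_ 0 id.
  apply/eqaddoP => e e0.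
  have /eqaddoP/(_ e e0) := diff_locally df.
  have fg' : \forall z \near 0, f (z + u) = g (z + u).
    by move: fg; rewrite (near_shift 0 u) subr0.
  move=> fo; near=> z.
  have -> : (g \o shift u - (cst (g u) + 'd f u)) z =
            (f \o shift u - (cst (f u) + 'd f u)) z.
    rewrite /= -fgu; congr (_ - _); rewrite /shift /=; symmetry.
    by near: z.
  by near: z.
have dE : 'd g u = 'd f u :> (V -> W).
  by apply: diff_unique E => //; exact: diff_continuous.
split => //; apply/diff_locallyP; rewrite dE; split => //.
exact: diff_continuous.
Unshelve. all: by end_near. Qed.

Lemma differentiable_lin V W (f : V -> W) u : linear f -> continuous f ->
  differentiable f u /\ 'd f u = f :> (V -> W).
Proof.
move=> lf cf; pose fM := GRing.isLinear.Build _ _ _ _ _ lf.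
pose fL : {linear _ -> _} := HB.pack f fM.
by split; [exact: (@linear_differentiable _ _ _ fL) | exact: (@diff_lin _ _ _ fL)].
Qed.

Lemma scaler_is_bilinear W : bilinear_for
    (GRing.Scale.Law.clone _ _ *:%R _) (GRing.Scale.Law.clone _ _ *:%R _)
    (fun (a : R^o) (w : W) => a *: w).
Proof.
split=> [u'|u] a x y /=; first by rewrite scalerDl scalerA.
by rewrite scalerDr !scalerA mulrC.
Qed.

Lemma differentiable_scale V W (a : V -> R^o) (f : V -> W) u :
  differentiable a u -> differentiable f u ->
  differentiable (fun x => a x *: f x) u /\
  forall v, 'd (fun x => a x *: f x) u v = 'd a u v *: f u + a u *: 'd f u v.
Proof.
move=> da df.
pose sM := bilinear_isBilinear.Build R R^o W W _ _ _ (scaler_is_bilinear W).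
pose s : {bilinear R^o -> W -> W} := HB.pack (fun (a : R^o) (w : W) => a *: w) sM.
have cs : continuous (fun p : R^o * W => s p.1 p.2).
  by move=> p; apply: (@scale_continuous R W).
have ds := differentiable_bilin (a u, f u) cs.
have dp := differentiable_pair da df.
have -> : (fun x => a x *: f x) = (fun p => s p.1 p.2) \o (fun x => (a x, f x)) by [].
split=> [|v]; first exact: differentiable_comp.
rewrite diff_comp //.
transitivity ('d (fun p => s p.1 p.2) (a u, f u) ('d (fun x => (a x, f x)) u v)) => //.
by rewrite (diff_bilin _ cs) (diff_pair da df) /= addrC.
Qed.

Lemma differentiable_sumD V W n (F : 'I_n -> V -> W) u :
  (forall i, differentiable (F i) u) ->
  differentiable (fun x => \sum_i F i x) u /\
  forall v, 'd (fun x => \sum_i F i x) u v = \sum_i 'd (F i) u v.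
Proof.
elim: n F => [|n IH] F dF.
  have -> : (fun x => \sum_(i < 0) F i x) = cst 0.
    by apply/funext => x; rewrite big_ord0.
  split=> [|v]; first exact: differentiable_cst.
  by rewrite diff_cst big_ord0.
have -> : (fun x => \sum_(i < n.+1) F i x) =
    F ord0 + (fun x => \sum_(i < n) F (lift ord0 i) x).
  by apply/funext => x; rewrite big_ord_recl.
have [d1 d2] := IH (fun i => F (lift ord0 i)) (fun i => dF _).
split=> [|v]; first exact: differentiableD.
by rewrite (diffD (dF ord0) d1) big_ord_recl -d2.
Qed.

(* ['d f u] elaborated at a matrix type carries other (convertible) topological
   structures than an instance of a lemma about abstract normed spaces, and
   unifying the two is intractable: [dfb] and [dif] hide them. *)
Definition dfb V W (f : V -> W) (u : V) : Prop := differentiable f u.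
Definition dif V W (f : V -> W) (u v : V) : W := 'd f u v.

Lemma dif_is_linear V W (f : V -> W) u : linear (dif f u).
Proof. by move=> a v w; rewrite /dif linearP. Qed.

Lemma difD V W (f : V -> W) u v w : dif f u (v + w) = dif f u v + dif f u w.
Proof. by rewrite /dif linearD. Qed.

Lemma difB V W (f : V -> W) u v w : dif f u (v - w) = dif f u v - dif f u w.
Proof. by rewrite /dif linearB. Qed.

Lemma difN V W (f : V -> W) u v : dif f u (- v) = - dif f u v.
Proof. by rewrite /dif linearN. Qed.

Lemma difZ V W (f : V -> W) u a v : dif f u (a *: v) = a *: dif f u v.
Proof. by rewrite /dif linearZ. Qed.

Lemma dif0 V W (f : V -> W) u : dif f u 0 = 0.
Proof. by rewrite /dif linear0. Qed.

Lemma dif_sum V W (f : V -> W) u n (F : 'I_n -> V) :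
  dif f u (\sum_i F i) = \sum_i dif f u (F i).
Proof. by rewrite /dif linear_sum. Qed.

Lemma dfb_near V W (f g : V -> W) (u : V) : (\forall z \near u, f z = g z) ->
  dfb f u -> dfb g u /\ forall v, dif g u v = dif f u v.
Proof.
by move=> fg df; have [? E] := near_eq_differentiable fg df; split=> // v; rewrite /dif E.
Qed.

Lemma dfb_lin V W (f : V -> W) u : linear f -> continuous f ->
  dfb f u /\ forall v, dif f u v = f v.
Proof.
by move=> lf cf; have [? E] := differentiable_lin u lf cf; split=> // v; rewrite /dif E.
Qed.

Lemma dfb_id V (u : V) : dfb id u /\ forall v, dif id u v = v.
Proof. by apply: (@dfb_lin _ _ (id : V -> V)) => // z; exact: cvg_id. Qed.

Lemma dfb_cst V W (w : W) (u : V) : dfb (cst w) u /\ forall v, dif (cst w) u v = 0.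
Proof. by split=> [|v]; [exact: differentiable_cst | rewrite /dif (@diff_cst _ V W w u)]. Qed.

Lemma dfb_comp U V W (f : U -> V) (g : V -> W) u : dfb f u -> dfb g (f u) ->
  dfb (g \o f) u /\ forall v, dif (g \o f) u v = dif g (f u) (dif f u v).
Proof.
move=> df dg; split=> [|v]; first exact: differentiable_comp.
by rewrite /dif (diff_comp df dg).
Qed.

Lemma dfb_add V W (f g : V -> W) u : dfb f u -> dfb g u ->
  dfb (fun z => f z + g z) u /\
  forall v, dif (fun z => f z + g z) u v = dif f u v + dif g u v.
Proof.
move=> df dg; split=> [|v]; first exact: differentiableD.
by rewrite /dif (diffD df dg).
Qed.

Lemma dfb_sub V W (f g : V -> W) u : dfb f u -> dfb g u ->
  dfb (fun z => f z - g z) u /\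
  forall v, dif (fun z => f z - g z) u v = dif f u v - dif g u v.
Proof.
move=> df dg; split=> [|v]; first exact: differentiableB.
by rewrite /dif (diffB df dg).
Qed.

Lemma dfb_scale V W (a : V -> R^o) (f : V -> W) u : dfb a u -> dfb f u ->
  dfb (fun x => a x *: f x) u /\
  forall v, dif (fun x => a x *: f x) u v = dif a u v *: f u + a u *: dif f u v.
Proof. exact: differentiable_scale. Qed.

Lemma dfb_sum V W n (F : 'I_n -> V -> W) u : (forall i, dfb (F i) u) ->
  dfb (fun x => \sum_i F i x) u /\
  forall v, dif (fun x => \sum_i F i x) u v = \sum_i dif (F i) u v.
Proof. exact: differentiable_sumD. Qed.

Lemma dfb_pair U V W (f : U -> V) (g : U -> W) u : dfb f u -> dfb g u ->
  dfb (fun x => (f x, g x)) u /\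
  forall v, dif (fun x => (f x, g x)) u v = (dif f u v, dif g u v).
Proof.
move=> df dg; split=> [|v]; first exact: differentiable_pair.
by rewrite /dif (diff_pair df dg).
Qed.

End Differentials.

Section Smoothness.
Variable R : realType.
Implicit Types V W U : normedModType R.

(** Finite dimensionality in the form that the proofs consume. [Ck] controls derivatives along fixed
    directions only; expanding a moving direction in the vectors [b i] reduces it to those. *)
Definition fin_coords V : Prop :=
  exists N (b : 'I_N -> V) (c : 'I_N -> V -> R^o),
    (forall i, linear (c i) /\ continuous (c i)) /\
    forall v, v = \sum_i c i v *: b i.

Lemma CkS V W k (A : set V) (f : V -> W) : Ck k.+1 A f <->
  (forall u, A u -> dfb f u) /\ forall v, Ck k A (fun u => dif f u v).
Proof. by []. Qed.

Lemma Ck_dfb V W k (A : set V) (f : V -> W) u : Ck k.+1 A f -> A u -> dfb f u.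
Proof. by move=> [df _]; exact: df. Qed.

Lemma Ck_dif V W k (A : set V) (f : V -> W) v :
  Ck k.+1 A f -> Ck k A (fun u => dif f u v).
Proof. by move=> [_]; exact. Qed.

Lemma near_open (T : topologicalType) (A : set T) (P : T -> Prop) u :
  open A -> A u -> (forall z, A z -> P z) -> \forall z \near u, P z.
Proof. by move=> oA Au AP; apply: filterS AP _; exact: open_nbhs_nbhs. Qed.

Lemma dfb_near_open V W (A : set V) (f g : V -> W) u : open A -> A u ->
  (forall z, A z -> f z = g z) ->
  dfb f u -> dfb g u /\ forall v, dif g u v = dif f u v.
Proof. by move=> oA Au fg; apply: dfb_near; exact: (near_open oA Au). Qed.

Lemma Ck_sub V W k (A B : set V) (f : V -> W) :
  A `<=` B -> Ck k B f -> Ck k A f.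
Proof.
move=> AB; elim: k f => [|k IH] f /=; first by move=> h u /AB; exact: h.
by move=> [h1 h2]; split=> [u /AB|v]; [exact: h1 | exact: IH].
Qed.

Lemma Ck_eq V W k (A : set V) (f g : V -> W) :
  open A -> (forall u, A u -> f u = g u) -> Ck k A f -> Ck k A g.
Proof.
move=> oA; elim: k f g => [|k IH] f g fg /=.
  move=> cf u Au; rewrite /prop_for /continuous_at -(fg u Au).
  apply: cvg_trans (cf u Au); apply: near_eq_cvg.
  exact: (near_open oA Au).
move=> [df cf]; have E u : A u -> differentiable g u /\ 'd g u = 'd f u :> (V -> W).
  move=> Au; apply: near_eq_differentiable (df u Au).
  exact: (near_open oA Au).
split=> [u /E[]//|v].
by apply: IH (cf v) => u Au; have [_ ->] := E u Au.
Qed.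

Lemma CkW V W k (A : set V) (f : V -> W) : Ck k.+1 A f -> Ck k A f.
Proof.
elim: k f => [|k IH] f [df cf].
  by move=> u Au; apply: differentiable_continuous; exact: df.
by split=> // v; exact: IH.
Qed.

Lemma Ck_cst V W k (A : set V) (w : W) : Ck k A (cst w).
Proof.
elim: k w => [|k IH] w; first by move=> u _; exact: cst_continuous.
split=> [u _|v]; first exact: differentiable_cst.
have -> : (fun u => 'd (cst w) u v) = cst (0 : W).
  by apply/funext => u; rewrite (@diff_cst _ V W w u).
exact: IH.
Qed.

Lemma Ck_add V W k (A : set V) (f g : V -> W) : open A ->
  Ck k A f -> Ck k A g -> Ck k A (fun u => f u + g u).
Proof.
move=> oA; elim: k f g => [|k IH] f g.
  by move=> cf cg u Au; apply: cvgD; [exact: cf | exact: cg].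
move=> [df cf] [dg cg]; split=> [u Au|v].
  by apply: differentiableD; [exact: df | exact: dg].
apply: (@Ck_eq _ _ _ _ (fun u => 'd f u v + 'd g u v)) => //.
  by move=> u Au; exact: (esym ((dfb_add (df u Au) (dg u Au)).2 v)).
exact: (IH _ _ (cf v) (cg v)).
Qed.

Lemma Ck_scale V W k (A : set V) (a : V -> R^o) (f : V -> W) : open A ->
  Ck k A a -> Ck k A f -> Ck k A (fun u => a u *: f u).
Proof.
move=> oA; elim: k a f => [|k IH] a f.
  move=> ca cf u Au.
  apply: (@cvgZ R W V (nbhs u) _ a f (a u) (f u)); [exact: ca | exact: cf].
move=> [da ca] [df cf]; split=> [u Au|v].
  by have [] := differentiable_scale (da u Au) (df u Au).
apply: (@Ck_eq _ _ _ _ (fun u => 'd a u v *: f u + a u *: 'd f u v)) => //.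
  by move=> u Au; have [_ ->] := differentiable_scale (da u Au) (df u Au).
apply: Ck_add => //.
  by apply: (IH _ _ (ca v)); apply: CkW; split.
by apply: (IH a _ _ (cf v)); apply: CkW; split.
Qed.

Lemma Ck_sum V W k (A : set V) n (F : 'I_n -> V -> W) : open A ->
  (forall i, Ck k A (F i)) -> Ck k A (fun u => \sum_i F i u).
Proof.
move=> oA; elim: n F => [|n IH] F cF.
  apply: (@Ck_eq _ _ _ _ (cst 0)) => // [u _|]; first by rewrite big_ord0.
  exact: Ck_cst.
apply: (@Ck_eq _ _ _ _ (fun u => F ord0 u + \sum_(i < n) F (lift ord0 i) u)) => //.
  by move=> u _; rewrite big_ord_recl.
by apply: Ck_add => //; exact: IH.
Qed.

Lemma Ck_linear V W k (A : set V) (f : V -> W) :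
  linear f -> continuous f -> Ck k A f.
Proof.
move=> lf cf; case: k => [|k]; first by move=> u _; exact: cf.
split=> [u _|v]; first by have [] := differentiable_lin u lf cf.
have -> : (fun u => 'd f u v) = cst (f v).
  by apply/funext => u; have [_ ->] := differentiable_lin u lf cf.
exact: Ck_cst.
Qed.

Lemma Ck_linear_comp V W U k (A : set U) (l : V -> W) (f : U -> V) : open A ->
  linear l -> continuous l -> Ck k A f -> Ck k A (l \o f).
Proof.
move=> oA ll cl; elim: k f => [|k IH] f.
  by move=> cf u Au; apply: continuous_comp; [exact: cf | exact: cl].
move=> [df dcf]; split=> [u Au|v].
  by apply: differentiable_comp; [exact: df | have [] := differentiable_lin (f u) ll cl].
apply: (@Ck_eq _ _ _ _ (l \o (fun u => 'd f u v))) => // [u Au|]; last exact: (IH _ (dcf v)).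
have [dl El] := differentiable_lin (f u) ll cl.
by rewrite (diff_comp (df u Au) dl) /= El.
Qed.

(** In the chain rule the direction ['d f u v] moves with [u]. Its expansion in coordinates turns
    the derivative into a sum of scalar functions times ['d g y (b i)] composed with [f], and the
    induction applies to these. *)
Lemma Ck_comp V W U k (A : set U) (B : set V) (f : U -> V) (g : V -> W) :
  fin_coords V -> open A -> open B -> (forall u, A u -> B (f u)) ->
  Ck k A f -> Ck k B g -> Ck k A (g \o f).
Proof.
move=> [N [b [c [cP bP]]]] oA oB AB; elim: k g => [|k IH] g.
  by move=> cf cg u Au; apply: continuous_comp; [exact: cf | exact/cg/AB].
move=> cf [dg cg]; have [df dcf] := cf; split=> [u Au|v].
  by apply: differentiable_comp; [exact: df | exact/dg/AB].
apply: (@Ck_eq _ _ _ _ (fun u => \sum_i c i ('d f u v) *: 'd g (f u) (b i))) => //.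
  move=> u Au; rewrite (diff_comp (df u Au) (dg _ (AB _ Au))) /=.
  rewrite {2}(bP ('d f u v)) linear_sum; apply: eq_bigr => i _.
  by rewrite linearZ.
apply: Ck_sum => // i; apply: Ck_scale => //.
  have [li ci] := cP i; exact: (Ck_linear_comp oA li ci (dcf v)).
exact: (IH (fun y => 'd g y (b i)) (CkW cf) (cg (b i))).
Qed.

Lemma linear_inl V W : linear (fun v : V => (v, 0) : V * W).
Proof. by move=> a x y; apply: injective_projections; rewrite /= ?scaler0 ?addr0. Qed.

Lemma linear_inr V W : linear (fun w : W => (0, w) : V * W).
Proof. by move=> a x y; apply: injective_projections; rewrite /= ?scaler0 ?addr0. Qed.

Lemma continuous_inl V W : continuous (fun v : V => (v, 0) : V * W).
Proof. by move=> v; apply: cvg_pair => //; exact: cvg_cst. Qed.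

Lemma continuous_inr V W : continuous (fun w : W => (0, w) : V * W).
Proof. by move=> v; apply: cvg_pair => //; exact: cvg_cst. Qed.

Lemma Ck_pair V W U k (A : set U) (f : U -> V) (g : U -> W) : open A ->
  Ck k A f -> Ck k A g -> Ck k A (fun u => (f u, g u)).
Proof.
move=> oA cf cg.
apply: (@Ck_eq _ _ _ _ (fun u => (f u, 0) + (0, g u))) => //.
  by move=> u _; apply: injective_projections; rewrite /= ?addr0 ?add0r.
apply: Ck_add => //.
  exact: (Ck_linear_comp oA (@linear_inl V W) (@continuous_inl V W)).
exact: (Ck_linear_comp oA (@linear_inr V W) (@continuous_inr V W)).
Qed.

Lemma linear_coord m n i j : linear (fun A : 'M[R]_(m, n) => A i j : R^o).
Proof. by move=> a x y; rewrite !mxE. Qed.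

Lemma fin_coords_rV m : fin_coords 'rV[R]_m.
Proof.
exists m, (fun i => delta_mx 0 i), (fun i (v : 'rV[R]_m) => v 0 i : R^o); split.
  by move=> i; split; [exact: linear_coord | exact: coord_continuous].
by move=> v; rewrite {1}(row_sum_delta v).
Qed.

Lemma fin_coords_prod V W : fin_coords V -> fin_coords W -> fin_coords (V * W)%type.
Proof.
move=> [N [b [c [cP bP]]]] [N' [b' [c' [cP' bP']]]].
exists (N + N')%N, (fun i : 'I_(N + N') => match fintype.split i with inl j => (b j, 0) | inr j => (0, b' j) end),
  (fun i (z : V * W) => match fintype.split i with inl j => c j z.1 | inr j => c' j z.2 end); split.
  move=> i; case: (fintype.split i) => j.
    have [lj cj] := cP j; split=> [a x y|z]; first exact: lj.
    by apply: (continuous_comp (@cvg_fst _ _ (nbhs z.1) (nbhs z.2) _)); exact: cj.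
  have [lj cj] := cP' j; split=> [a x y|z]; first exact: lj.
  by apply: (continuous_comp (@cvg_snd _ _ (nbhs z.1) (nbhs z.2) _)); exact: cj.
move=> [v w]; rewrite big_split_ord /=.
under eq_bigr => i _ do rewrite (unsplitK (inl i)).
under [X in _ = _ + X]eq_bigr => i _ do rewrite (unsplitK (inr i)).
rewrite {1}(bP v) {1}(bP' w).
pose li := GRing.isLinear.Build _ _ _ _ _ (@linear_inl V W).
pose lL : {linear V -> (V * W)%type} := HB.pack (fun v : V => (v, 0) : V * W) li.
pose ri := GRing.isLinear.Build _ _ _ _ _ (@linear_inr V W).
pose rL : {linear W -> (V * W)%type} := HB.pack (fun v : W => (0, v) : V * W) ri.
have -> : \sum_i c i v *: ((b i, 0) : V * W) = lL (\sum_i c i v *: b i).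
  by rewrite linear_sum; apply: eq_bigr => i _; rewrite linearZ.
have -> : \sum_i c' i w *: ((0, b' i) : V * W) = rL (\sum_i c' i w *: b' i).
  by rewrite linear_sum; apply: eq_bigr => i _; rewrite linearZ.
by apply: injective_projections; rewrite /= ?addr0 ?add0r.
Qed.

End Smoothness.

(** * Symmetry of second derivatives *)

Section Symmetry.
Variable R : realType.
Implicit Types V W U : normedModType R.

Lemma is_derive_path V W (f : V -> W) u v (s : R) :
  differentiable f (u + s *: v) ->
  is_derive s 1 (fun t : R => f (u + t *: v)) ('d f (u + s *: v) v).
Proof.
move=> df.
pose l (t : R) : V := t *: v.
have ll : linear l by move=> a x y; rewrite /l scalerDl scalerA.
have cl : continuous l by move=> x; exact: scalel_continuous.
have [dl El] := differentiable_lin (s : R) ll cl.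
have dc : differentiable (cst u + l) s.
  exact: differentiableD.
have dfl : differentiable (f \o (cst u + l)) s.
  by apply: differentiable_comp.
have -> : (fun t : R => f (u + t *: v)) = f \o (cst u + l) by [].
apply: DeriveDef; first exact: diff_derivable.
rewrite deriveE // (diff_comp dc df) /=; congr ('d f _ _).
rewrite diffD //=.
by rewrite diff_cst El /= add0r /l scale1r.
Qed.

Lemma mvt_path V (f : V -> R^o) u v (h : R) : 0 <= h ->
  (forall s, 0 <= s <= h -> differentiable f (u + s *: v)) ->
  exists2 s, 0 <= s <= h & f (u + h *: v) - f u = 'd f (u + s *: v) v * h.
Proof.
move=> h0 df.
have D s : 0 <= s <= h -> is_derive s 1 (fun t : R => f (u + t *: v) : R) ('d f (u + s *: v) v).
  by move=> sh; apply: is_derive_path; exact: df.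
have [|| c] := @MVT_segment R (fun t : R => f (u + t *: v)) (fun s => 'd f (u + s *: v) v) 0 h h0.
- by move=> s; rewrite in_itv /= => /andP[s0 sh]; apply: D; rewrite !ltW.
- apply: derivable_within_continuous => s; rewrite in_itv /= => sh.
  by have [] := D s sh.
by rewrite in_itv /= scale0r addr0 subr0 => ch E; exists c.
Qed.

(** The mean value theorem is applied along [v] to the difference of [f] at [z + h w] and at [z],
    and once more along [w] to the derivative of [f] along [v]. The value of the left side does not
    change when [v] and [w] are exchanged, which is what makes it useful. *)
Lemma second_difference V (A : set V) (f : V -> R^o) u v w (h : R) : 0 <= h ->
  (forall s t, 0 <= s <= h -> 0 <= t <= h -> A (u + s *: v + t *: w)) ->
  Ck 2 A f ->
  exists s t, [/\ 0 <= s <= h, 0 <= t <= h &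
    f (u + h *: v + h *: w) - f (u + h *: v) - f (u + h *: w) + f u =
    'd (fun z => 'd f z v : R^o) (u + s *: v + t *: w) w * h * h].
Proof.
move=> h0 hA [df ddf].
have hh : 0 <= h <= h by rewrite h0 lexx.
have h00 : (0 : R) <= 0 <= h by rewrite h0 lexx.
have shf z : differentiable f (z + h *: w) ->
    differentiable (fun z => f (z + h *: w)) z /\
    'd (fun z => f (z + h *: w)) z v = 'd f (z + h *: w) v.
  move=> dfz.
  have ds : differentiable (id + cst (h *: w)) z.
    exact: differentiableD.
  have -> : (fun z => f (z + h *: w)) = f \o (id + cst (h *: w)) by [].
  split; first exact: differentiable_comp.
  rewrite (diff_comp ds dfz) /=; congr ('d f _ _).
  rewrite diffD //=.
  by rewrite diff_cst diff_val /= addr0.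
pose g z := f (z + h *: w) - f z.
have dg s : 0 <= s <= h -> differentiable g (u + s *: v) /\
    'd g (u + s *: v) v = 'd f (u + s *: v + h *: w) v - 'd f (u + s *: v) v.
  move=> sh.
  have d1 : differentiable f (u + s *: v + h *: w) by apply: df; exact: hA.
  have d2 : differentiable f (u + s *: v).
    by apply: df; have := hA s 0 sh h00; rewrite scale0r addr0.
  have [d3 E3] := shf _ d1.
  by split; [exact: differentiableB | rewrite (diffB d3 d2) -E3].
have [s sh Es] := mvt_path h0 (fun s sh => (dg s sh).1).
rewrite (dg s sh).2 in Es.
have [t th Et] := @mvt_path V (fun z => 'd f z v) (u + s *: v) w h h0
  (fun t th => (ddf v).1 _ (hA s t sh th)).
exists s, t; split => //.
rewrite -Et -Es /g; lra.
Qed.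

(** Exchanging the two directions, one inequality is enough. If it failed, the common second
    difference over a small parallelogram would be close to both mixed derivatives at once. *)
Lemma diff_sym_scalar V (A : set V) (f : V -> R^o) u v w : open A -> A u ->
  Ck 2 A f ->
  'd (fun z => 'd f z v : R^o) u w = 'd (fun z => 'd f z w : R^o) u v :> R.
Proof.
move=> oA Au f2; have [df ddf] := f2.
apply/eqP; rewrite eq_le; apply/andP.
suff S a b : 'd (fun z => 'd f z b : R^o) u a <= ('d (fun z => 'd f z a : R^o) u b : R).
  by split.
move: v w => _ _; rename a into w, b into v.
rewrite leNgt; apply/negP => lt.
set x := ('d (fun z => 'd f z w : R^o) u v : R) in lt.
set y := ('d (fun z => 'd f z v : R^o) u w : R) in lt.
(* Half of the gap: no number lies at distance less than [e] from both [x] and [y]. *)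
pose e := (y - x) / 2.
have e0 : 0 < e by rewrite /e; lra.
have N1 : \forall z \near u, `|y - 'd (fun z => 'd f z v : R^o) z w| < e.
  have := (ddf v).2 w u Au.
  by move/cvgrPdist_lt => /(_ e e0).
have N2 : \forall z \near u, `|x - 'd (fun z => 'd f z w : R^o) z v| < e.
  have := (ddf w).2 v u Au.
  by move/cvgrPdist_lt => /(_ e e0).
have N3 : \forall z \near u, A z by exact: open_nbhs_nbhs.
have : \forall z \near u, [/\ `|y - 'd (fun z => 'd f z v : R^o) z w| < e,
   `|x - 'd (fun z => 'd f z w : R^o) z v| < e & A z] by near=> z; split; near: z.
move=> /nbhs_normP [r /= r0 rP].
(* The summand 1 keeps [c] positive when [v] and [w] vanish; with h c = r / 2 the whole
   parallelogram lies in the ball of radius [r]. *)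
pose c := `|v| + `|w| + 1.
have c0 : 0 < c by rewrite /c ltr_wpDl // addr_ge0.
pose h := r / (2 * c).
have h0 : 0 < h by rewrite divr_gt0 // mulr_gt0.
have B s t : 0 <= s <= h -> 0 <= t <= h ->
   `|u - (u + s *: v + t *: w)| < r.
  move=> /andP[s0 sh] /andP[t0 th]; rewrite /= -addrA opprD addNKr normrN.
  apply: (le_lt_trans (ler_normD _ _)); rewrite !normrZ !ger0_norm //.
  apply: (@le_lt_trans _ _ (h * c)).
    rewrite /c !mulrDr; apply: (@le_trans _ _ (h * `|v| + h * `|w|)).
      by apply: lerD; apply: ler_wpM2r.
    by rewrite lerDl mulr1 ltW.
  by rewrite /h invfM mulrA divfK ?gt_eqF //; lra.
have hA s t sh th := let: And3 _ _ Az := rP _ (B s t sh th) in Az.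
have B' s t : 0 <= s <= h -> 0 <= t <= h -> `|u - (u + s *: w + t *: v)| < r.
  by move=> sh th; rewrite [u + s *: w + t *: v]addrAC; exact: B.
have hA' s t sh th := let: And3 _ _ Az := rP _ (B' s t sh th) in Az.
have [s [t [sh th E]]] := second_difference (ltW h0) hA f2.
have [s' [t' [sh' th' E']]] := second_difference (ltW h0) hA' f2.
have [+ _ _] := rP _ (B s t sh th).
have [_ + _] := rP _ (B' s' t' sh' th').
set p := (X in `|x - X|); set q := (X in `|y - X|).
have : q * h * h = p * h * h.
  rewrite /p /q -E -E' [u + h *: w + h *: v]addrAC.
  exact: (congr1 (fun z => z + f u) (addrAC _ _ _)).
have hn : h != 0 by rewrite gt_eqF.
move=> /(mulIf hn) /(mulIf hn) ->.
rewrite !ltr_norml /e => /andP[h1 h2] /andP[h3 h4]; clear -h1 h2 h3 h4; lra.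
Unshelve. all: by end_near. Qed.

(** The scalar case applied to each coordinate of [f]. *)
Lemma dif_sym V W (A : set V) (f : V -> W) u v w : fin_coords W ->
  open A -> A u -> Ck 2 A f ->
  dif (fun z => dif f z v) u w = dif (fun z => dif f z w) u v.
Proof.
move=> [N [b [c [cP bP]]]] oA Au f2.
rewrite (bP (dif _ u w)) (bP (dif _ u v)); apply: eq_bigr => i _; congr (_ *: _).
have [ll cl] := cP i; set l := c i in ll cl *.
have dl B := dfb_lin B ll cl.
have [df /= ddf] := (CkS _ _ _).1 f2.
have E1 z a : A z -> dif (l \o f) z a = l (dif f z a).
  by move=> Az; rewrite (dfb_comp (df z Az) (dl _).1).2 (dl _).2.
have E2 a e : dif (fun z => dif (l \o f) z a) u e = l (dif (fun z => dif f z a) u e).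
  have d1 : dfb (fun z => dif f z a) u := (ddf a).1 u Au.
  have [d2 E2] := dfb_comp d1 (dl _).1.
  rewrite -(dl (dif f u a)).2 -E2.
  apply: (dfb_near _ d2).2.
  by apply: (near_open oA Au) => z Az; rewrite E1.
rewrite -!E2.
exact: (diff_sym_scalar v w oA Au (Ck_linear_comp oA ll cl f2)).
Qed.

End Symmetry.

Global Opaque dif dfb.

(** * Brackets of vector fields in coordinates *)

Section Brackets.
Variable R : realType.
Implicit Types V W U : normedModType R.

Lemma dfb_partial1 U V W (F : U * V -> W) a b : dfb F (a, b) ->
  dfb (fun v => F (v, b)) a /\
  forall x, dif (fun v => F (v, b)) a x = dif F (a, b) (x, 0).
Proof.
move=> dF; have [di Ei] := dfb_id a; have [dc Ec] := dfb_cst b a.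
have [dp Ep] := dfb_pair di dc.
have [d E] := @dfb_comp _ _ _ _ (fun v => (id v, cst b v)) F a dp dF.
by split=> // x; rewrite -[LHS]/(dif (F \o _) a x) E Ep Ei Ec.
Qed.

Lemma dfb_partial2 U V W (F : U * V -> W) a b : dfb F (a, b) ->
  dfb (fun v => F (a, v)) b /\
  forall x, dif (fun v => F (a, v)) b x = dif F (a, b) (0, x).
Proof.
move=> dF; have [di Ei] := dfb_id b; have [dc Ec] := dfb_cst a b.
have [dp Ep] := dfb_pair dc di.
have [d E] := @dfb_comp _ _ _ _ (fun v => (cst a v, id v)) F b dp dF.
by split=> // x; rewrite -[LHS]/(dif (F \o _) b x) E Ep Ei Ec.
Qed.

(** Product rule for a moving base point and a moving direction. The differential is linear in the
    direction, so expanding [x s] leaves products of a scalar function with a derivative of [F]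
    along a fixed vector. *)
Lemma dfb_apply V W U (A : set V) (F : V -> W) (g x : U -> V) t :
  fin_coords V -> Ck 2 A F -> A (g t) -> dfb g t -> dfb x t ->
  dfb (fun s => dif F (g s) (x s)) t /\
  forall h, dif (fun s => dif F (g s) (x s)) t h =
    dif (fun u => dif F u (x t)) (g t) (dif g t h) + dif F (g t) (dif x t h).
Proof.
move=> [N [b [c [cP bP]]]] F2 At dg dx; have [dF ddF] := (CkS _ _ _).1 F2.
have dcx i : dfb (c i \o x) t /\ forall h, dif (c i \o x) t h = c i (dif x t h).
  have [li ci] := cP i; have [d E] := dfb_lin (x t) li ci.
  by have [d' E'] := dfb_comp dx d; split=> // h; rewrite E' E.
have dFb i : dfb (fun s => dif F (g s) (b i)) t /\
   forall h, dif (fun s => dif F (g s) (b i)) t h = dif (fun u => dif F u (b i)) (g t) (dif g t h).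
  exact: (@dfb_comp _ _ _ _ g (fun u => dif F u (b i)) t dg (Ck_dfb (ddF (b i)) At)).
have expand u w : dif F u w = \sum_i c i w *: dif F u (b i).
  by rewrite {1}(bP w) dif_sum; apply: eq_bigr => i _; rewrite difZ.
have -> : (fun s => dif F (g s) (x s)) =
   (fun s => \sum_i (c i \o x) s *: dif F (g s) (b i)).
  by apply/funext => s; rewrite expand.
have ds i := dfb_scale (dcx i).1 (dFb i).1.
have [d E] := dfb_sum (fun i => (ds i).1).
split=> // h; rewrite E.
have -> : dif (fun u => dif F u (x t)) (g t) (dif g t h) =
    \sum_i c i (x t) *: dif (fun u => dif F u (b i)) (g t) (dif g t h).
  have -> : (fun u => dif F u (x t)) = (fun u => \sum_i cst (c i (x t) : R^o) u *: dif F u (b i)).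
    by apply/funext => u; rewrite expand.
  have dc i := dfb_cst (c i (x t) : R^o) (g t).
  have ds' i := dfb_scale (dc i).1 (Ck_dfb (ddF (b i)) At).
  rewrite (dfb_sum (fun i => (ds' i).1)).2.
  by apply: eq_bigr => i _; rewrite (ds' i).2 (dc i).2 scale0r add0r.
rewrite [in RHS](expand (g t)) -big_split; apply: eq_bigr => i _ /=.
by rewrite (ds i).2 (dcx i).2 (dFb i).2 addrC.
Qed.

Lemma dfb_apply_id V W (A : set V) (F : V -> W) (x : V -> V) t :
  fin_coords V -> Ck 2 A F -> A t -> dfb x t ->
  dfb (fun s => dif F s (x s)) t /\
  forall h, dif (fun s => dif F s (x s)) t h =
    dif (fun u => dif F u (x t)) t h + dif F t (dif x t h).
Proof.
move=> fc F2 At dx; have [did Eid] := dfb_id t.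
have [d E] := dfb_apply fc F2 (At : A (id t)) did dx.
by split=> // h; rewrite E Eid.
Qed.

Definition local_bracket V (x y : V -> V) (u : V) : V := dif y u (x u) - dif x u (y u).

Lemma local_bracketC V (x y : V -> V) u : local_bracket x y u = - local_bracket y x u.
Proof. by rewrite /local_bracket opprB. Qed.

Lemma local_bracket_near V (A : set V) (x y z : V -> V) u : open A -> A u ->
  (forall v, A v -> y v = z v) -> dfb y u -> local_bracket x y u = local_bracket x z u.
Proof.
move=> oA Au E dy; have [_ dE] := dfb_near_open oA Au E dy.
by rewrite /local_bracket dE E.
Qed.

(** Differentiating the relation between a field and its image along the other field produces a
    second derivative of [F] in the directions of [x] and [y]; it is symmetric and drops out of the
    difference. *)
Lemma local_bracket_related V W (A : set V) (F : V -> W)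
    (x y : V -> V) (x' y' : W -> W) u :
  fin_coords V -> fin_coords W -> open A -> A u -> Ck 2 A F ->
  dfb x u -> dfb y u -> dfb x' (F u) -> dfb y' (F u) ->
  (forall z, A z -> dif F z (x z) = x' (F z)) ->
  (forall z, A z -> dif F z (y z) = y' (F z)) ->
  dif F u (local_bracket x y u) = local_bracket x' y' (F u).
Proof.
move=> fV fW oA Au F2 dx dy dx' dy' Ex Ey.
have dF : dfb F u := Ck_dfb F2 Au.
have key (z : V -> V) (z' : W -> W) h : dfb z u -> dfb z' (F u) ->
   (forall w, A w -> dif F w (z w) = z' (F w)) ->
   dif (fun v => dif F v (z u)) u h + dif F u (dif z u h) = dif z' (F u) (dif F u h).
  move=> dz dz' Ez.
  have [d E] := dfb_apply_id fV F2 Au dz.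
  by rewrite -E -(dfb_near_open oA Au Ez d).2 -(dfb_comp dF dz').2.
have E1 := key y y' (x u) dy dy' Ey.
have E2 := key x x' (y u) dx dx' Ex.
rewrite /local_bracket difB -(Ex u Au) -(Ey u Au) -E1 -E2.
by rewrite (dif_sym _ _ fW oA Au F2) opprD addrACA subrr add0r.
Qed.

Lemma Ck_apply V W U k (A : set U) (B : set V) (F : V -> W) (g x : U -> V) :
  fin_coords V -> open A -> open B -> (forall u, A u -> B (g u)) ->
  Ck k.+1 B F -> Ck k A g -> Ck k A x -> Ck k A (fun u => dif F (g u) (x u)).
Proof.
move=> fc oA oB AB cF cg cx; have [N [b [c [cP bP]]]] := fc.
apply: (@Ck_eq _ _ _ _ _ (fun u => \sum_i c i (x u) *: dif F (g u) (b i))) => //.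
  move=> u Au; rewrite {2}(bP (x u)) dif_sum; apply: eq_bigr => i _.
  by rewrite difZ.
apply: Ck_sum => // i; apply: Ck_scale => //.
  by have [li ci] := cP i; exact: (Ck_linear_comp oA li ci cx).
exact: (Ck_comp fc oA oB AB cg (Ck_dif (b i) cF)).
Qed.

Lemma Ck_id V k (A : set V) : Ck k A (id : V -> V).
Proof. by apply: Ck_linear => // z; exact: cvg_id. Qed.

Lemma Ck_sub_fun V W k (A : set V) (f g : V -> W) : open A ->
  Ck k A f -> Ck k A g -> Ck k A (fun u => f u - g u).
Proof.
move=> oA cf cg; apply: Ck_add => //.
apply: (Ck_linear_comp oA (l := -%R) _ _ cg).
  by move=> a v w; rewrite opprD scalerN.
exact: opp_continuous.
Qed.

Lemma Ck_local_bracket V k (A : set V) (x y : V -> V) : fin_coords V ->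
  open A -> Ck k.+1 A x -> Ck k.+1 A y -> Ck k A (local_bracket x y).
Proof.
move=> fc oA cx cy.
apply: Ck_sub_fun => //.
  exact: (Ck_apply fc oA oA _ cy (@Ck_id _ _ _) (CkW cx)).
exact: (Ck_apply fc oA oA _ cx (@Ck_id _ _ _) (CkW cy)).
Qed.

Lemma linear_ext V (v w : V) : fin_coords V ->
  (forall l : {linear V -> R^o}, l v = l w) -> v = w.
Proof.
move=> [N [b [c [cP bP]]]] E; rewrite (bP v) (bP w); apply: eq_bigr => i _.
pose lM := GRing.isLinear.Build _ _ _ _ _ (cP i).1.
pose l : {linear V -> R^o} := HB.pack (c i) lM.
by rewrite -[c i v]/(l v) E.
Qed.

(** The nine unknowns are the second-derivative terms and the products of first derivatives in the
    Jacobi identity, once equal mixed derivatives are identified. Linear forms reduce the identity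
    to scalars, where [ring] decides it. *)
Lemma jacobi_terms V (a b c d e f g h i : V) : fin_coords V ->
  a + b - (c + d) - (e - f) =
  b - g - (c + h - (i + f)) + (a + g - (i + e) - (d - h)).
Proof.
move=> fc; apply: (linear_ext fc) => l; rewrite !(linearB, linearD) /=; ring.
Qed.

Lemma local_bracket_jacobi V (A : set V) (x y z : V -> V) u : fin_coords V ->
  open A -> A u -> Ck 2 A x -> Ck 2 A y -> Ck 2 A z ->
  local_bracket x (local_bracket y z) u =
  local_bracket (local_bracket x y) z u + local_bracket y (local_bracket x z) u.
Proof.
move=> fc oA Au x2 y2 z2.
have key a b h : Ck 2 A a -> Ck 2 A b -> dif (local_bracket a b) u h =
  (dif (fun v => dif b v (a u)) u h + dif b u (dif a u h)) -
  (dif (fun v => dif a v (b u)) u h + dif a u (dif b u h)).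
  move=> a2 b2.
  have [d1 E1] := dfb_apply_id fc b2 Au (Ck_dfb a2 Au).
  have [d2 E2] := dfb_apply_id fc a2 Au (Ck_dfb b2 Au).
  by rewrite (dfb_sub d1 d2).2 E1 E2.
rewrite [in LHS]/local_bracket [X in _ = X + _]/local_bracket [X in _ = _ + X]/local_bracket.
rewrite (key y z (x u) y2 z2) (key x y (z u) x2 y2) (key x z (y u) x2 z2).
rewrite /local_bracket !difB.
rewrite [in RHS](dif_sym (x u) (y u) fc oA Au z2) (dif_sym (x u) (z u) fc oA Au y2).
rewrite (dif_sym (y u) (z u) fc oA Au x2).
by have := jacobi_terms _ _ _ _ _ _ _ _ _ fc; apply.
Qed.

End Brackets.

(** * Charts, actions and induced fields *)

Section Charts.
Variable R : realType.

Local Transparent dif dfb.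

Lemma open_of_nbhs (T : topologicalType) (A : set T) :
  (forall u, A u -> nbhs u A) -> open A.
Proof. by move=> h; rewrite openE => u /h. Qed.

Lemma open_comp_at (T S : topologicalType) (f : T -> S) (A : set T) (B : set S) :
  open A -> open B -> (forall u, A u -> {for u, continuous f}) ->
  open [set u | A u /\ B (f u)].
Proof.
move=> oA oB cf; apply: open_of_nbhs => u [Au Bu].
apply: filterI; first exact: open_nbhs_nbhs.
by apply: (cf u Au); exact: open_nbhs_nbhs.
Qed.

Lemma tdiffE m k (M : manifold R m) (N : manifold R k) (f : M -> N) p v :
  tdiff f p v = dif (chart (f p) \o f \o chartV p) (chart p p) v.
Proof. by []. Qed.

Lemma dchartE m (M : manifold R m) (p q : M) v :
  dchart p q v = dif (chart p \o chartV q) (chart q q) v.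
Proof. by []. Qed.

Lemma dchartVE m (M : manifold R m) (p q : M) v :
  dchartV p q v = dif (chart q \o chartV p) (chart p q) v.
Proof. by []. Qed.

Lemma vderiveE m (M : manifold R m) (X : vfield M) f (p : M) :
  vderive X f p = dif (fun u => f (chartV p u) : R^o) (chart p p) (X p).
Proof. by []. Qed.

Local Opaque dif dfb.

Variables (m : nat) (M : manifold R m).
Implicit Types p q r : M.

Definition trans_dom p q := [set u | cod p u /\ dom q (chartV p u)].

Lemma trans_dom_open p q : open (trans_dom p q).
Proof.
apply: open_comp_at; [exact: cod_open | exact: dom_open | exact: chartV_continuous].
Qed.

Arguments trans_dom_open : clear implicits.

Lemma trans_dom_chart p q r : dom p r -> dom q r -> trans_dom p q (chart p r).
Proof. by move=> pr qr; split; [exact: chart_cod | rewrite chartK]. Qed.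

Lemma dfb_trans p q u : trans_dom p q u -> dfb (chart q \o chartV p) u.
Proof. exact: (Ck_dfb (@chart_smooth _ _ M p q 1%N)). Qed.

Lemma dif_trans_id p u v : cod p u -> dif (chart p \o chartV p) u v = v.
Proof.
move=> pu; have [did Eid] := dfb_id u.
have [|_ ->//] := @dfb_near_open _ _ _ _ (id : 'rV[R]_m -> 'rV[R]_m)
  (chart p \o chartV p) u (@cod_open _ _ M p) pu _ did.
by move=> z pz; rewrite /= chartVK.
Qed.

Lemma dif_trans_comp p q r u v : trans_dom p q u -> trans_dom p r u ->
  dif (chart r \o chartV q) (chart q (chartV p u)) (dif (chart q \o chartV p) u v) =
  dif (chart r \o chartV p) u v.
Proof.
move=> hq hr; have [pu qu] := hq.
have d1 := dfb_trans hq.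
have h : trans_dom q r (chart q (chartV p u)).
  by split; [exact: chart_cod | rewrite chartK //; case: hr].
have d2 := dfb_trans h.
rewrite -(dfb_comp d1 d2).2.
have [|_ ->//] := @dfb_near_open _ _ _ _ _ (chart r \o chartV p) u
  (trans_dom_open p q) hq _ (dfb_comp d1 d2).1.
by move=> z [_ qz] /=; rewrite chartK.
Qed.

Lemma dchart_id p v : dchart p p v = v.
Proof. by rewrite dchartE dif_trans_id //; apply: chart_cod; exact: dom_center. Qed.

Lemma dchartK p q v : dom p q -> dchartV p q (dchart p q v) = v.
Proof.
move=> pq; rewrite dchartE dchartVE.
have qq := dom_center q.
have := @dif_trans_comp q p q (chart q q) v.
rewrite chartK // => ->; try exact: trans_dom_chart.
by rewrite dif_trans_id //; exact: chart_cod.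
Qed.

Lemma dchart_linear p q : linear (dchart p q).
Proof. exact: dif_is_linear. Qed.

Lemma dchartV_linear p q : linear (dchartV p q).
Proof. exact: dif_is_linear. Qed.

Lemma vfield_in_chart_center (X : vfield M) p : vfield_in_chart X p (chart p p) = X p.
Proof.
rewrite /vfield_in_chart chartK; last exact: dom_center.
exact: dchart_id.
Qed.

Lemma lie_bracketE (X Y : vfield M) p :
  lie_bracket X Y p =
  local_bracket (vfield_in_chart X p) (vfield_in_chart Y p) (chart p p).
Proof. by rewrite /local_bracket !vfield_in_chart_center. Qed.

Lemma smooth_vfieldP (X : vfield M) p u k : smooth_vfield X -> cod p u ->
  dfb (vfield_in_chart X p) u /\ Ck k (cod p) (vfield_in_chart X p).
Proof. by move=> sX pu; split; [exact: (Ck_dfb (sX p 1%N)) | exact: sX]. Qed.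

(** [lie_bracket] reads each point in its own preferred chart, so its smoothness is not visible from
    the definition. Naturality under the transition maps rewrites it as one formula in the fixed
    chart at [p]. *)
Lemma lie_bracket_in_chart (X Y : vfield M) p u :
  smooth_vfield X -> smooth_vfield Y -> cod p u ->
  vfield_in_chart (lie_bracket X Y) p u =
  local_bracket (vfield_in_chart X p) (vfield_in_chart Y p) u.
Proof.
move=> sX sY pu; set q := chartV p u.
have pq : dom p q by exact: chartV_dom.
have qq := dom_center q.
have uE : u = chart p q by rewrite /q chartVK.
rewrite /vfield_in_chart -/q lie_bracketE dchartE.
have fc := @fin_coords_rV R m.
have tq : trans_dom q p (chart q q) by exact: trans_dom_chart.
have qqc : cod q (chart q q) by exact: chart_cod.
have E : (chart p \o chartV q) (chart q q) = u by rewrite /= chartK.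
have rel Z z : trans_dom q p z ->
    dif (chart p \o chartV q) z (vfield_in_chart Z q z) =
    vfield_in_chart Z p ((chart p \o chartV q) z).
  move=> [qz pz].
  rewrite /vfield_in_chart /= chartK // !dchartE.
  set r := chartV q z; have -> : z = chart q (chartV r (chart r r)).
    by rewrite chartK ?chartVK //; exact: dom_center.
  apply: dif_trans_comp; apply: trans_dom_chart => //; try exact: dom_center.
  exact: chartV_dom.
have -> := local_bracket_related fc fc (trans_dom_open q p) tq (@chart_smooth _ _ M q p 2)
  (smooth_vfieldP 1 sX qqc).1 (smooth_vfieldP 1 sY qqc).1 _ _ (rel X) (rel Y).
- by rewrite E.
- by rewrite E; exact: (smooth_vfieldP 1 sX pu).1.
- by rewrite E; exact: (smooth_vfieldP 1 sY pu).1.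
Qed.

Lemma smooth_lie_bracket (X Y : vfield M) :
  smooth_vfield X -> smooth_vfield Y -> smooth_vfield (lie_bracket X Y).
Proof.
move=> sX sY p k; apply: (@Ck_eq _ _ _ _ _ (local_bracket (vfield_in_chart X p) (vfield_in_chart Y p))).
- exact: cod_open.
- by move=> u pu; rewrite lie_bracket_in_chart.
- by apply: Ck_local_bracket; [exact: fin_coords_rV | exact: cod_open | exact: sX | exact: sY].
Qed.

Lemma lie_bracket_jacobi (X Y Z : vfield M) p :
  smooth_vfield X -> smooth_vfield Y -> smooth_vfield Z ->
  lie_bracket X (lie_bracket Y Z) p =
  lie_bracket (lie_bracket X Y) Z p + lie_bracket Y (lie_bracket X Z) p.
Proof.
move=> sX sY sZ; rewrite !lie_bracketE.
have pp : cod p (chart p p) by apply: chart_cod; exact: dom_center.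
have H A B C : smooth_vfield A -> smooth_vfield B -> smooth_vfield C ->
   local_bracket (vfield_in_chart A p) (vfield_in_chart (lie_bracket B C) p) (chart p p) =
   local_bracket (vfield_in_chart A p)
     (local_bracket (vfield_in_chart B p) (vfield_in_chart C p)) (chart p p).
  move=> sA sB sC.
  apply: (local_bracket_near _ (@cod_open _ _ M p) pp).
    by move=> z pz; rewrite lie_bracket_in_chart.
  exact: (smooth_vfieldP 1 (smooth_lie_bracket sB sC) pp).1.
rewrite (H X Y Z) // (H Y X Z) //.
(* Antisymmetry brings the inner bracket into the second place, the one that [H] handles. *)
rewrite [X in _ = X + _]local_bracketC (H Z X Y) // -[X in _ = X + _]local_bracketC.
apply: (local_bracket_jacobi (@fin_coords_rV R m) (@cod_open _ _ M p) pp); [exact: sX|exact: sY|exact: sZ].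
Qed.

End Charts.

Arguments trans_dom_open {R m M} p q : rename.

Section MapsInCharts.
Variables (R : realType) (m k : nat) (N : manifold R k) (M : manifold R m).

Definition map_dom (f : N -> M) (q : N) (r : M) :=
  [set u | cod q u /\ dom r (f (chartV q u))].

Lemma map_dom_open (f : N -> M) q r : continuous f -> open (map_dom f q r).
Proof.
move=> cf; apply: (@open_comp_at _ _ (f \o chartV q)).
- exact: cod_open.
- exact: dom_open.
- by move=> u qu; apply: continuous_comp; [exact: chartV_continuous | exact: cf].
Qed.
Arguments map_dom_open : clear implicits.

(** Only the chart of the target changes, from the preferred one at [f q] to the one at [r]; the
    chain rule through the transition map does it. *)
Lemma dchart_tdiff (f : N -> M) q r w : continuous f -> dom r (f q) ->
  dfb (chart (f q) \o f \o chartV q) (chart q q) ->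
  dfb (chart r \o f \o chartV q) (chart q q) /\
  dchart r (f q) (tdiff f q w) = dif (chart r \o f \o chartV q) (chart q q) w.
Proof.
move=> cf rq d1; have qq := dom_center q; have fqq := dom_center (f q).
rewrite tdiffE dchartE.
have d2 : dfb (chart r \o chartV (f q)) ((chart (f q) \o f \o chartV q) (chart q q)).
  by apply: dfb_trans; rewrite /= chartK //; exact: trans_dom_chart.
have [d3 E3] := dfb_comp d1 d2.
have oA := map_dom_open f q (f q) cf.
have Aq : map_dom f q (f q) (chart q q).
  by split; [exact: chart_cod | rewrite chartK].
have [|d4 E4] := @dfb_near_open _ _ _ _ _ (chart r \o f \o chartV q) _ oA Aq _ d3.
  by move=> z [_ fz] /=; rewrite chartK.
by split=> //; rewrite E4 E3 /= chartK.
Qed.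

End MapsInCharts.

Arguments map_dom_open {R m k N M} f q r _ : rename.

(** * Lie groups and smooth actions *)

Section LieGroup.
Variables (R : realType) (d : nat) (G : lie_group R d).
Local Notation "a * b" := (@lg_mul R d G a b).
Local Notation "a ^-1" := (@lg_inv R d G a).
Local Notation e := (lg_one G).

Lemma lg_mulrV (a : G) : a * a^-1 = e.
Proof.
rewrite -[LHS](lg_mul1) -{1}(lg_mulV (a^-1)) -lg_mulA (lg_mulA a^-1 a).
by rewrite lg_mulV lg_mul1 lg_mulV.
Qed.

Lemma lg_mulr1 (a : G) : a * e = a.
Proof. by rewrite -(lg_mulV a) lg_mulA lg_mulrV lg_mul1. Qed.

(** Lets the results on actions be applied to G itself: the fields induced by left multiplication
    are the right-invariant ones. *)
Lemma lg_mul_action : @smooth_action R d d G G (@lg_mul R d G).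
Proof.
split; first exact: lg_mul_smooth.
  by move=> z; rewrite lg_mul1.
by move=> a b z; rewrite lg_mulA.
Qed.

End LieGroup.

Section Action.
Variables (R : realType) (d m : nat) (G : lie_group R d) (M : manifold R m).
Variables (act : G -> M -> M).
Hypothesis act_smooth : smooth_action act.
Local Notation e := (lg_one G).
Local Notation u0 := (chart e e).

Let act1 z : act e z = z. Proof. by have [_ ->] := act_smooth. Qed.
Let actM a b z : act (lg_mul a b) z = act a (act b z).
Proof. by have [_ _ ->] := act_smooth. Qed.

Lemma act_continuous : continuous (fun z : G * M => act z.1 z.2).
Proof. by have [[]] := act_smooth. Qed.

Lemma act_continuous1 z : continuous (act ^~ z).
Proof.
move=> a; apply: (@continuous_comp _ _ _ (fun a => (a, z)) (fun z : G * M => act z.1 z.2)).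
  by apply: cvg_pair => //; exact: cvg_cst.
exact: act_continuous.
Qed.

Lemma act_continuous2 a : continuous (act a).
Proof.
move=> z; apply: (@continuous_comp _ _ _ (fun z => (a, z)) (fun z : G * M => act z.1 z.2)).
  by apply: cvg_pair => //; exact: cvg_cst.
exact: act_continuous.
Qed.

Definition act_chart (a : G) (p r : M) (z : 'rV[R]_d * 'rV[R]_m) : 'rV[R]_m :=
  chart r (act (chartV a z.1) (chartV p z.2)).

Definition actdom (a : G) (p r : M) : set ('rV[R]_d * 'rV[R]_m) :=
  [set z | (cod a z.1 /\ cod p z.2) /\ dom r (act (chartV a z.1) (chartV p z.2))].

Lemma actdom_open a p r : open (actdom a p r).
Proof.
apply: (@open_comp_at _ _ (fun z => act (chartV a z.1) (chartV p z.2))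
  [set z | cod a z.1 /\ cod p z.2]).
- apply: open_of_nbhs => -[u v] [/= au pv].
  exists (cod a, cod p) => //=; split; apply: open_nbhs_nbhs; split=> //; exact: cod_open.
- exact: dom_open.
- move=> z [az pz].
  apply: (@continuous_comp _ _ _ (fun z => (chartV a z.1, chartV p z.2)) (fun z : G * M => act z.1 z.2)).
    apply: cvg_pair => /=.
      by apply: (continuous_comp (@cvg_fst _ _ (nbhs z.1) (nbhs z.2) _)); exact: chartV_continuous.
    by apply: (continuous_comp (@cvg_snd _ _ (nbhs z.1) (nbhs z.2) _)); exact: chartV_continuous.
  exact: act_continuous.
Qed.
Arguments actdom_open : clear implicits.

Lemma act_chart_smooth a p k : Ck k (actdom a p (act a p)) (act_chart a p (act a p)).
Proof.
have [[_ /(_ a p k) h] _ _] := act_smooth.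
by apply: Ck_sub h => z [[? ?] ?]; split.
Qed.

Lemma act_chart1_smooth p k : Ck k (actdom e p p) (act_chart e p p).
Proof. by have := @act_chart_smooth e p k; rewrite act1. Qed.

Lemma actdom_center a p : actdom a p (act a p) (chart a a, chart p p).
Proof.
have aa := dom_center a; have pp := dom_center p.
split; first by split; exact: chart_cod.
by rewrite /= !chartK //; exact: dom_center.
Qed.

Lemma actdom1 p u : cod p u -> actdom e p p (u0, u).
Proof.
have ee := dom_center e.
move=> pu; split; first by split=> //; exact: chart_cod.
by rewrite /= chartK // act1; exact: chartV_dom.
Qed.

Lemma act_chart1E p u : cod p u -> act_chart e p p (u0, u) = u.
Proof.
move=> pu; rewrite /act_chart /= chartK; last exact: dom_center.
by rewrite act1 chartVK.
Qed.

Lemma dfb_act1 a z : dfb (chart (act a z) \o (act ^~ z) \o chartV a) (chart a a).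
Proof.
have d1 := Ck_dfb (@act_chart_smooth a z 1) (actdom_center a z).
have [d2 _] := dfb_partial1 d1.
have zz := dom_center z.
suff -> : chart (act a z) \o act ^~ z \o chartV a =
  (fun v => act_chart a z (act a z) (v, chart z z)) by [].
by apply/funext => v; rewrite /act_chart /= chartK.
Qed.

Lemma dfb_act2 a z : dfb (chart (act a z) \o act a \o chartV z) (chart z z).
Proof.
have d1 := Ck_dfb (@act_chart_smooth a z 1) (actdom_center a z).
have [d2 _] := dfb_partial2 d1.
have aa := dom_center a.
suff -> : chart (act a z) \o act a \o chartV z =
  (fun v => act_chart a z (act a z) (chart a a, v)) by [].
by apply/funext => v; rewrite /act_chart /= chartK.
Qed.

(** The induced field is the partial derivative, in the group variable, of one smooth map of two
    variables; its smoothness in the point follows from this form. *)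
Lemma induced_in_chart X p u : cod p u ->
  vfield_in_chart (induced_vfield act X) p u = dif (act_chart e p p) (u0, u) (X, 0).
Proof.
move=> pu; set q := chartV p u.
have pq : dom p (act e q) by rewrite act1; exact: chartV_dom.
rewrite /vfield_in_chart -/q /induced_vfield.
rewrite -{1}(act1 q).
have [_ ->] := dchart_tdiff X (@act_continuous1 q) pq (dfb_act1 e q).
have d1 := Ck_dfb (@act_chart1_smooth p 1) (actdom1 pu).
by rewrite -(dfb_partial1 d1).2.
Qed.

Lemma smooth_induced X : smooth_vfield (induced_vfield act X).
Proof.
move=> p k; apply: (@Ck_eq _ _ _ _ _ (fun u => dif (act_chart e p p) (u0, u) (X, 0))).
- exact: cod_open.
- by move=> u pu; rewrite induced_in_chart.
have fc : fin_coords ('rV[R]_d * 'rV[R]_m)%type.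
  by apply: fin_coords_prod; exact: fin_coords_rV.
have oc : open (cod p) := @cod_open _ _ M p.
apply: (Ck_apply fc oc (actdom_open e p p) _ (@act_chart1_smooth p k.+1)).
- by move=> u; exact: actdom1.
- by apply: Ck_pair => //; [exact: Ck_cst | exact: Ck_id].
- exact: Ck_cst.
Qed.

Lemma induced_linear z : linear (fun X => induced_vfield act X z).
Proof. exact: dif_is_linear. Qed.

End Action.

Arguments actdom_open {R d m G M act} _ a p r : rename.
Arguments act_continuous1 {R d m G M act} _ z : rename.
Arguments act_continuous2 {R d m G M act} _ a : rename.

Section SmoothMaps.
Variables (R : realType) (m k l : nat).
Variables (L : manifold R l) (N : manifold R k) (M : manifold R m).

Lemma smooth_map_dfb (f : N -> M) q : smooth_map f ->
  dfb (chart (f q) \o f \o chartV q) (chart q q).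
Proof.
move=> [_ /(_ q 1%N) h]; apply: (Ck_dfb h); have qq := dom_center q.
by split; [exact: chart_cod | rewrite chartK //; exact: dom_center].
Qed.

Lemma tdiff_in_charts (f : N -> M) p q r w : smooth_map f -> dom p q -> dom r (f q) ->
  dfb (chart r \o f \o chartV p) (chart p q) /\
  dif (chart r \o f \o chartV p) (chart p q) (dchart p q w) = dchart r (f q) (tdiff f q w).
Proof.
move=> sf pq rq; have [cf _] := sf; have qq := dom_center q.
have [d1 ->] := dchart_tdiff w cf rq (smooth_map_dfb q sf).
have tq : trans_dom q p (chart q q) by exact: trans_dom_chart.
have tp : trans_dom p q (chart p q) by exact: trans_dom_chart.
have d1' : dfb (chart r \o f \o chartV q) ((chart q \o chartV p) (chart p q)).
  by rewrite /= chartK.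
have [d2 _] := dfb_comp (dfb_trans tp) d1'.
have [|d3 _] := @dfb_near_open _ _ _ _ _ (chart r \o f \o chartV p) _
  (trans_dom_open p q) tp _ d2.
  by move=> z [_ qz] /=; rewrite chartK.
split=> //; rewrite dchartE.
have d3' : dfb (chart r \o f \o chartV p) ((chart p \o chartV q) (chart q q)).
  by rewrite /= chartK.
have [d4 E4] := dfb_comp (dfb_trans tq) d3'.
have [|_ ->] := @dfb_near_open _ _ _ _ _ (chart r \o f \o chartV q) _
  (trans_dom_open q p) tq _ d4.
  by move=> z [_ pz] /=; rewrite chartK.
by rewrite E4 /= chartK.
Qed.

Lemma tdiff_comp (f : L -> N) (g : N -> M) p v : continuous f ->
  dfb (chart (f p) \o f \o chartV p) (chart p p) ->
  dfb (chart (g (f p)) \o g \o chartV (f p)) (chart (f p) (f p)) ->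
  dfb (chart (g (f p)) \o (g \o f) \o chartV p) (chart p p) /\
  tdiff (g \o f) p v = tdiff g (f p) (tdiff f p v).
Proof.
move=> cf df dg; have pp := dom_center p; have fpp := dom_center (f p).
have dg' : dfb (chart (g (f p)) \o g \o chartV (f p)) ((chart (f p) \o f \o chartV p) (chart p p)).
  by rewrite /= chartK.
have [d1 E1] := dfb_comp df dg'.
have hp : map_dom f p (f p) (chart p p).
  by split; [exact: chart_cod | rewrite chartK].
have [|d2 E2] := @dfb_near_open _ _ _ _ _ (chart (g (f p)) \o (g \o f) \o chartV p) _
  (map_dom_open f p (f p) cf) hp _ d1.
  by move=> z [_ fz] /=; rewrite chartK.
by split=> //; rewrite !tdiffE E2 E1 /= chartK.
Qed.

Lemma lie_bracket_related (f : N -> M) (X Y : vfield N) (X' Y' : vfield M) p :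
  smooth_map f -> smooth_vfield X -> smooth_vfield Y ->
  smooth_vfield X' -> smooth_vfield Y' ->
  (forall q, tdiff f q (X q) = X' (f q)) -> (forall q, tdiff f q (Y q) = Y' (f q)) ->
  tdiff f p (lie_bracket X Y p) = lie_bracket X' Y' (f p).
Proof.
move=> sf sX sY sX' sY' EX EY.
have [cf Cf] := sf; have pp := dom_center p; have fpp := dom_center (f p).
have hp : map_dom f p (f p) (chart p p).
  by split; [exact: chart_cod | rewrite chartK].
have rel (Z : vfield N) (Z' : vfield M) (EZ : forall q, tdiff f q (Z q) = Z' (f q)) z :
    map_dom f p (f p) z ->
    dif (chart (f p) \o f \o chartV p) z (vfield_in_chart Z p z) =
    vfield_in_chart Z' (f p) ((chart (f p) \o f \o chartV p) z).
  move=> [pz fz]; rewrite /vfield_in_chart /= chartK // -EZ.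
  have := (tdiff_in_charts (Z (chartV p z)) sf (chartV_dom pz) fz).2.
  by rewrite chartVK.
have fk := @fin_coords_rV R k; have fm := @fin_coords_rV R m.
have cp : cod p (chart p p) by exact: chart_cod.
have E : (chart (f p) \o f \o chartV p) (chart p p) = chart (f p) (f p).
  by rewrite /= chartK.
have cfp : cod (f p) ((chart (f p) \o f \o chartV p) (chart p p)).
  by rewrite E; exact: chart_cod.
have := local_bracket_related fk fm (map_dom_open f p (f p) cf) hp (Cf p 2)
  (smooth_vfieldP 1 sX cp).1 (smooth_vfieldP 1 sY cp).1
  (smooth_vfieldP 1 sX' cfp).1 (smooth_vfieldP 1 sY' cfp).1 (rel X X' EX) (rel Y Y' EY).
by rewrite E tdiffE !lie_bracketE.
Qed.

End SmoothMaps.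

Section ActionBrackets.
Variables (R : realType) (d m : nat) (G : lie_group R d) (M : manifold R m).
Variables (act : G -> M -> M).
Hypothesis act_smooth : smooth_action act.
Local Notation e := (lg_one G).
Local Notation u0 := (chart e e).
Local Notation mu := (act_chart (@lg_mul R d G) e e e).
Local Notation lgs := (lg_mul_action G).

Let act1 z : act e z = z. Proof. by have [_ ->] := act_smooth. Qed.
Let actM a b z : act (lg_mul a b) z = act a (act b z).
Proof. by have [_ _ ->] := act_smooth. Qed.

Lemma smooth_map_act1 z : smooth_map (act ^~ z).
Proof.
split; first exact: act_continuous1.
move=> a k; have zz := dom_center z.
have -> : chart (act a z) \o act ^~ z \o chartV a =
  (act_chart act a z (act a z)) \o (fun v => (v, chart z z)).
  by apply/funext => v; rewrite /act_chart /= chartK.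
apply: (@Ck_comp R ('rV[R]_d * 'rV[R]_m)%type _ _ k _ (actdom act a z (act a z))).
- by apply: fin_coords_prod; exact: fin_coords_rV.
- exact: (map_dom_open (act ^~ z) a (act a z) (act_continuous1 act_smooth z)).
- exact: actdom_open.
- by move=> u [au hu]; split; [split=> //; exact: chart_cod | rewrite /= chartK].
- apply: Ck_pair; [|exact: Ck_id|exact: Ck_cst].
  exact: (map_dom_open (act ^~ z) a (act a z) (act_continuous1 act_smooth z)).
- exact: act_chart_smooth.
Qed.

Lemma smooth_map_act2 a : smooth_map (act a).
Proof.
split; first exact: act_continuous2.
move=> z k; have aa := dom_center a.
have -> : chart (act a z) \o act a \o chartV z =
  (act_chart act a z (act a z)) \o (fun v => (chart a a, v)).
  by apply/funext => v; rewrite /act_chart /= chartK.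
apply: (@Ck_comp R ('rV[R]_d * 'rV[R]_m)%type _ _ k _ (actdom act a z (act a z))).
- by apply: fin_coords_prod; exact: fin_coords_rV.
- exact: (map_dom_open (act a) z (act a z) (act_continuous2 act_smooth a)).
- exact: actdom_open.
- by move=> u [au hu]; split; [split=> //; exact: chart_cod | rewrite /= chartK].
- apply: Ck_pair; [|exact: Ck_cst|exact: Ck_id].
  exact: (map_dom_open (act a) z (act a z) (act_continuous2 act_smooth a)).
- exact: act_chart_smooth.
Qed.

End ActionBrackets.

(** * Left- and right-invariant fields, and the derivative of Ad *)

Section LeftRight.
Variables (R : realType) (d : nat) (G : lie_group R d).
Local Notation e := (lg_one G).
Local Notation u0 := (chart e e).
Local Notation mul := (@lg_mul R d G).
Local Notation mu := (act_chart mul e e e).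
Local Notation lgs := (lg_mul_action G).
Local Notation rinv := (induced_vfield mul).

Let fd : fin_coords 'rV[R]_d := @fin_coords_rV R d.
Let fdd : fin_coords ('rV[R]_d * 'rV[R]_d)%type := fin_coords_prod fd fd.
Let ce : cod e u0. Proof. by apply: chart_cod; exact: dom_center. Qed.

Let mu_smooth k : Ck k (actdom mul e e e) mu.
Proof. exact: (act_chart1_smooth lgs). Qed.

Let mu_dom_l v : cod e v -> actdom mul e e e (v, u0).
Proof.
move=> ev; have ee := dom_center e.
by split; [split | rewrite /= chartK // lg_mulr1; exact: chartV_dom].
Qed.

Let omu : open (actdom mul e e e) := actdom_open lgs e e e.

Lemma left_invariant_in_chart X v : cod e v ->
  vfield_in_chart (left_invariant G X) e v = dif mu (v, u0) (0, X).
Proof.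
move=> ev; set a := chartV e v.
have ea : dom e (mul a e) by rewrite lg_mulr1; exact: chartV_dom.
rewrite /vfield_in_chart -/a /left_invariant.
rewrite -{1}(lg_mulr1 a).
have [_ ->] := dchart_tdiff X (act_continuous2 lgs a) ea (dfb_act2 lgs a e).
have d1 := Ck_dfb (mu_smooth 1) (mu_dom_l ev).
by rewrite -(dfb_partial2 d1).2.
Qed.

Lemma left_invariant_one X : left_invariant G X e = X.
Proof.
rewrite /left_invariant tdiffE lg_mul1.
have -> : chart e \o [eta mul e] \o chartV e = chart e \o chartV e.
  by apply/funext => v; rewrite /= lg_mul1.
exact: dif_trans_id.
Qed.

Lemma right_invariant_one X : rinv X e = X.
Proof.
rewrite /induced_vfield tdiffE lg_mulr1.
have -> : chart e \o mul^~ e \o chartV e = chart e \o chartV e.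
  by apply/funext => v; rewrite /= lg_mulr1.
exact: dif_trans_id.
Qed.

Lemma dif_left_invariant X h :
  dfb (vfield_in_chart (left_invariant G X) e) u0 /\
  dif (vfield_in_chart (left_invariant G X) e) u0 h =
  dif (fun z => dif mu z (0, X)) (u0, u0) (h, 0).
Proof.
have d1 : dfb (fun z => dif mu z (0, X)) (u0, u0).
  exact: (Ck_dfb (Ck_dif (0, X) (mu_smooth 2)) (mu_dom_l ce)).
have [d2 E2] := dfb_partial1 d1.
have [|d3 E3] := @dfb_near_open _ _ _ _ _ (vfield_in_chart (left_invariant G X) e) _
  (@cod_open _ _ G e) ce _ d2.
  by move=> v ev; rewrite left_invariant_in_chart.
by split=> //; rewrite E3 E2.
Qed.

Lemma dif_right_invariant X h :
  dif (vfield_in_chart (rinv X) e) u0 h =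
  dif (fun z => dif mu z (X, 0)) (u0, u0) (0, h).
Proof.
have d1 : dfb (fun z => dif mu z (X, 0)) (u0, u0).
  exact: (Ck_dfb (Ck_dif (X, 0) (mu_smooth 2)) (mu_dom_l ce)).
have [d2 E2] := dfb_partial2 d1.
have [|_ ->] := @dfb_near_open _ _ _ _ _ (vfield_in_chart (rinv X) e) _
  (@cod_open _ _ G e) ce _ d2.
  by move=> v ev; rewrite (induced_in_chart lgs).
by rewrite E2.
Qed.

(** A left-invariant field is the partial derivative of multiplication in its second factor, so the
    bracket is the antisymmetrised mixed second derivative of multiplication at the identity. *)
Lemma lie_alg_bracketE X Y : lie_alg_bracket G X Y =
  dif (fun z => dif mu z (0, Y)) (u0, u0) (X, 0) -
  dif (fun z => dif mu z (0, X)) (u0, u0) (Y, 0).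
Proof.
rewrite /lie_alg_bracket lie_bracketE /local_bracket !vfield_in_chart_center.
by rewrite !left_invariant_one (dif_left_invariant _ _).2 (dif_left_invariant _ _).2.
Qed.

Let mu_sym X Y : dif (fun z => dif mu z (X, 0)) (u0, u0) (0, Y) =
  dif (fun z => dif mu z (0, Y)) (u0, u0) (X, 0).
Proof. exact: (dif_sym _ _ fd omu (mu_dom_l ce) (mu_smooth 2)). Qed.

(** Right-invariant fields differentiate the other factor. By the symmetry of mixed derivatives the
    same two terms come back with opposite signs, which is the origin of the sign in
    [induced_bracket]. *)
Lemma right_invariant_bracket X Y :
  lie_bracket (rinv X) (rinv Y) e = - lie_alg_bracket G X Y.
Proof.
rewrite lie_bracketE /local_bracket !vfield_in_chart_center !right_invariant_one.
by rewrite !dif_right_invariant lie_alg_bracketE opprB !mu_sym.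
Qed.

Definition conjg_lg (a : G) : G -> G := fun b => mul (mul a b) (lg_inv a).

Lemma conjg_lgE a : conjg_lg a = (mul ^~ (lg_inv a)) \o mul a.
Proof. by []. Qed.

Lemma conjg_lg_one a : conjg_lg a e = e.
Proof. by rewrite /conjg_lg lg_mulr1 lg_mulrV. Qed.

Lemma conjg_lg_continuous a : continuous (conjg_lg a).
Proof.
move=> b; apply: (@continuous_comp _ _ _ (mul a) (mul ^~ (lg_inv a))).
  exact: act_continuous2 lgs a b.
exact: act_continuous1 lgs (lg_inv a) _.
Qed.

Lemma AdE a X : Ad a X = tdiff (conjg_lg a) e X.
Proof. by []. Qed.

Lemma Ad_left_right a X :
  dfb (chart (conjg_lg a e) \o conjg_lg a \o chartV e) (chart e e) /\
  Ad a X = tdiff (mul ^~ (lg_inv a)) a (left_invariant G X a).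
Proof.
rewrite AdE conjg_lgE.
have [d1 E] := tdiff_comp X (act_continuous2 lgs a) (dfb_act2 lgs a e)
   (smooth_map_dfb (mul a e) (smooth_map_act1 lgs (lg_inv a))).
split; first exact: d1.
transitivity (tdiff (mul ^~ (lg_inv a)) (mul a e) (tdiff (mul a) e X)).
  exact: E.
rewrite lg_mulr1.
reflexivity.
Qed.

(* In the chart at the identity, right translation by a carries Ad a X to the
   left-invariant field at a; this is differentiated at the identity below. *)
Lemma Ad_chart_equation X v : cod e v ->
  dif mu (u0, v) (Ad (chartV e v) X, 0) = dif mu (v, u0) (0, X).
Proof.
move=> ev; set a := chartV e v.
rewrite -left_invariant_in_chart // -(induced_in_chart lgs) // /vfield_in_chart -/a.
congr (dchart _ _ _).
have ce' : conjg_lg a e = e := conjg_lg_one a.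
have [d1 _] := Ad_left_right a X.
have d2 : dfb (chart (mul (conjg_lg a e) a) \o (mul ^~ a) \o chartV (conjg_lg a e))
    (chart (conjg_lg a e) (conjg_lg a e)).
  exact: (smooth_map_dfb _ (smooth_map_act1 lgs a)).
have [_ E] := tdiff_comp X (@conjg_lg_continuous a) d1 d2.
have F : (mul ^~ a) \o conjg_lg a = mul a.
  by apply/funext => b; rewrite /= /conjg_lg -!lg_mulA lg_mulV lg_mulr1.
transitivity (tdiff (mul ^~ a) (conjg_lg a e) (tdiff (conjg_lg a) e X)).
  rewrite ce'; reflexivity.
rewrite -E F; reflexivity.
Qed.

Let iota v := chart e (lg_inv (chartV e v)).

Lemma lg_inv_one : lg_inv e = e.
Proof. by rewrite -[LHS]lg_mulr1 lg_mulV. Qed.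

(** An explicit expression for [Ad] through [mu]; it involves inversion, hence the second condition.
    It serves to prove differentiability, while the value of the derivative comes from
    [Ad_chart_equation], which contains no inverse. *)
Lemma Ad_in_chart X v : cod e v -> dom e (lg_inv (chartV e v)) ->
  Ad (chartV e v) X = dif mu (v, iota v) (dif mu (v, u0) (0, X), 0).
Proof.
move=> ev hv; set a := chartV e v.
have ea : dom e a by exact: chartV_dom.
have aa : mul a (lg_inv a) = e by exact: lg_mulrV.
have aae : dom e (mul a (lg_inv a)) by rewrite aa; exact: dom_center.
rewrite (Ad_left_right a X).2 -(left_invariant_in_chart X ev).
rewrite /vfield_in_chart -/a.
have [d1 E1] := tdiff_in_charts (left_invariant G X a) (smooth_map_act1 lgs (lg_inv a)) ea aae.
have va : v = chart e a by rewrite /a chartVK.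
have hd : actdom mul e e e (v, iota v).
  split; first by split; [exact: ev | exact: (chart_cod hv)].
  by rewrite /= (chartK hv); exact: aae.
rewrite -(dfb_partial1 (Ck_dfb (mu_smooth 1) hd)).2.
have -> : (fun w => mu (w, iota v)) = chart e \o mul ^~ (lg_inv a) \o chartV e.
  by apply/funext => w; rewrite /act_chart /= (chartK hv).
by rewrite {1}va E1 aa dchart_id.
Qed.

Lemma Ad_one X : Ad e X = X.
Proof.
rewrite AdE tdiffE conjg_lg_one.
have -> : chart e \o conjg_lg e \o chartV e = chart e \o chartV e.
  by apply/funext => v; rewrite /= /conjg_lg lg_mul1 lg_inv_one lg_mulr1.
exact: dif_trans_id.
Qed.

(** Implicit differentiation of [Ad_chart_equation] at the identity: the derivative sought plus one
    mixed derivative of multiplication equals the other one, and their difference is the bracket. *)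
Lemma Ad_derivative X :
  dfb (fun v => Ad (chartV e v) X) u0 /\
  forall Y, dif (fun v => Ad (chartV e v) X) u0 Y = lie_alg_bracket G Y X.
Proof.
have ee := dom_center e; have [ci _] := lg_inv_smooth G.
have oA := map_dom_open (@lg_inv R d G) e e ci.
have Au0 : map_dom (@lg_inv R d G) e e u0.
  by split; [exact: ce | rewrite chartK // lg_inv_one].
have diota : dfb iota u0.
  by have := smooth_map_dfb e (lg_inv_smooth G); rewrite lg_inv_one.
have iota1 : iota u0 = u0 by rewrite /iota chartK // lg_inv_one.
have dl : dfb (fun v => dif mu (v, u0) (0, X)) u0 /\
   forall Y, dif (fun v => dif mu (v, u0) (0, X)) u0 Y =
             dif (fun z => dif mu z (0, X)) (u0, u0) (Y, 0).
  exact: (dfb_partial1 (Ck_dfb (Ck_dif (0, X) (mu_smooth 2)) (mu_dom_l ce))).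
have dz : dfb (fun v => Ad (chartV e v) X) u0.
  have d1 := dfb_pair (dfb_id u0).1 diota.
  have d2 := dfb_pair dl.1 (dfb_cst (0 : 'rV[R]_d) u0).1.
  have Ag : actdom mul e e e (id u0, iota u0) by rewrite iota1; exact: mu_dom_l.
  have [d3 _] := dfb_apply fdd (mu_smooth 2) Ag d1.1 d2.1.
  have [|//] := @dfb_near_open _ _ _ _ _ (fun v => Ad (chartV e v) X) _ oA Au0 _ d3.
  by move=> v [ev hv]; rewrite Ad_in_chart.
split=> // Y.
have d1 := dfb_pair (dfb_cst u0 u0).1 (dfb_id u0).1.
have d2 := dfb_pair dz (dfb_cst (0 : 'rV[R]_d) u0).1.
have Ag : actdom mul e e e (cst u0 u0, id u0) by exact: mu_dom_l.
have [d3 E3] := dfb_apply fdd (mu_smooth 2) Ag d1.1 d2.1.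
have [|_ E4] := @dfb_near_open _ _ _ _ _ (fun v => dif mu (v, u0) (0, X)) _
  (@cod_open _ _ G e) ce _ d3.
  by move=> v ev; exact: Ad_chart_equation.
have := E4 Y; rewrite dl.2 E3 d1.2 d2.2 (dfb_cst _ _).2 (dfb_cst _ _).2 (dfb_id _).2.
rewrite /= chartK // Ad_one lie_alg_bracketE mu_sym.
set D := dif (fun v => Ad (chartV e v) X) u0 Y.
have -> : dif mu (u0, u0) (D, 0) = D.
  rewrite -(induced_in_chart lgs) ?vfield_in_chart_center ?right_invariant_one //.
move=> ->; by rewrite addrC addKr.
Qed.

Lemma lie_alg_bracketC X Y : lie_alg_bracket G X Y = - lie_alg_bracket G Y X.
Proof. by rewrite !lie_alg_bracketE opprB. Qed.

Lemma lie_alg_bracket_linear X : linear (lie_alg_bracket G X).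
Proof.
have E Y : lie_alg_bracket G X Y = dif (fun z => dif mu z (X, 0)) (u0, u0) (0, Y) -
    dif (fun z => dif mu z (0, X)) (u0, u0) (Y, 0).
  by rewrite lie_alg_bracketE mu_sym.
move=> a Y Z; rewrite !E.
have -> : ((0, a *: Y + Z) : 'rV[R]_d * 'rV[R]_d) = a *: (0, Y) + (0, Z).
  exact: linear_inr.
have -> : ((a *: Y + Z, 0) : 'rV[R]_d * 'rV[R]_d) = a *: (Y, 0) + (Z, 0).
  exact: linear_inl.
by rewrite !difD !difZ scalerBr opprD addrACA.
Qed.

End LeftRight.

Lemma linear_continuous_fin (R : realType) (V W : normedModType R) (f : V -> W) :
  fin_coords V -> linear f -> continuous f.
Proof.
move=> [N [b [c [cP bP]]]] lf v.
pose fM := GRing.isLinear.Build _ _ _ _ _ lf.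
pose fL : {linear V -> W} := HB.pack f fM.
have E : forall w, setT w -> \sum_i c i w *: f (b i) = f w.
  move=> w _; rewrite [in RHS](bP w) -[f (\sum_i _)]/(fL _) linear_sum.
  by apply: eq_bigr => i _; rewrite linearZ.
have : Ck 0 setT f.
  apply: (Ck_eq openT E); apply: Ck_sum => [|i]; first exact: openT.
  apply: Ck_scale; [exact: openT | | exact: Ck_cst].
  by apply: Ck_linear; have [] := cP i.
by move=> /(_ v I).
Qed.

(** * The isotropy algebra and its invariant complement *)

Section Isotropy.
Variables (R : realType) (d : nat) (G : lie_group R d).
Local Notation e := (lg_one G).
Local Notation u0 := (chart e e).

Local Transparent dif dfb.
Lemma dif_of_is_derive (W : normedModType R) (f : R^o -> W) (t : R^o) (w : W) :
  is_derive t (1 : R^o) f w -> dfb f t /\ dif f t 1 = w.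
Proof.
move=> [df E]; have df' : differentiable f t by apply/derivable1_diffP.
by split => //; rewrite /dif -deriveE.
Qed.
Local Opaque dif dfb.

Lemma one_parameter_subgroup0 X (c : R -> G) : one_parameter_subgroup X c -> c 0 = e.
Proof.
move=> [_ ch _]; have := ch 0 0; rewrite addr0 => E.
by rewrite -(lg_mulV (c 0)) {3}E lg_mulA lg_mulV lg_mul1.
Qed.

Lemma one_parameter_subgroup_dif X (c : R -> G) : one_parameter_subgroup X c ->
  dfb (fun t : R^o => chart e (c t)) 0 /\ dif (fun t : R^o => chart e (c t)) 0 1 = X.
Proof. by move=> [_ _ h]; exact: dif_of_is_derive. Qed.

(** The curve [Ad (c t) X] stays in [mm] and has the bracket as its velocity at t = 0. Membership in
    [mm] is tested by a linear map [l] with kernel [mm], so that the function differentiated is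
    locally zero. *)
Lemma lie_subalg_complement (K : set G) (mm : {vspace 'rV[R]_d}) X Y :
  reductive_complement K mm -> lie_subalg K Y -> X \in mm ->
  lie_alg_bracket G Y X \in mm.
Proof.
move=> [_ _ AdK] [c c1 cK] Xm.
have c0 := one_parameter_subgroup0 c1; have [cc _ _] := c1.
pose l (Z : 'rV[R]_d) := Z - projv mm Z.
have ll : linear l by move=> a x y; rewrite /l linearP scalerBr opprD addrACA.
have cl : continuous l by apply: linear_continuous_fin ll; exact: fin_coords_rV.
have l0 Z : Z \in mm -> l Z = 0 by move=> Zm; rewrite /l projv_id // subrr.
suff : l (lie_alg_bracket G Y X) = 0.
  by move/eqP; rewrite subr_eq0 => /eqP ->; exact: memv_proj.
have [dz Ez] := Ad_derivative G X.
have [dv Ev] := one_parameter_subgroup_dif c1.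
have dz' : dfb (fun v => Ad (chartV e v) X) ((fun t : R^o => chart e (c t)) 0).
  by rewrite c0.
have [d1 E1] := dfb_comp dv dz'.
have [d2 E2] := dfb_lin (((fun v => Ad (chartV e v) X) \o (fun t : R^o => chart e (c t))) 0) ll cl.
have [d3 E3] := dfb_comp d1 d2.
have oA : open [set t : R^o | dom e (c t)].
  apply: open_of_nbhs => t ht; apply: (cc t); apply: open_nbhs_nbhs.
  by split => //; exact: dom_open.
have A0 : [set t : R^o | dom e (c t)] 0 by rewrite /= c0; exact: dom_center.
have [|_ E4] := @dfb_near_open _ _ _ _ _ (cst 0) _ oA A0 _ d3.
  by move=> t ht; rewrite /= chartK // l0 //; exact: AdK.
by have := E4 1; rewrite (dfb_cst _ _).2 E3 E2 E1 Ev c0 Ez => <-.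
Qed.

End Isotropy.

(** * Brackets of induced fields *)

Section InducedBrackets.
Variables (R : realType) (d m : nat) (G : lie_group R d) (M : manifold R m).
Variables (act : G -> M -> M).
Hypothesis act_smooth : smooth_action act.
Local Notation e := (lg_one G).
Local Notation lgs := (lg_mul_action G).

Let act1 z : act e z = z. Proof. by have [_ ->] := act_smooth. Qed.
Let actM a b z : act (lg_mul a b) z = act a (act b z).
Proof. by have [_ _ ->] := act_smooth. Qed.

(** Right translation by [a] followed by the orbit map of [z] is the orbit map of [act a z]. *)
Lemma tdiff_orbit_map X z a :
  tdiff (act ^~ z) a (induced_vfield (@lg_mul R d G) X a) = induced_vfield act X (act a z).
Proof.
rewrite /induced_vfield.
have d1 := smooth_map_dfb e (smooth_map_act1 lgs a).
have d2 := smooth_map_dfb (lg_mul e a) (smooth_map_act1 act_smooth z).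
have [_ E] := tdiff_comp X (act_continuous1 lgs a) d1 d2.
have F : (act ^~ z) \o ((@lg_mul R d G) ^~ a) = act ^~ (act a z).
  by apply/funext => b; rewrite /= actM.
rewrite F in E; rewrite E lg_mul1; reflexivity.
Qed.

(** The orbit map of [z] relates right-invariant fields to induced ones, so the sign of
    [right_invariant_bracket] passes to M. *)
Lemma induced_bracket X Y z :
  lie_bracket (induced_vfield act X) (induced_vfield act Y) z =
  - induced_vfield act (lie_alg_bracket G X Y) z.
Proof.
have := lie_bracket_related e (smooth_map_act1 act_smooth z)
  (smooth_induced lgs X) (smooth_induced lgs Y)
  (smooth_induced act_smooth X) (smooth_induced act_smooth Y)
  (tdiff_orbit_map X z) (tdiff_orbit_map Y z).
rewrite right_invariant_bracket act1 => <-.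
by rewrite !tdiffE difN.
Qed.

(** This is the identity a (b z) = (a b a^-1) (a z), differentiated in b at the identity. *)
Lemma Ad_induced a X z :
  tdiff (act a) z (induced_vfield act X z) = induced_vfield act (Ad a X) (act a z).
Proof.
rewrite /induced_vfield.
have [d0 _] := Ad_left_right a X.
have d1 := smooth_map_dfb (conjg_lg a e) (smooth_map_act1 act_smooth (act a z)).
have [_ E1] := tdiff_comp X (@conjg_lg_continuous R d G a) d0 d1.
have d2 := smooth_map_dfb e (smooth_map_act1 act_smooth z).
have d3 := smooth_map_dfb (act e z) (smooth_map_act2 act_smooth a).
have [_ E2] := tdiff_comp X (act_continuous1 act_smooth z) d2 d3.
have F : (act ^~ (act a z)) \o conjg_lg a = act a \o (act ^~ z).
  by apply/funext => b; rewrite /= /conjg_lg -!actM -!lg_mulA lg_mulV lg_mulr1.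
rewrite F in E1.
transitivity (tdiff (act a) (act e z) (tdiff (act ^~ z) e X)).
  rewrite act1; reflexivity.
rewrite -E2 E1 conjg_lg_one; reflexivity.
Qed.

(** [act a] relates the field of X to that of [Ad a X], and brackets of related fields are related.
    Thus Ad_a respects the bracket as far as the fields on M can see, which is the form in which it
    is used. *)
Lemma Ad_bracket_induced (a : G) X Y z :
  induced_vfield act (lie_alg_bracket G (Ad a X) (Ad a Y)) z =
  induced_vfield act (Ad a (lie_alg_bracket G X Y)) z.
Proof.
pose w := act (lg_inv a) z.
have zE : z = act a w by rewrite /w -actM lg_mulrV act1.
have := lie_bracket_related w (smooth_map_act2 act_smooth a)
  (smooth_induced act_smooth X) (smooth_induced act_smooth Y)
  (smooth_induced act_smooth (Ad a X)) (smooth_induced act_smooth (Ad a Y))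
  (Ad_induced a X) (Ad_induced a Y).
rewrite !induced_bracket -zE => /eqP.
rewrite tdiffE difN -tdiffE Ad_induced -zE eqr_opp => /eqP <-; reflexivity.
Qed.

(** The curve [c t] fixes [x], so the orbit map is constant along it. *)
Lemma lie_subalg_isotropy x X :
  lie_subalg (isotropy act x) X -> induced_vfield act X x = 0.
Proof.
move=> [c c1 cK]; have c0 := one_parameter_subgroup0 c1; have [cc _ _] := c1.
have [dv Ev] := one_parameter_subgroup_dif c1.
rewrite /induced_vfield tdiffE.
have d1 : dfb (chart (act e x) \o act^~ x \o chartV e) ((fun t : R^o => chart e (c t)) 0).
  rewrite c0; exact: (smooth_map_dfb e (smooth_map_act1 act_smooth x)).
have [d2 E2] := dfb_comp dv d1.
have oA : open [set t : R^o | dom e (c t)].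
  apply: open_of_nbhs => t ht; apply: (cc t); apply: open_nbhs_nbhs.
  by split => //; exact: dom_open.
have A0 : [set t : R^o | dom e (c t)] 0 by rewrite /= c0; exact: dom_center.
have [|_ E4] := @dfb_near_open _ _ _ _ _ (cst (chart (act e x) x)) _ oA A0 _ d2.
  by move=> t ht; rewrite /= chartK // (cK t).
by have := E4 1; rewrite (dfb_cst _ _).2 E2 Ev c0 => <-.
Qed.

End InducedBrackets.

(** * Differentiating tensors applied to fields *)

Section LinearFields.
Variables (R : realType) (T U V W : normedModType R).
Hypothesis fV : fin_coords V.

(** Product rule for a tensor applied to a field: in the uses, [u] is the point in a chart and [a]
    the field in components. Linearity in [a] reduces it to the finitely many coefficient functions
    [B (b i)]. *)
Lemma dfb_linear_field (A : set U) (B : V -> U -> W) (x : T -> V) (g : T -> U) t :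
  (forall u, linear (B ^~ u)) -> (forall a, Ck 1 A (B a)) -> A (g t) ->
  dfb g t -> dfb x t ->
  dfb (fun s => B (x s) (g s)) t /\
  forall h, dif (fun s => B (x s) (g s)) t h =
    dif (B (x t)) (g t) (dif g t h) + B (dif x t h) (g t).
Proof.
move=> lB cB At dg dx; have [N [b [c [cP bP]]]] := fV.
have expand a u : B a u = \sum_i c i a *: B (b i) u.
  pose lM := GRing.isLinear.Build _ _ _ _ _ (lB u).
  pose l : {linear V -> W} := HB.pack (B ^~ u) lM.
  rewrite {1}(bP a) -[LHS]/(l _) linear_sum.
  by apply: eq_bigr => i _; rewrite linearZ.
have dcx i : dfb (c i \o x) t /\ forall h, dif (c i \o x) t h = c i (dif x t h).
  have [li ci] := cP i; have [d E] := dfb_lin (x t) li ci.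
  by have [d' E'] := dfb_comp dx d; split=> // h; rewrite E' E.
have dBg i : dfb (fun s => B (b i) (g s)) t /\
    forall h, dif (fun s => B (b i) (g s)) t h = dif (B (b i)) (g t) (dif g t h).
  exact: (@dfb_comp _ _ _ _ g (B (b i)) t dg (Ck_dfb (cB (b i)) At)).
have -> : (fun s => B (x s) (g s)) = (fun s => \sum_i (c i \o x) s *: B (b i) (g s)).
  by apply/funext => s; rewrite expand.
have ds i := dfb_scale (dcx i).1 (dBg i).1.
have [d E] := dfb_sum (fun i => (ds i).1).
split=> // h; rewrite E.
have -> : dif (B (x t)) (g t) (dif g t h) =
    \sum_i c i (x t) *: dif (B (b i)) (g t) (dif g t h).
  have -> : B (x t) = (fun u => \sum_i cst (c i (x t) : R^o) u *: B (b i) u).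
    by apply/funext => u; rewrite expand.
  have dc i := dfb_cst (c i (x t) : R^o) (g t).
  have ds' i := dfb_scale (dc i).1 (Ck_dfb (cB (b i)) At).
  rewrite (dfb_sum (fun i => (ds' i).1)).2.
  by apply: eq_bigr => i _; rewrite (ds' i).2 (dc i).2 scale0r add0r.
rewrite [in RHS](expand _ (g t)) -big_split; apply: eq_bigr => i _ /=.
by rewrite (ds i).2 (dcx i).2 (dBg i).2 addrC.
Qed.

Lemma Ck_linear_field k (A : set U) (B : V -> U -> W) (x : U -> V) : open A ->
  (forall u, linear (B ^~ u)) -> (forall a, Ck k A (B a)) -> Ck k A x ->
  Ck k A (fun u => B (x u) u).
Proof.
move=> oA lB cB cx; have [N [b [c [cP bP]]]] := fV.
have expand a u : B a u = \sum_i c i a *: B (b i) u.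
  pose lM := GRing.isLinear.Build _ _ _ _ _ (lB u).
  pose l : {linear V -> W} := HB.pack (B ^~ u) lM.
  rewrite {1}(bP a) -[LHS]/(l _) linear_sum.
  by apply: eq_bigr => i _; rewrite linearZ.
have E u : A u -> \sum_i c i (x u) *: B (b i) u = B (x u) u.
  by move=> _; rewrite [RHS]expand.
apply: (Ck_eq oA E).
apply: Ck_sum => // i; apply: Ck_scale => //.
by have [li ci] := cP i; exact: (Ck_linear_comp oA li ci cx).
Qed.

End LinearFields.

Lemma dfb_bilinear_field (R : realType) (T U V W : normedModType R)
    (A : set U) (B : V -> V -> U -> W) (x y : T -> V) (g : T -> U) t :
  fin_coords V ->
  (forall b u, linear (fun a => B a b u)) -> (forall a u, linear (fun b => B a b u)) ->
  (forall a b, Ck 1 A (B a b)) -> A (g t) -> dfb g t -> dfb x t -> dfb y t ->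
  dfb (fun s => B (x s) (y s) (g s)) t /\
  forall h, dif (fun s => B (x s) (y s) (g s)) t h =
    dif (B (x t) (y t)) (g t) (dif g t h) + B (dif x t h) (y t) (g t)
    + B (x t) (dif y t h) (g t).
Proof.
move=> fV l1 l2 cB At dg dx dy; have [N [b [c [cP bP]]]] := fV.
have expand a e u : B a e u = \sum_i c i e *: B a (b i) u.
  pose lM := GRing.isLinear.Build _ _ _ _ _ (l2 a u).
  pose l : {linear V -> W} := HB.pack (fun b => B a b u) lM.
  rewrite {1}(bP e) -[LHS]/(l _) linear_sum.
  by apply: eq_bigr => i _; rewrite linearZ.
have dcy i : dfb (c i \o y) t /\ forall h, dif (c i \o y) t h = c i (dif y t h).
  have [li ci] := cP i; have [d E] := dfb_lin (y t) li ci.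
  by have [d' E'] := dfb_comp dy d; split=> // h; rewrite E' E.
have dBg i := dfb_linear_field fV (l1 (b i)) (fun a => cB a (b i)) At dg dx.
have -> : (fun s => B (x s) (y s) (g s)) =
    (fun s => \sum_i (c i \o y) s *: B (x s) (b i) (g s)).
  by apply/funext => s; rewrite expand.
have ds i := dfb_scale (dcy i).1 (dBg i).1.
have [d E] := dfb_sum (fun i => (ds i).1).
split=> // h; rewrite E.
have -> : dif (B (x t) (y t)) (g t) (dif g t h) =
    \sum_i c i (y t) *: dif (B (x t) (b i)) (g t) (dif g t h).
  have -> : B (x t) (y t) = (fun u => \sum_i cst (c i (y t) : R^o) u *: B (x t) (b i) u).
    by apply/funext => u; rewrite expand.
  have dc i := dfb_cst (c i (y t) : R^o) (g t).
  have ds' i := dfb_scale (dc i).1 (Ck_dfb (cB (x t) (b i)) At).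
  rewrite (dfb_sum (fun i => (ds' i).1)).2.
  by apply: eq_bigr => i _; rewrite (ds' i).2 (dc i).2 scale0r add0r.
rewrite [B (dif x t h) _ _]expand [B (x t) (dif y t h) _]expand -!big_split.
apply: eq_bigr => i _ /=.
by rewrite (ds i).2 (dcy i).2 (dBg i).2 scalerDr addrC.
Qed.

Section Tensors.
Variables (R : realType) (m : nat) (M : manifold R m).
Variables (om : tensor2 M) (J : endo_field M).
Hypothesis om_smooth : smooth_tensor2 om.
Hypothesis J_smooth : smooth_endo_field J.

Let fm : fin_coords 'rV[R]_m := @fin_coords_rV R m.

(** Derivative of the field in the preferred chart at [p]. It depends on the chart and serves as a
    common intermediate for brackets and for derivatives of tensors. *)
Definition vdif (X : vfield M) (p : M) (w : 'rV[R]_m) : 'rV[R]_m :=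
  dif (vfield_in_chart X p) (chart p p) w.

Lemma lie_bracket_vdif (X Y : vfield M) p :
  lie_bracket X Y p = vdif Y p (X p) - vdif X p (Y p).
Proof. by rewrite lie_bracketE /local_bracket !vfield_in_chart_center. Qed.

Definition form_in_chart (p : M) (a b u : 'rV[R]_m) : R^o :=
  om (chartV p u) (dchartV p (chartV p u) a) (dchartV p (chartV p u) b).

Definition endo_in_chart (p : M) (a u : 'rV[R]_m) : 'rV[R]_m :=
  dchart p (chartV p u) (J (chartV p u) (dchartV p (chartV p u) a)).

Lemma form_in_chart_linear1 p b u : linear (fun a => form_in_chart p a b u).
Proof.
move=> a v w; have [_ [l _]] := om_smooth.
by rewrite /form_in_chart (dchartV_linear p); exact: l.
Qed.

Lemma form_in_chart_linear2 p a u : linear (fun b => form_in_chart p a b u).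
Proof.
move=> c v w; have [l _] := om_smooth.
by rewrite /form_in_chart (dchartV_linear p); exact: l.
Qed.

Lemma endo_in_chart_linear p u : linear (endo_in_chart p ^~ u).
Proof.
move=> a v w; have [l _] := J_smooth.
rewrite /endo_in_chart (dchartV_linear p) l; exact: dchart_linear.
Qed.

Lemma form_in_chart_smooth p a b k : Ck k (cod p) (form_in_chart p a b).
Proof. by have [_ [_ h]] := om_smooth; exact: (h p a b k). Qed.

Lemma endo_in_chart_smooth p a k : Ck k (cod p) (endo_in_chart p a).
Proof. by have [_ h] := J_smooth; exact: (h p a k). Qed.

Lemma form_in_chartE p q a b : dom p q ->
  form_in_chart p (dchart p q a) (dchart p q b) (chart p q) = om q a b.
Proof. by move=> pq; rewrite /form_in_chart (chartK pq) (dchartK a pq) (dchartK b pq). Qed.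

Lemma endo_in_chartE p q a : dom p q ->
  endo_in_chart p (dchart p q a) (chart p q) = dchart p q (J q a).
Proof. by move=> pq; rewrite /endo_in_chart (chartK pq) (dchartK a pq). Qed.

Lemma form_in_chart_center p a b : form_in_chart p a b (chart p p) = om p a b.
Proof.
rewrite -(form_in_chartE a b (dom_center p)) !dchart_id; reflexivity.
Qed.

Lemma endo_in_chart_center p a : endo_in_chart p a (chart p p) = J p a.
Proof.
rewrite -[RHS](dchart_id p) -(endo_in_chartE a (dom_center p)) dchart_id; reflexivity.
Qed.

Let pp (p : M) : cod p (chart p p). Proof. by apply: chart_cod; exact: dom_center. Qed.

Lemma endo_vfield_in_chart (X : vfield M) p u : cod p u ->
  vfield_in_chart (endo_vfield J X) p u = endo_in_chart p (vfield_in_chart X p u) u.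
Proof.
move=> pu; rewrite /vfield_in_chart /endo_vfield.
rewrite -(endo_in_chartE _ (chartV_dom pu)) chartVK //.
Qed.

Lemma smooth_endo_vfield (X : vfield M) : smooth_vfield X -> smooth_vfield (endo_vfield J X).
Proof.
move=> sX p k; have E u : cod p u -> endo_in_chart p (vfield_in_chart X p u) u =
    vfield_in_chart (endo_vfield J X) p u.
  by move=> pu; rewrite endo_vfield_in_chart.
apply: (Ck_eq (@cod_open _ _ M p) E).
apply: (Ck_linear_field fm (@cod_open _ _ M p)) => //.
- exact: endo_in_chart_linear.
- by move=> a; exact: endo_in_chart_smooth.
- exact: sX.
Qed.

Lemma vdif_endo (X : vfield M) p w : smooth_vfield X ->
  vdif (endo_vfield J X) p w =
  dif (endo_in_chart p (X p)) (chart p p) w + J p (vdif X p w).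
Proof.
move=> sX; have dX := (smooth_vfieldP 1 sX (pp p)).1.
have [d1 E1] := @dfb_linear_field _ _ _ _ _ fm (cod p) (endo_in_chart p)
  (vfield_in_chart X p) id (chart p p) (@endo_in_chart_linear p)
  (fun a => @endo_in_chart_smooth p a 1) (pp p) (dfb_id _).1 dX.
have [|_ E2] := @dfb_near_open _ _ _ _ _ (vfield_in_chart (endo_vfield J X) p) _
  (@cod_open _ _ M p) (pp p) _ d1.
  by move=> u pu; rewrite endo_vfield_in_chart.
rewrite /vdif E2 E1 (dfb_id _).2 vfield_in_chart_center endo_in_chart_center.
reflexivity.
Qed.

Lemma form_of_vfields (X Y : vfield M) p : smooth_vfield X -> smooth_vfield Y ->
  dfb (fun u => om (chartV p u) (X (chartV p u)) (Y (chartV p u)) : R^o) (chart p p) /\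
  forall w, dif (fun u => om (chartV p u) (X (chartV p u)) (Y (chartV p u)) : R^o) (chart p p) w
  = dif (form_in_chart p (X p) (Y p)) (chart p p) w
    + om p (vdif X p w) (Y p) + om p (X p) (vdif Y p w).
Proof.
move=> sX sY; have dX := (smooth_vfieldP 1 sX (pp p)).1.
have dY := (smooth_vfieldP 1 sY (pp p)).1.
have [d1 E1] := @dfb_bilinear_field _ _ _ _ _ (cod p) (form_in_chart p)
  (vfield_in_chart X p) (vfield_in_chart Y p) id (chart p p) fm
  (@form_in_chart_linear1 p) (@form_in_chart_linear2 p)
  (fun a b => @form_in_chart_smooth p a b 1) (pp p) (dfb_id _).1 dX dY.
have [|d2 E2] := @dfb_near_open _ _ _ _ _
  (fun u => om (chartV p u) (X (chartV p u)) (Y (chartV p u)) : R^o) _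
  (@cod_open _ _ M p) (pp p) _ d1.
  move=> u pu; rewrite -(form_in_chartE _ _ (chartV_dom pu)) chartVK //.
split=> // w; rewrite E2 E1 (dfb_id _).2 !vfield_in_chart_center !form_in_chart_center.
reflexivity.
Qed.

Lemma vderive_form (Z X Y : vfield M) p : smooth_vfield X -> smooth_vfield Y ->
  vderive Z (fun q => om q (X q) (Y q)) p =
  dif (form_in_chart p (X p) (Y p)) (chart p p) (Z p)
    + om p (vdif X p (Z p)) (Y p) + om p (X p) (vdif Y p (Z p)).
Proof. by move=> sX sY; rewrite vderiveE (form_of_vfields p sX sY).2. Qed.

End Tensors.

(** * Infinitesimal invariance of om and J *)

Section Killing.
Variables (R : realType) (d m : nat) (G : lie_group R d) (M : manifold R m).
Variables (act : G -> M -> M) (om : tensor2 M) (J : endo_field M).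
Hypothesis act_smooth : smooth_action act.
Hypothesis om_smooth : smooth_tensor2 om.
Hypothesis J_smooth : smooth_endo_field J.
Hypothesis act_om : preserves_form act om.
Hypothesis act_J : preserves_acs act J.
Local Notation e := (lg_one G).
Local Notation u0 := (chart e e).

Let fm : fin_coords 'rV[R]_m := @fin_coords_rV R m.

Let pp (p : M) : cod p (chart p p). Proof. by apply: chart_cod; exact: dom_center. Qed.

Lemma act_chart_dif2 p v w : actdom act e p p (v, chart p p) ->
  dif (act_chart act e p p) (v, chart p p) (0, w) =
  dchart p (act (chartV e v) p) (tdiff (act (chartV e v)) p w).
Proof.
move=> hd; have [[/= ev _]] := hd; rewrite (chartK (dom_center p)) => hp.
have [_ <-] := tdiff_in_charts w (smooth_map_act2 act_smooth (chartV e v)) (dom_center p) hp.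
rewrite dchart_id -(dfb_partial2 (Ck_dfb (act_chart1_smooth act_smooth p 1) hd)).2.
reflexivity.
Qed.

Lemma act_chart_dif2_one p w :
  dif (act_chart act e p p) (u0, chart p p) (0, w) = w.
Proof.
have hd := actdom1 act_smooth (pp p).
rewrite -(dfb_partial2 (Ck_dfb (act_chart1_smooth act_smooth p 1) hd)).2.
have [did Eid] := dfb_id (chart p p).
have [|_ ->] := @dfb_near_open _ _ _ _ _
  (fun u => act_chart act e p p (u0, u)) _ (@cod_open _ _ M p) (pp p) _ did.
  by move=> u pu; rewrite (act_chart1E act_smooth pu).
exact: Eid.
Qed.

Lemma act_chart_dif1_one p X :
  dif (act_chart act e p p) (u0, chart p p) (X, 0) = induced_vfield act X p.
Proof.
rewrite -(induced_in_chart act_smooth X (pp p)) vfield_in_chart_center; reflexivity.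
Qed.

(** Variational equation of the action: exchanging the derivative in the group variable with the one
    in the point turns the rate of change of the differential of [act] into the derivative of the
    induced field. *)
Lemma act_chart_mixed p X w :
  dfb (fun v => dif (act_chart act e p p) (v, chart p p) (0, w)) u0 /\
  dif (fun v => dif (act_chart act e p p) (v, chart p p) (0, w)) u0 X =
  vdif (induced_vfield act X) p w.
Proof.
have hd := actdom1 act_smooth (pp p).
have C2 := act_chart1_smooth act_smooth p 2.
have [d1 E1] := dfb_partial1 (Ck_dfb (Ck_dif (0, w) C2) hd).
split; first exact: d1.
rewrite E1 (dif_sym _ _ fm (actdom_open act_smooth e p p) hd C2).
have [d2 E2] := dfb_partial2 (Ck_dfb (Ck_dif (X, 0) C2) hd).
rewrite -E2; rewrite /vdif.
have [|_ ->] := @dfb_near_open _ _ _ _ _ (vfield_in_chart (induced_vfield act X) p) _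
  (@cod_open _ _ M p) (pp p) _ d2.
  by move=> u pu; rewrite (induced_in_chart act_smooth X pu).
reflexivity.
Qed.

Let A p : set 'rV[R]_d := [set v | actdom act e p p (v, chart p p)].

Let oA p : open (A p).
Proof.
have -> : A p = map_dom (act ^~ p) e p.
  apply/seteqP; split => v; rewrite /A /actdom /map_dom /= (chartK (dom_center p)).
    by move=> [[? _] ?].
  by move=> [? ?]; split => //; split => //; exact: pp.
exact: map_dom_open (act_continuous1 act_smooth p).
Qed.

Let A0 p : A p u0. Proof. exact: (actdom1 act_smooth (pp p)). Qed.

Let dg p : dfb (fun v => act_chart act e p p (v, chart p p)) u0 /\
  forall X, dif (fun v => act_chart act e p p (v, chart p p)) u0 X = induced_vfield act X p.
Proof.
have hd := actdom1 act_smooth (pp p).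
have [d1 E1] := dfb_partial1 (Ck_dfb (act_chart1_smooth act_smooth p 1) hd).
split; first exact: d1.
move=> X; rewrite E1 act_chart_dif1_one; reflexivity.
Qed.

(** By invariance, om at the image of [p] under a group element, applied to the images of [a] and
    [b], does not depend on that element. Its derivative at the identity along X is the left side,
    the Lie derivative of om along X' in coordinates. *)
Lemma killing_form_in_chart p X a b :
  dif (form_in_chart om p a b) (chart p p) (induced_vfield act X p)
  + om p (vdif (induced_vfield act X) p a) b
  + om p a (vdif (induced_vfield act X) p b) = 0.
Proof.
have [dx Ex] := act_chart_mixed p X a; have [dy Ey] := act_chart_mixed p X b.
have g0 : act_chart act e p p (u0, chart p p) = chart p p by exact: act_chart1E.
have hg : cod p (act_chart act e p p (u0, chart p p)) by rewrite g0.
have [d1 E1] := @dfb_bilinear_field _ _ _ _ _ (cod p) (form_in_chart om p)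
  (fun v => dif (act_chart act e p p) (v, chart p p) (0, a))
  (fun v => dif (act_chart act e p p) (v, chart p p) (0, b))
  (fun v => act_chart act e p p (v, chart p p)) u0 fm
  (form_in_chart_linear1 om_smooth p) (form_in_chart_linear2 om_smooth p)
  (fun a b => form_in_chart_smooth om_smooth p a b 1) hg (dg p).1 dx dy.
have [|_ E2] := @dfb_near_open _ _ _ _ _ (cst (om p a b : R^o)) _ (@oA p) (@A0 p) _ d1.
  move=> v hd; rewrite !(act_chart_dif2 _ hd).
  have [[/= ev _]] := hd; rewrite (chartK (dom_center p)) => hp.
  rewrite /act_chart /= (chartK (dom_center p)) (form_in_chartE _ _ _ hp).
  exact: act_om.
have := E2 X; rewrite (dfb_cst _ _).2 E1 (dg p).2 Ex Ey !act_chart_dif2_one g0.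
by rewrite !form_in_chart_center => <-.
Qed.

(** The same differentiation applied to [act_J]; the equation says that the Lie derivative of J
    along X' vanishes. *)
Lemma killing_endo_in_chart p X a :
  dif (endo_in_chart J p a) (chart p p) (induced_vfield act X p)
  + J p (vdif (induced_vfield act X) p a) = vdif (induced_vfield act X) p (J p a).
Proof.
have [dx Ex] := act_chart_mixed p X a; have [dy Ey] := act_chart_mixed p X (J p a).
have g0 : act_chart act e p p (u0, chart p p) = chart p p by exact: act_chart1E.
have hg : cod p (act_chart act e p p (u0, chart p p)) by rewrite g0.
have [d1 E1] := @dfb_linear_field _ _ _ _ _ fm (cod p) (endo_in_chart J p)
  (fun v => dif (act_chart act e p p) (v, chart p p) (0, a))
  (fun v => act_chart act e p p (v, chart p p)) u0
  (endo_in_chart_linear J_smooth p)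
  (fun a => endo_in_chart_smooth J_smooth p a 1) hg (dg p).1 dx.
have [|_ E2] := @dfb_near_open _ _ _ _ _
   (fun v => dif (act_chart act e p p) (v, chart p p) (0, J p a)) _ (@oA p) (@A0 p) _ d1.
  move=> v hd; rewrite !(act_chart_dif2 _ hd).
  have [[/= ev _]] := hd; rewrite (chartK (dom_center p)) => hp.
  rewrite /act_chart /= (chartK (dom_center p)) (endo_in_chartE _ _ hp).
  by rewrite act_J.
have := E2 X; rewrite E1 (dg p).2 Ex Ey !act_chart_dif2_one g0 endo_in_chart_center.
by move=> <-.
Qed.

End Killing.

(** * Almost Kaehler geometry and the Chern connection *)

Section FieldAlgebra.
Variables (R : realType) (m : nat) (M : manifold R m).
Implicit Types X Y Z : vfield M.

Definition lincomb (a : R) X Y : vfield M := fun q => a *: X q + Y q.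

Lemma lincomb_in_chart a X Y p u : vfield_in_chart (lincomb a X Y) p u =
  a *: vfield_in_chart X p u + vfield_in_chart Y p u.
Proof. exact: dchart_linear. Qed.

Lemma smooth_lincomb a X Y : smooth_vfield X -> smooth_vfield Y -> smooth_vfield (lincomb a X Y).
Proof.
move=> sX sY p k.
have E u : cod p u -> cst (a : R^o) u *: vfield_in_chart X p u + vfield_in_chart Y p u =
    vfield_in_chart (lincomb a X Y) p u by move=> _; rewrite lincomb_in_chart.
have oc : open (cod p) := @cod_open _ _ M p.
apply: (Ck_eq oc E); apply: (Ck_add oc); last exact: sY.
by apply: (Ck_scale oc); [exact: Ck_cst | exact: sX].
Qed.

Lemma vdif_lincomb a X Y p w : smooth_vfield X -> smooth_vfield Y ->
  vdif (lincomb a X Y) p w = a *: vdif X p w + vdif Y p w.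
Proof.
move=> sX sY; have pp : cod p (chart p p) by apply: chart_cod; exact: dom_center.
have [dX _] := smooth_vfieldP 1 sX pp; have [dY _] := smooth_vfieldP 1 sY pp.
have [dc Ec] := dfb_cst (a : R^o) (chart p p).
have [d1 E1] := dfb_scale dc dX.
have [d2 E2] := dfb_add d1 dY.
rewrite /vdif; have -> : vfield_in_chart (lincomb a X Y) p =
    (fun u => cst (a : R^o) u *: vfield_in_chart X p u + vfield_in_chart Y p u).
  by apply/funext => u; rewrite lincomb_in_chart.
by rewrite E2 E1 Ec scale0r add0r.
Qed.

Lemma vdif_linear X p : linear (vdif X p).
Proof. exact: dif_is_linear. Qed.

Global Opaque vdif lie_bracket vderive vfield_in_chart dchart dchartV tdiff.

Lemma lie_bracketC X Y p : lie_bracket X Y p = - lie_bracket Y X p.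
Proof. by rewrite !lie_bracket_vdif opprB. Qed.

Lemma lie_bracket_lincombr a X Y Z p :
  smooth_vfield X -> smooth_vfield Y -> smooth_vfield Z ->
  lie_bracket Z (lincomb a X Y) p = a *: lie_bracket Z X p + lie_bracket Z Y p.
Proof.
move=> sX sY sZ; rewrite !lie_bracket_vdif vdif_lincomb // vdif_linear.
move: (vdif X p _) (vdif Y p _) (vdif Z p _) (vdif Z p _) => x y z w.
by rewrite scalerBr opprD addrACA.
Qed.

Lemma lie_bracket_lincombl a X Y Z p :
  smooth_vfield X -> smooth_vfield Y -> smooth_vfield Z ->
  lie_bracket (lincomb a X Y) Z p = a *: lie_bracket X Z p + lie_bracket Y Z p.
Proof.
move=> sX sY sZ; rewrite lie_bracketC lie_bracket_lincombr //.
by rewrite opprD -scalerN -!lie_bracketC.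
Qed.

(** Written as -2 X + X, so that the closure and linearity properties of [lincomb] apply to it. *)
Definition opp_vf X : vfield M := lincomb (-2) X X.

Lemma opp_vfE X q : opp_vf X q = - X q.
Proof. by rewrite /opp_vf /lincomb scaleNr scaler_nat mulr2n opprD subrK. Qed.

Lemma lie_bracket_oppl X Z p : smooth_vfield X -> smooth_vfield Z ->
  lie_bracket (opp_vf X) Z p = - lie_bracket X Z p.
Proof.
by move=> sX sZ; rewrite lie_bracket_lincombl // scaleNr scaler_nat mulr2n opprD subrK.
Qed.

Lemma lie_bracket_oppr X Z p : smooth_vfield X -> smooth_vfield Z ->
  lie_bracket Z (opp_vf X) p = - lie_bracket Z X p.
Proof. by move=> sX sZ; rewrite lie_bracketC lie_bracket_oppl // -lie_bracketC. Qed.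

(** Differentiability is part of the relation, since additivity of [vderive] depends on it. *)
Definition has_vderive X p (f : M -> R) (c : R) : Prop :=
  dfb (fun u => f (chartV p u) : R^o) (chart p p) /\ vderive X f p = c.

Lemma has_vderive_add X p f g a b :
  has_vderive X p f a -> has_vderive X p g b ->
  has_vderive X p (fun q => f q + g q) (a + b).
Proof.
move=> [df <-] [dg <-]; have [d E] := dfb_add df dg.
by split; [exact: d | rewrite !vderiveE E].
Qed.

Lemma has_vderive_sub X p f g a b :
  has_vderive X p f a -> has_vderive X p g b ->
  has_vderive X p (fun q => f q - g q) (a - b).
Proof.
move=> [df <-] [dg <-]; have [d E] := dfb_sub df dg.
by split; [exact: d | rewrite !vderiveE E].
Qed.

Lemma vderive0 X p f : X p = 0 -> vderive X f p = 0.
Proof. by move=> X0; rewrite vderiveE X0 dif0. Qed.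

End FieldAlgebra.

(** * Pointwise algebra of om, J and g, and the Nijenhuis tensor *)

Section AlmostKaehler.
Variables (R : realType) (m : nat) (M : manifold R m).
Variables (om : tensor2 M) (J : endo_field M).
Hypothesis om_symplectic : symplectic_form om.
Hypothesis J_compatible : compatible_acs om J.
Implicit Types X Y Z W : vfield M.

Local Notation JF := (endo_vfield J).
Local Notation N := (nijenhuis J).
Local Notation g := (metric om J).

Lemma om_is_smooth : smooth_tensor2 om. Proof. by case: om_symplectic. Qed.
Lemma J_is_smooth : smooth_endo_field J. Proof. by case: J_compatible. Qed.

Lemma JD p u v : J p (u + v) = J p u + J p v.
Proof. by have [l _] := J_is_smooth; have := l p 1 u v; rewrite !scale1r. Qed.
Lemma J0 p : J p 0 = 0.
Proof. by apply: (addrI (J p 0)); rewrite -JD !addr0. Qed.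
Lemma JZ p a u : J p (a *: u) = a *: J p u.
Proof. by have [l _] := J_is_smooth; have := l p a u 0; rewrite J0 !addr0. Qed.
Lemma JN p u : J p (- u) = - J p u.
Proof. by rewrite -scaleN1r JZ scaleN1r. Qed.
Lemma JB p u v : J p (u - v) = J p u - J p v.
Proof. by rewrite JD JN. Qed.
Lemma JJ p u : J p (J p u) = - u. Proof. by have [_ ->] := J_compatible. Qed.
Lemma omJJ p u v : om p (J p u) (J p v) = om p u v.
Proof. by have [_ _ ->] := J_compatible. Qed.
Lemma om_anti p u v : om p u v = - om p v u.
Proof. by have [_ h _ _] := om_symplectic; exact: h. Qed.

Lemma omDl p u v w : om p (u + v) w = om p u w + om p v w.
Proof.
by have [_ [l _]] := om_is_smooth; have := l p w 1 u v; rewrite scale1r mul1r.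
Qed.
Lemma om0l p w : om p 0 w = 0.
Proof. by apply: (addrI (om p 0 w)); rewrite -omDl !addr0. Qed.
Lemma omZl p a u w : om p (a *: u) w = a * om p u w.
Proof.
by have [_ [l _]] := om_is_smooth; have := l p w a u 0; rewrite om0l !addr0.
Qed.
Lemma omNl p u w : om p (- u) w = - om p u w.
Proof. by rewrite -scaleN1r omZl mulN1r. Qed.
Lemma omBl p u v w : om p (u - v) w = om p u w - om p v w.
Proof. by rewrite omDl omNl. Qed.
Lemma omDr p u v w : om p w (u + v) = om p w u + om p w v.
Proof. by rewrite om_anti omDl opprD -!om_anti. Qed.
Lemma omZr p a u w : om p w (a *: u) = a * om p w u.
Proof. by rewrite om_anti omZl -mulrN -om_anti. Qed.
Lemma omNr p u w : om p w (- u) = - om p w u.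
Proof. by rewrite -scaleN1r omZr mulN1r. Qed.
Lemma omBr p u v w : om p w (u - v) = om p w u - om p w v.
Proof. by rewrite omDr omNr. Qed.

Lemma gC p u v : g p u v = g p v u.
Proof. by rewrite /metric -omJJ JJ omNr -om_anti. Qed.
Lemma gDl p u v w : g p (u + v) w = g p u w + g p v w. Proof. exact: omDl. Qed.
Lemma gNl p u w : g p (- u) w = - g p u w. Proof. exact: omNl. Qed.
Lemma gBl p u v w : g p (u - v) w = g p u w - g p v w. Proof. exact: omBl. Qed.
Lemma gZl p a u w : g p (a *: u) w = a * g p u w. Proof. exact: omZl. Qed.
Lemma gNr p u w : g p w (- u) = - g p w u. Proof. by rewrite gC gNl gC. Qed.
Lemma gJl p u w : g p (J p u) w = om p u w.
Proof. by rewrite /metric omJJ. Qed.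
Lemma gJr p u w : g p u (J p w) = - om p u w.
Proof. by rewrite /metric JJ omNr. Qed.
Lemma gJ p u w : g p (J p u) w = - g p u (J p w).
Proof. by rewrite gJl gJr opprK. Qed.
Lemma om_g p u w : om p u w = - g p u (J p w).
Proof. by rewrite gJr opprK. Qed.

Lemma smooth_JF X : smooth_vfield X -> smooth_vfield (JF X).
Proof. exact: (smooth_endo_vfield J_is_smooth). Qed.

Lemma JF_JF X : JF (JF X) = opp_vf X.
Proof. by apply/funext => q; rewrite opp_vfE /endo_vfield JJ. Qed.

Lemma nijenhuisE X Y p : N X Y p = 4^-1 *: (lie_bracket (JF X) (JF Y) p
  - J p (lie_bracket (JF X) Y p) - J p (lie_bracket X (JF Y) p) - lie_bracket X Y p).
Proof. by []. Qed.

Lemma smooth_nijenhuis X Y : smooth_vfield X -> smooth_vfield Y -> smooth_vfield (N X Y).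
Proof.
move=> sX sY; have sJX := smooth_JF sX; have sJY := smooth_JF sY.
have s1 := smooth_lie_bracket sJX sJY.
have s2 := smooth_JF (smooth_lie_bracket sJX sY).
have s3 := smooth_JF (smooth_lie_bracket sX sJY).
have s4 := smooth_lie_bracket sX sY.
have s0 := smooth_lincomb (-1) s4 (smooth_lincomb (-1) s3 (smooth_lincomb (-1) s2 s1)).
(* [lincomb (c - 1) T T] is c T, here with c = 1/4. *)
have := smooth_lincomb (4^-1 - 1) s0 s0; congr smooth_vfield; apply/funext => q.
rewrite /lincomb nijenhuisE /endo_vfield !scaleN1r.
rewrite scalerBl scale1r subrK; congr (_ *: _).
by rewrite addrC; congr (_ - _); rewrite addrC; congr (_ - _); rewrite addrC.
Qed.

Lemma nijenhuisC X Y p : N X Y p = - N Y X p.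
Proof.
rewrite !nijenhuisE -scalerN; congr (_ *: _).
rewrite (lie_bracketC (JF X) (JF Y)) (lie_bracketC (JF X) Y) (lie_bracketC X (JF Y)) (lie_bracketC X Y).
move: (lie_bracket (JF Y) (JF X) p) (lie_bracket Y X p) => a b.
move: (lie_bracket Y (JF X) p) (lie_bracket (JF Y) X p) => c d'.
rewrite !JN; move: (J p c) (J p d') => c' d''.
apply/matrixP => i j; rewrite !mxE; lra.
Qed.

Lemma nijenhuis_Jr X Y p : smooth_vfield X -> smooth_vfield Y ->
  N X (JF Y) p = - J p (N X Y p).
Proof.
move=> sX sY; have sJX := smooth_JF sX.
rewrite !nijenhuisE JF_JF (lie_bracket_oppr p sY sJX) (lie_bracket_oppr p sY sX).
move: (lie_bracket (JF X) (JF Y) p) (lie_bracket X Y p) => a b.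
move: (lie_bracket (JF X) Y p) (lie_bracket X (JF Y) p) => c d'.
rewrite JZ !JB !JJ !JN; move: (J p a) (J p b) => a' b'.
apply/matrixP => i j; rewrite !mxE; lra.
Qed.

Lemma nijenhuis_Jl X Y p : smooth_vfield X -> smooth_vfield Y ->
  N (JF X) Y p = - J p (N X Y p).
Proof. by move=> sX sY; rewrite nijenhuisC nijenhuis_Jr // -JN -nijenhuisC. Qed.

(* At a zero of Z the bracket [_, Z] only sees the linear part of Z. *)
Lemma vderive_form_zero X Z W p : smooth_vfield Z -> smooth_vfield W -> Z p = 0 ->
  vderive X (fun q => g q (Z q) (W q)) p = g p (lie_bracket X Z p) (W p).
Proof.
move=> sZ sW Z0; have sJW := smooth_JF sW.
rewrite (vderive_form om_is_smooth X p sZ sJW) Z0 om0l addr0.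
rewrite lie_bracket_vdif Z0.
have -> : vdif X p 0 = 0 by exact: dif0.
rewrite subr0.
have -> : form_in_chart om p 0 (JF W p) = cst (0 : R^o).
  apply/funext => u; rewrite /form_in_chart.
  have -> : dchartV p (chartV p u) 0 = 0 by exact: dif0.
  exact: om0l.
rewrite (dfb_cst _ _).2 add0r; reflexivity.
Qed.

(** The derivative of the coefficients of J is applied to the value of Z at [p], which is zero, so J
    comes out of the bracket. *)
Lemma lie_bracket_J_zero Z W p : smooth_vfield Z -> smooth_vfield W -> Z p = 0 ->
  lie_bracket (JF Z) W p = J p (lie_bracket Z W p).
Proof.
move=> sZ sW Z0; rewrite !lie_bracket_vdif (vdif_endo J_is_smooth p (W p) sZ) Z0.
have -> : JF Z p = 0 by rewrite /endo_vfield Z0 J0.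
have -> : vdif W p 0 = 0 by exact: dif0.
have -> : endo_in_chart J p 0 = cst 0.
  apply/funext => u; rewrite /endo_in_chart.
  have -> : dchartV p (chartV p u) 0 = 0 by exact: dif0.
  rewrite J0; exact: dif0.
by rewrite (dfb_cst _ _).2 !add0r JN.
Qed.

(** This carries the tensoriality of N in its first argument: with J taken out of the brackets by
    [lie_bracket_J_zero], the four terms cancel in pairs. *)
Lemma nijenhuis_zero Z W p : smooth_vfield Z -> smooth_vfield W -> Z p = 0 ->
  N Z W p = 0.
Proof.
move=> sZ sW Z0; have sJW := smooth_JF sW.
rewrite nijenhuisE (lie_bracket_J_zero sZ sJW Z0) (lie_bracket_J_zero sZ sW Z0).
move: (lie_bracket Z (JF W) p) (lie_bracket Z W p) => a b.
by rewrite JJ opprK (addrAC _ b) subrr add0r subrr scaler0.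
Qed.

End AlmostKaehler.

Global Opaque nijenhuis metric.

Ltac g_lra := repeat match goal with
  |- context [metric ?o ?j ?p ?u ?v] => generalize (metric o j p u v); intro end;
  repeat match goal with |- context [vderive ?X ?f ?p] =>
    generalize (vderive X f p); intro end;
  intros; lra.

(** * The Chern connection and the covariant derivative of J *)

Section Chern.
Variables (R : realType) (m : nat) (M : manifold R m).
Variables (om : tensor2 M) (J : endo_field M).
Hypothesis om_symplectic : symplectic_form om.
Hypothesis J_compatible : compatible_acs om J.
Variable nabla : vfield M -> vfield M -> vfield M.
Hypothesis nabla_chern : chern_connection om J nabla.
Implicit Types X Y Z W : vfield M.

Local Notation JF := (endo_vfield J).
Local Notation N := (nijenhuis J).
Local Notation g := (metric om J).
Local Notation smJ := (smooth_JF J_compatible).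

Lemma smooth_nabla X Y : smooth_vfield X -> smooth_vfield Y -> smooth_vfield (nabla X Y).
Proof. by have [[h _] _ _] := nabla_chern; exact: h. Qed.

Lemma smooth_fun_cst (c : R) : smooth_fun (fun _ : M => c).
Proof. by move=> p k; exact: Ck_cst. Qed.

Lemma smooth_scale_vf (a : R) X : smooth_vfield X -> smooth_vfield (fun q => a *: X q).
Proof.
move=> sX; have := smooth_lincomb (a - 1) sX sX; congr smooth_vfield.
by apply/funext => q; rewrite /lincomb scalerBl scale1r subrK.
Qed.

Lemma nabla_lincombl a X Y Z p : smooth_vfield X -> smooth_vfield Y -> smooth_vfield Z ->
  nabla (lincomb a X Y) Z p = a *: nabla X Z p + nabla Y Z p.
Proof.
move=> sX sY sZ; have [[_ [addl [_ [scl _]]]] _ _] := nabla_chern.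
have saX := smooth_scale_vf a sX.
have := addl _ _ _ saX sY sZ p; rewrite (scl _ _ _ (smooth_fun_cst a) sX sZ p) => <-.
reflexivity.
Qed.

Lemma nabla_lincombr a X Y Z p : smooth_vfield X -> smooth_vfield Y -> smooth_vfield Z ->
  nabla Z (lincomb a X Y) p = a *: nabla Z X p + nabla Z Y p.
Proof.
move=> sX sY sZ; have [[_ [_ [addr [_ scr]]]] _ _] := nabla_chern.
have saX := smooth_scale_vf a sX.
have := addr _ _ _ sZ saX sY p.
rewrite (scr _ _ _ (smooth_fun_cst a) sZ sX p).
have -> : vderive Z (fun _ => a) p = 0.
  by rewrite vderiveE (dfb_cst (a : R^o) (chart p p)).2.
rewrite scale0r add0r => <-; reflexivity.
Qed.

Lemma nabla_oppl X Z p : smooth_vfield X -> smooth_vfield Z ->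
  nabla (opp_vf X) Z p = - nabla X Z p.
Proof.
move=> sX sZ; rewrite nabla_lincombl //; move: (nabla X Z p) => v.
by rewrite scaleNr scaler_nat mulr2n opprD subrK.
Qed.

Lemma nabla_oppr X Z p : smooth_vfield X -> smooth_vfield Z ->
  nabla Z (opp_vf X) p = - nabla Z X p.
Proof.
move=> sX sZ; rewrite nabla_lincombr //; move: (nabla Z X p) => v.
by rewrite scaleNr scaler_nat mulr2n opprD subrK.
Qed.

Lemma nabla_metric X Y Z p : smooth_vfield X -> smooth_vfield Y -> smooth_vfield Z ->
  vderive X (fun q => g q (Y q) (Z q)) p = g p (nabla X Y p) (Z p) + g p (Y p) (nabla X Z p).
Proof. by have [_ h _] := nabla_chern; move=> sX sY sZ; exact: h. Qed.

Lemma nabla_torsion X Y p : smooth_vfield X -> smooth_vfield Y ->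
  lie_bracket X Y p = nabla X Y p - nabla Y X p - N X Y p.
Proof.
have [_ _ h] := nabla_chern; move=> sX sY; rewrite -(h X Y sX sY p).
move: (nabla X Y p) (nabla Y X p) (lie_bracket X Y p) => a b c.
by rewrite opprB addrC subrK.
Qed.

Lemma nabla_torsion_g X Y p w : smooth_vfield X -> smooth_vfield Y ->
  g p (lie_bracket X Y p) w = g p (nabla X Y p) w - g p (nabla Y X p) w - g p (N X Y p) w.
Proof.
move=> sX sY; rewrite (nabla_torsion p sX sY).
move: (nabla X Y p) (nabla Y X p) (N X Y p) => a b c.
by rewrite !(gBl J om_symplectic).
Qed.

Lemma has_vderive_g X Y Z p : smooth_vfield X -> smooth_vfield Y -> smooth_vfield Z ->
  has_vderive X p (fun q => g q (Y q) (Z q))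
    (g p (nabla X Y p) (Z p) + g p (Y p) (nabla X Z p)).
Proof.
move=> sX sY sZ; split; last exact: nabla_metric.
exact: (form_of_vfields (om_is_smooth om_symplectic) p sY (smJ sZ)).1.
Qed.

(* [nabla_defect X Y Z p] is g((nabla_X J) Y, Z). *)
Definition nabla_defect X Y Z p : R :=
  g p (nabla X (JF Y) p) (Z p) + g p (nabla X Y p) (J p (Z p)).
Local Notation C := nabla_defect.

(** The identity g(JY, Z) + g(Y, JZ) = 0 is differentiated along X, the metric being parallel. *)
Lemma nabla_defect_anti X Y Z p : smooth_vfield X -> smooth_vfield Y -> smooth_vfield Z ->
  C X Y Z p = - C X Z Y p.
Proof.
move=> sX sY sZ; have sJY := smJ sY; have sJZ := smJ sZ.
have [_ ] := has_vderive_add (has_vderive_g p sX sJY sZ) (has_vderive_g p sX sY sJZ).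
have -> : (fun q => g q (JF Y q) (Z q) + g q (Y q) (JF Z q)) = (fun=> 0).
  apply/funext => q; rewrite /endo_vfield (gJ om_symplectic J_compatible).
  by rewrite addrC subrr.
rewrite vderiveE (dfb_cst (0 : R^o) (chart p p)).2 /C /endo_vfield.
rewrite (gC om_symplectic J_compatible p (J p (Y p))).
rewrite (gC om_symplectic J_compatible p (Y p)).
g_lra.
Qed.

Lemma nabla_defect_J X Y Z p : smooth_vfield X -> smooth_vfield Y ->
  C X (JF Y) Z p = C X Y (JF Z) p.
Proof.
move=> sX sY; rewrite /C (JF_JF J_compatible) (nabla_oppr p sY sX) /endo_vfield.
rewrite (JJ J_compatible) (gNl J om_symplectic) (gNr om_symplectic J_compatible).
by rewrite addrC.
Qed.

Lemma nabla_defect_opp3 X Y Z p : C X Y (opp_vf Z) p = - C X Y Z p.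
Proof.
rewrite /C opp_vfE (JN J_compatible) !(gNr om_symplectic J_compatible).
by rewrite opprD.
Qed.

Lemma nabla_defect_opp1 X Y Z p : smooth_vfield X -> smooth_vfield Y ->
  C (opp_vf X) Y Z p = - C X Y Z p.
Proof.
move=> sX sY; rewrite /C (nabla_oppl p sX sY) (nabla_oppl p sX (smJ sY)).
by rewrite !(gNl J om_symplectic) opprD.
Qed.

(** The four brackets in 4 N are expressed through nabla and the torsion N. As N is J-antilinear,
    their torsion terms add up to 4 N and cancel the left side, so that a relation for the defect
    alone remains. *)
Lemma nabla_defect_nijenhuis X Y Z p :
  smooth_vfield X -> smooth_vfield Y -> smooth_vfield Z ->
  C (JF X) Y Z p - C (JF Y) X Z p - C Y X (JF Z) p + C X Y (JF Z) p = 0.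
Proof.
move=> sX sY sZ; have sJY := smJ sY; have sJX := smJ sX.
have : g p (4%:R *: N X Y p) (Z p) = g p (lie_bracket (JF X) (JF Y) p) (Z p)
   + g p (lie_bracket (JF X) Y p) (J p (Z p)) + g p (lie_bracket X (JF Y) p) (J p (Z p))
   - g p (lie_bracket X Y p) (Z p).
  rewrite nijenhuisE; move: (lie_bracket (JF X) (JF Y) p) (lie_bracket X Y p) => a b.
  move: (lie_bracket (JF X) Y p) (lie_bracket X (JF Y) p) (Z p) => c d w.
  have n4 : (4%:R : R) != 0 by rewrite pnatr_eq0.
  rewrite scalerA (divff n4) scale1r !(gBl J om_symplectic).
  by rewrite !(gJ om_symplectic J_compatible) !opprK.
rewrite (nabla_torsion p sJX sJY) (nabla_torsion p sJX sY) (nabla_torsion p sX sJY) (nabla_torsion p sX sY).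
rewrite (nijenhuis_Jl J_compatible p sX sJY).
rewrite (nijenhuis_Jl J_compatible p sX sY).
rewrite (nijenhuis_Jr J_compatible p sX sY).
rewrite (JN J_compatible) opprK (JJ J_compatible).
rewrite (gZl J om_symplectic) !(gBl J om_symplectic) !(gNl J om_symplectic).
rewrite !(gJ om_symplectic J_compatible) !(JJ J_compatible) !(gNr om_symplectic J_compatible).
rewrite /C /endo_vfield (JJ J_compatible) !(gNr om_symplectic J_compatible).
g_lra.
Qed.

(** This is d om = 0 written with nabla: since om = g(J _, _) and g is parallel, [C X Y Z] is
    (nabla_X om)(Y, Z), and the torsion produces the right side. *)
Lemma nabla_defect_closed X Y Z p :
  smooth_vfield X -> smooth_vfield Y -> smooth_vfield Z ->
  C X Y Z p - C Y X Z p + C Z X Y p =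
  g p (N X Y p) (J p (Z p)) - g p (N X Z p) (J p (Y p)) + g p (N Y Z p) (J p (X p)).
Proof.
move=> sX sY sZ; have sJY := smJ sY; have sJX := smJ sX; have sJZ := smJ sZ.
have [_ _ _ /(_ X Y Z sX sY sZ p)] := om_symplectic.
have E A B W : smooth_vfield A -> smooth_vfield B -> smooth_vfield W ->
  vderive W (fun q => om q (A q) (B q)) p =
  g p (nabla W (JF A) p) (B p) + g p (nabla W B p) (J p (A p)).
  move=> sA sB sW; have -> : (fun q => om q (A q) (B q)) = (fun q => g q (JF A q) (B q)).
    by apply/funext => q; rewrite /endo_vfield (gJl J_compatible).
  rewrite (nabla_metric p sW (smJ sA) sB) (gC om_symplectic J_compatible p (JF A p)).
  reflexivity.
rewrite (E _ _ _ sY sZ sX) (E _ _ _ sX sZ sY) (E _ _ _ sX sY sZ).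
have og := om_g om_symplectic J_compatible p.
have := fun w => nabla_torsion_g p w sX sY.
have := fun w => nabla_torsion_g p w sX sZ.
have := fun w => nabla_torsion_g p w sY sZ.
generalize (lie_bracket X Y p) (lie_bracket X Z p) (lie_bracket Y Z p) => a b c.
generalize (N X Y p) (N X Z p) (N Y Z p) => a' b' c' Ec Eb Ea.
rewrite (og a (Z p)) (og b (Y p)) (og c (X p)) Ea Eb Ec /C.
g_lra.
Qed.

End Chern.

(* The defect g((nabla_X J) Y, Z) is skew and J-linear in (Y, Z); d om = 0 kills
   its part of type (0,1) in X relative to (Y, Z), and the Nijenhuis identity
   makes the remaining part symmetric in (X, Y), hence zero. *)
Lemma defect_eq0 (R : realType) (F : Type) (S : F -> Prop) (J opp : F -> F)
    (C n : F -> F -> F -> R) :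
  (forall X, S X -> S (J X)) -> (forall X, J (J X) = opp X) ->
  (forall X Y Z, S X -> S Y -> S Z -> C X Y Z = - C X Z Y) ->
  (forall X Y Z, S X -> S Y -> C X (J Y) Z = C X Y (J Z)) ->
  (forall X Y Z, C X Y (opp Z) = - C X Y Z) ->
  (forall X Y Z, S X -> S Y -> C (opp X) Y Z = - C X Y Z) ->
  (forall X Y Z, S X -> S Y -> S Z ->
    C (J X) Y Z - C (J Y) X Z - C Y X (J Z) + C X Y (J Z) = 0) ->
  (forall X Y Z, S X -> S Y -> S Z -> C X Y Z - C Y X Z + C Z X Y = n X Y Z) ->
  (forall X Y Z, S X -> S Y -> S Z -> n (J X) (J Y) Z = - n X Y Z) ->
  forall X Y Z, S X -> S Y -> S Z -> C X Y Z = 0.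
Proof.
move=> SJ JJ anti lin opp3 opp1 nij clos nJ.
have D X Y Z : S X -> S Y -> S Z ->
    C X Y Z + C (J X) (J Y) Z + (C Y Z X + C (J Y) (J Z) X) = 0.
  move=> sX sY sZ; have sJX := SJ _ sX; have sJY := SJ _ sY.
  have := clos _ _ _ sX sY sZ; have := clos _ _ _ sJX sJY sZ.
  rewrite (nJ _ _ _ sX sY sZ) (lin _ _ (J Y) sZ sX) JJ opp3.
  rewrite (anti _ _ _ sY sX sZ) (anti _ _ _ sJY sJX sZ) (lin (J Y) Z X sJY sZ).
  lra.
have D0 X Y Z : S X -> S Y -> S Z -> C (J X) (J Y) Z = - C X Y Z.
  move=> sX sY sZ.
  have := D _ _ _ sX sY sZ; have := D _ _ _ sY sZ sX; have := D _ _ _ sZ sX sY.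
  lra.
have D1 X Y Z : S X -> S Y -> S Z -> C (J X) Y Z = C X (J Y) Z.
  move=> sX sY sZ; have sJX := SJ _ sX; have sJY := SJ _ sY.
  have := D0 _ _ _ sJX sY sZ; rewrite JJ (opp1 _ _ _ sX sJY); lra.
have sym1 X Y Z : S X -> S Y -> S Z -> C X (J Y) Z = C Y (J X) Z.
  move=> sX sY sZ; have := nij _ _ _ sX sY sZ.
  rewrite (D1 _ _ _ sX sY sZ) (D1 _ _ _ sY sX sZ).
  rewrite -(lin _ _ Z sY sX) -(lin _ _ Z sX sY); lra.
have sym X Y Z : S X -> S Y -> S Z -> C X Y Z = C Y X Z.
  move=> sX sY sZ; have sJX := SJ _ sX; have sJY := SJ _ sY.
  have := sym1 _ _ _ sJX sY sZ; rewrite (D0 _ _ _ sX sY sZ) JJ.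
  have -> : C Y (opp X) Z = - C Y X Z.
    rewrite -JJ (lin _ _ _ sY sJX) (lin _ _ _ sY sX) JJ opp3; reflexivity.
  by move/oppr_inj.
move=> X Y Z sX sY sZ.
have := sym _ _ _ sX sY sZ; have := anti _ _ _ sY sX sZ; have := sym _ _ _ sY sZ sX.
have := anti _ _ _ sZ sY sX; have := sym _ _ _ sZ sX sY; have := anti _ _ _ sX sZ sY.
lra.
Qed.

(** * Metric connections with torsion and Killing fields *)

Section MetricTorsion.
Variables (R : realType) (T : Type) (V : lmodType R).
Local Notation F := (T -> V).
Variables (S : F -> Prop) (br nab N : F -> F -> F) (g : T -> V -> V -> R).
Variable hv : F -> T -> (T -> R) -> R -> Prop.
Definition lc (a : R) (X Y : F) : F := fun q => a *: X q + Y q.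

Hypothesis hv_fun : forall X p f a b, hv X p f a -> hv X p f b -> a = b.
Hypothesis hvD : forall X p f h a b, hv X p f a -> hv X p h b ->
  hv X p (fun q => f q + h q) (a + b).
Hypothesis hvB : forall X p f h a b, hv X p f a -> hv X p h b ->
  hv X p (fun q => f q - h q) (a - b).
Hypothesis hv0 : forall X p f a, X p = 0 -> hv X p f a -> a = 0.
Hypothesis S_br : forall X Y, S X -> S Y -> S (br X Y).
Hypothesis S_nab : forall X Y, S X -> S Y -> S (nab X Y).
Hypothesis S_N : forall X Y, S X -> S Y -> S (N X Y).
Hypothesis S_lc : forall a X Y, S X -> S Y -> S (lc a X Y).
Hypothesis gC : forall p u v, g p u v = g p v u.
Hypothesis gDl : forall p u v w, g p (u + v) w = g p u w + g p v w.
Hypothesis gZl : forall p a u w, g p (a *: u) w = a * g p u w.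
Hypothesis brC : forall X Y p, br X Y p = - br Y X p.
Hypothesis NC : forall X Y p, N X Y p = - N Y X p.
Hypothesis br_lc : forall a X Y Z p, S X -> S Y -> S Z ->
  br Z (lc a X Y) p = a *: br Z X p + br Z Y p.
Hypothesis nab_lc : forall a X Y Z p, S X -> S Y -> S Z ->
  nab Z (lc a X Y) p = a *: nab Z X p + nab Z Y p.
Hypothesis nab_metric : forall X Y Z p, S X -> S Y -> S Z ->
  hv X p (fun q => g q (Y q) (Z q)) (g p (nab X Y p) (Z p) + g p (Y p) (nab X Z p)).
Hypothesis torsion : forall X Y p, S X -> S Y ->
  br X Y p = nab X Y p - nab Y X p - N X Y p.
Hypothesis hv_zero : forall X Z W p, S Z -> S W -> Z p = 0 ->
  hv X p (fun q => g q (Z q) (W q)) (g p (br X Z p) (W p)).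
Hypothesis N_zero : forall Z W p, S Z -> S W -> Z p = 0 -> N Z W p = 0.

Lemma g_opp p u w : g p (- u) w = - g p u w.
Proof. by rewrite -scaleN1r gZl mulN1r. Qed.

Lemma g_sub p u v w : g p (u - v) w = g p u w - g p v w.
Proof. by rewrite gDl g_opp. Qed.

Lemma g_0 p w : g p 0 w = 0.
Proof. by rewrite -(scale0r 0) gZl mul0r. Qed.

(** The Koszul formula for a metric connection with torsion N, left doubled. The three derivatives
    are parameters, so that each use supplies the value available there: from the metric, from a
    zero of a field, or from invariance. *)
Lemma koszul X Y Z p a b c : S X -> S Y -> S Z ->
  hv X p (fun q => g q (Y q) (Z q)) a -> hv Y p (fun q => g q (X q) (Z q)) b ->
  hv Z p (fun q => g q (X q) (Y q)) c ->
  g p (nab X Y p) (Z p) + g p (nab X Y p) (Z p) = a + b - c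
    + g p (br X Y p) (Z p) - g p (br X Z p) (Y p) - g p (br Y Z p) (X p)
    + g p (N X Y p) (Z p) - g p (N X Z p) (Y p) - g p (N Y Z p) (X p).
Proof.
move=> sX sY sZ ha hb hc.
rewrite (hv_fun ha (nab_metric p sX sY sZ)) (hv_fun hb (nab_metric p sY sX sZ)).
rewrite (hv_fun hc (nab_metric p sZ sX sY)).
rewrite (torsion p sX sY) (torsion p sX sZ) (torsion p sY sZ) !g_sub.
rewrite (gC p (Y p)) (gC p (X p) (nab Y Z p)) (gC p (X p) (nab Z Y p)).
lra.
Qed.

Variables (A : Type) (fld : A -> F) (w : A -> A -> A).
Hypothesis S_fld : forall X, S (fld X).
Hypothesis br_fld : forall X Y, br (fld X) (fld Y) = fld (w X Y).
Hypothesis killing : forall W Y Z p, S Y -> S Z ->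
  hv (fld W) p (fun q => g q (Y q) (Z q))
    (g p (br (fld W) Y p) (Z p) + g p (Y p) (br (fld W) Z p)).
Hypothesis jacobi : forall X Y Z p, S X -> S Y -> S Z ->
  br X (br Y Z) p = br (br X Y) Z p + br Y (br X Z) p.
Hypothesis br_N : forall W Y Z p, S Y -> S Z ->
  br (fld W) (N Y Z) p = N (br (fld W) Y) Z p + N Y (br (fld W) Z) p.
Variable p : T.
Hypothesis nondeg : forall u v, (forall X, g p u (fld X p) = g p v (fld X p)) -> u = v.

(** At a zero of X the brackets with X in the Koszul formula cancel against the derivatives, and
    every other term vanishes. This replaces the usual argument from linearity over functions, which
    calls for cut-offs. *)
Lemma nab_zero X Y : S X -> S Y -> X p = 0 -> nab X Y p = 0.
Proof.
move=> sX sY X0; apply: nondeg => U; have sU := S_fld U.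
have h1 := nab_metric p sX sY sU.
have := koszul sX sY sU h1 (hv_zero Y sX sU X0) (hv_zero (fld U) sX sY X0).
rewrite (hv0 X0 h1) X0 (N_zero sX sY X0) (N_zero sX sU X0) !g_0.
rewrite !(gC p _ 0) !g_0 (brC Y X) (brC (fld U) X) !g_opp; lra.
Qed.

(** On induced fields the derivatives of g are themselves brackets, so nabla is given by g, brackets
    and N alone. Such an expression can be differentiated once more along an induced field, which
    [nab_affine] does. *)
Lemma koszul_killing Y Z U q :
  g q (nab (fld Y) (fld Z) q) (fld U q) + g q (nab (fld Y) (fld Z) q) (fld U q) =
  g q (br (fld Y) (fld Z) q) (fld U q) + g q (br (fld Y) (fld U) q) (fld Z q)
  + g q (br (fld Z) (fld U) q) (fld Y q) + g q (N (fld Y) (fld Z) q) (fld U q)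
  - g q (N (fld Y) (fld U) q) (fld Z q) - g q (N (fld Z) (fld U) q) (fld Y q).
Proof.
have sY := S_fld Y; have sZ := S_fld Z; have sU := S_fld U.
have := koszul sY sZ sU (killing Y q sZ sU) (killing Z q sY sU) (killing U q sY sZ).
rewrite (brC (fld Z) (fld Y)) (brC (fld U) (fld Y)) (brC (fld U) (fld Z)) !g_opp.
rewrite !(gC q (fld _ q)) !g_opp; lra.
Qed.

(** Both sides of [koszul_killing] are differentiated along W'. Every term obeys a Leibniz rule, by
    the invariance of g, the Jacobi identity and the invariance of N; subtracting the Koszul
    formulas in which one of Y, Z, U is replaced by its bracket with W leaves the claim tested
    against U'. *)
Lemma nab_affine W Y Z :
  br (fld W) (nab (fld Y) (fld Z)) p =
  nab (br (fld W) (fld Y)) (fld Z) p + nab (fld Y) (br (fld W) (fld Z)) p.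
Proof.
apply: nondeg => U.
have sY := S_fld Y; have sZ := S_fld Z; have sU := S_fld U; have sW := S_fld W.
have sYZ := S_br sY sZ; have sYU := S_br sY sU; have sZU := S_br sZ sU.
have nYZ := S_N sY sZ; have nYU := S_N sY sU; have nZU := S_N sZ sU.
have sn := S_nab sY sZ.
have h1 := hvD (killing W p sn sU) (killing W p sn sU).
have h2 := hvB (hvB (hvD (hvD (hvD (killing W p sYZ sU) (killing W p sYU sZ))
  (killing W p sZU sY)) (killing W p nYZ sU)) (killing W p nYU sZ)) (killing W p nZU sY).
have E := funext (koszul_killing Y Z U).
rewrite E in h1; have := hv_fun h1 h2.
rewrite !(jacobi p sW) // !br_N // !gDl.
have := koszul_killing (w W Y) Z U p; have := koszul_killing Y (w W Z) U p.
have := koszul_killing Y Z (w W U) p.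
rewrite -!br_fld; lra.
Qed.

(** Up to sign, Kostant's operator of a Killing field. *)
Definition conn_minus_lie (X : A) (Z : F) : F := fun q => nab (fld X) Z q - br (fld X) Z q.
Local Notation D := conn_minus_lie.

Lemma S_conn_minus_lie X Z : S Z -> S (D X Z).
Proof.
move=> sZ; have := S_lc (-1) (S_br (S_fld X) sZ) (S_nab (S_fld X) sZ).
by congr S; apply/funext => q; rewrite /lc scaleN1r addrC.
Qed.

(** By the torsion identity Z is no longer differentiated: it remains as the direction of a
    derivative and as an argument of N, and both see only its value at the point. *)
Lemma conn_minus_lieE X Z q : S Z -> D X Z q = nab Z (fld X) q + N (fld X) Z q.
Proof.
by move=> sZ; rewrite /D (torsion q (S_fld X) sZ) opprB addrC -addrA addrC opprB subrK addrC.
Qed.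

Lemma conn_minus_lie_lc a X Y Z q : S Y -> S Z ->
  D X (lc a Y Z) q = a *: D X Y q + D X Z q.
Proof.
move=> sY sZ; rewrite /D (nab_lc a q sY sZ (S_fld X)) (br_lc a q sY sZ (S_fld X)).
by rewrite scalerBr opprD addrACA.
Qed.

Lemma conn_minus_lie_zero X Z : S Z -> Z p = 0 -> D X Z p = 0.
Proof.
move=> sZ Z0; rewrite conn_minus_lieE // (nab_zero sZ (S_fld X) Z0).
by rewrite NC (N_zero sZ (S_fld X) Z0) oppr0 addr0.
Qed.

Lemma conn_minus_lie_fld X Y : D X (fld Y) p - D Y (fld X) p =
  N (fld X) (fld Y) p - br (fld X) (fld Y) p.
Proof.
rewrite (conn_minus_lieE X _ (S_fld Y)) /D (brC (fld X)) opprK.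
by rewrite opprB addrC addrA subrK addrC.
Qed.

Lemma conn_minus_lie_skew X Y Z q : S Y -> S Z ->
  g q (D X Y q) (Z q) = - g q (Y q) (D X Z q).
Proof.
move=> sY sZ; have sX := S_fld X.
have := hv_fun (nab_metric q sX sY sZ) (killing X q sY sZ).
rewrite /D !(gC q (Y q)) !g_sub; lra.
Qed.

(** The rules [L_X', nabla_Y'] = nabla_[X', Y'] and [L_X', L_Y'] = L_[X', Y'] turn [D_X, D_Y] into
    R(X', Y') minus the operator D of the field [X', Y']; hence the exchanged arguments of [w]. *)
Lemma curvature_killing X Y Z :
  nab (fld X) (nab (fld Y) (fld Z)) p - nab (fld Y) (nab (fld X) (fld Z)) p
    - nab (br (fld X) (fld Y)) (fld Z) p =
  D X (D Y (fld Z)) p - D Y (D X (fld Z)) p - D (w Y X) (fld Z) p.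
Proof.
have sX := S_fld X; have sY := S_fld Y; have sZ := S_fld Z.
have sYZ := S_br sY sZ; have sXZ := S_br sX sZ.
have nXZ := S_nab sX sZ; have nYZ := S_nab sY sZ.
have DXZ : D X (fld Z) = lc (-1) (br (fld X) (fld Z)) (nab (fld X) (fld Z)).
  by apply/funext => q; rewrite /D /lc scaleN1r addrC.
have DYZ : D Y (fld Z) = lc (-1) (br (fld Y) (fld Z)) (nab (fld Y) (fld Z)).
  by apply/funext => q; rewrite /D /lc scaleN1r addrC.
rewrite DXZ DYZ /D !nab_lc // !br_lc // -!br_fld.
rewrite !nab_affine; apply: nondeg => U.
have := congr1 (fun v => g p v (fld U p)) (jacobi p sY sX sZ).
rewrite !(gDl, g_opp, gZl); lra.
Qed.

End MetricTorsion.

(** * Traces and wedge powers *)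

Lemma mul_lin1 (R : realType) m k (f : 'rV[R]_m -> 'rV[R]_k) v :
  linear f -> v *m lin1_mx f = f v.
Proof.
move=> lf; pose fM := GRing.isLinear.Build _ _ _ _ _ lf.
pose fL : {linear 'rV[R]_m -> 'rV[R]_k} := HB.pack f fM.
exact: (mul_rV_lin1 fL).
Qed.

Lemma lin1_mx_comp (R : realType) m k l (f : 'rV[R]_m -> 'rV[R]_k) (h : 'rV[R]_k -> 'rV[R]_l) :
  linear h -> lin1_mx (fun v => h (f v)) = lin1_mx f *m lin1_mx h.
Proof.
move=> lh; apply/row_matrixP => i; rewrite row_mul.
have -> : row i (lin1_mx f) = f (delta_mx 0 i).
  by apply/rowP => j; rewrite !mxE.
by rewrite mul_lin1 //; apply/rowP => j; rewrite !mxE.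
Qed.

Lemma traceC (R : realType) m k (f : 'rV[R]_m -> 'rV[R]_k) (h : 'rV[R]_k -> 'rV[R]_m) :
  linear f -> linear h -> trace (fun v => h (f v)) = trace (fun v => f (h v)).
Proof.
by move=> lf lh; rewrite /trace (lin1_mx_comp f lh) (lin1_mx_comp h lf) mxtrace_mulC.
Qed.

Lemma trace_eq (R : realType) m (f h : 'rV[R]_m -> 'rV[R]_m) :
  (forall v, f v = h v) -> trace f = trace h.
Proof. by move=> E; congr trace; apply/funext. Qed.

Lemma traceD (R : realType) m (f h : 'rV[R]_m -> 'rV[R]_m) :
  trace (fun v => f v + h v) = trace f + trace h.
Proof. by rewrite /trace -linearD; congr (\tr _); apply/matrixP => i j; rewrite !mxE. Qed.

Lemma traceN (R : realType) m (f : 'rV[R]_m -> 'rV[R]_m) :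
  trace (fun v => - f v) = - trace f.
Proof. by rewrite /trace -linearN; congr (\tr _); apply/matrixP => i j; rewrite !mxE. Qed.

Lemma trace_sum (R : realType) m k (f : 'I_k -> 'rV[R]_m -> 'rV[R]_m) :
  trace (fun v => \sum_i f i v) = \sum_i trace (f i).
Proof.
rewrite /trace -raddf_sum; congr (\tr _); apply/matrixP => i j.
rewrite !mxE summxE summxE; apply: eq_bigr => l _; by rewrite mxE.
Qed.

Lemma traceB (R : realType) m (f h : 'rV[R]_m -> 'rV[R]_m) :
  trace (fun v => f v - h v) = trace f - trace h.
Proof. by rewrite traceD traceN. Qed.

Lemma linear_opp (R : realType) (V W : lmodType R) (f : V -> W) v :
  linear f -> f (- v) = - f v.
Proof.
move=> lf; pose fM := GRing.isLinear.Build _ _ _ _ _ lf.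
pose fL : {linear V -> W} := HB.pack f fM.
exact: (linearN fL).
Qed.

(** The trace of J f J is computed twice: by cyclicity with J^2 = -1, and by moving f past J. *)
Lemma trace_anticommute (R : realType) m (J f : 'rV[R]_m -> 'rV[R]_m) :
  linear J -> linear f -> (forall v, J (J v) = - v) -> (forall v, f (J v) = - J (f v)) ->
  trace f = 0.
Proof.
move=> lJ lf JJ fJ.
have lJf : linear (fun v => J (f v)) by move=> a u v; rewrite lf lJ.
have E1 : trace (fun v => J (f (J v))) = - trace f.
  rewrite (traceC lJ lJf) -traceN.
  by apply: trace_eq => v; rewrite JJ.
have E2 : trace (fun v => J (f (J v))) = trace f.
  by apply: trace_eq => v; rewrite fJ (linear_opp _ lJ) JJ opprK.
lra.
Qed.

(** * Symplectic frames and traces *)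

Section SymplecticFrame.
Variables (R : realType) (n : nat).
Local Notation V := 'rV[R]_(n + n).
Variable om : V -> V -> R.
Hypothesis omC : forall u v, om u v = - om v u.
Hypothesis omD : forall u v w, om (u + v) w = om u w + om v w.
Hypothesis omZ : forall a u w, om (a *: u) w = a * om u w.
Variables E F : 'I_n -> V.
Hypothesis omEE : forall i j, om (E i) (E j) = 0.
Hypothesis omFF : forall i j, om (F i) (F j) = 0.
Hypothesis omEF : forall i j, om (E i) (F j) = (i == j)%:R.

Lemma om_opp u w : om (- u) w = - om u w.
Proof. by rewrite -scaleN1r omZ mulN1r. Qed.

Lemma om_sum k (u : 'I_k -> V) w : om (\sum_i u i) w = \sum_i om (u i) w.
Proof.
elim: k u => [|k IH] u; last by rewrite !big_ord_recl omD IH.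
by rewrite !big_ord0 -(scale0r 0) omZ mul0r.
Qed.

Lemma om_addr u v w : om w (u + v) = om w u + om w v.
Proof. by rewrite omC omD opprD -!omC. Qed.

Lemma om_scaler a u w : om w (a *: u) = a * om w u.
Proof. by rewrite omC omZ -mulrN -omC. Qed.

Lemma om_sumr k (u : 'I_k -> V) w : om w (\sum_i u i) = \sum_i om w (u i).
Proof. by rewrite omC om_sum -sumrN; apply: eq_bigr => i _; rewrite -omC. Qed.

Definition frame_mx : 'M[R]_(n + n) := \matrix_(k, l)
  match fintype.split k with inl i => E i 0 l | inr i => F i 0 l end.

(** The columns are the dual basis given by om: [om _ (F i)] is the coordinate along [E i], and
    [om (E i) _] the one along [F i]. *)
Definition coframe_mx : 'M[R]_(n + n) := \matrix_(k, l)
  match fintype.split l with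
  | inl i => om (delta_mx 0 k) (F i) | inr i => om (E i) (delta_mx 0 k) end.

Lemma row_frame_l i : row (lshift n i) frame_mx = E i.
Proof. by apply/rowP => l; rewrite !mxE (unsplitK (inl i)). Qed.

Lemma row_frame_r i : row (rshift n i) frame_mx = F i.
Proof. by apply/rowP => l; rewrite !mxE (unsplitK (inr i)). Qed.

Lemma coframe_l v i : (v *m coframe_mx) 0 (lshift n i) = om v (F i).
Proof.
rewrite mxE {2}(row_sum_delta v) om_sum; apply: eq_bigr => k _.
by rewrite mxE (unsplitK (inl i)) omZ.
Qed.

Lemma coframe_r v i : (v *m coframe_mx) 0 (rshift n i) = om (E i) v.
Proof.
rewrite mxE {2}(row_sum_delta v) om_sumr; apply: eq_bigr => k _.
by rewrite mxE (unsplitK (inr i)) om_scaler.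
Qed.

Lemma frame_coframe : frame_mx *m coframe_mx = 1%:M.
Proof.
apply/row_matrixP => k; rewrite row_mul row1; apply/rowP => l.
rewrite -(splitK k) -(splitK l).
case: (fintype.split k) => i; case: (fintype.split l) => j; rewrite /= ?row_frame_l ?row_frame_r
  ?coframe_l ?coframe_r mxE eqxx /=.
- by rewrite omEF eq_lshift eq_sym.
- by rewrite omEE eq_rlshift.
- by rewrite omFF eq_lrshift.
- by rewrite omEF eq_rshift.
Qed.

(** [frame_coframe] is a one-sided inverse of a square matrix, hence two-sided: the symplectic
    relations together with the count of vectors give a basis. *)
Lemma frame_expansion v : v = \sum_i (om v (F i) *: E i + om (E i) v *: F i).
Proof.
rewrite -[LHS]mulmx1 -(mulmx1C frame_coframe) mulmxA.
rewrite mulmx_sum_row big_split_ord big_split /=; congr (_ + _).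
  by apply: eq_bigr => i _; rewrite coframe_l row_frame_l.
by apply: eq_bigr => i _; rewrite coframe_r row_frame_r.
Qed.

Lemma trace_frame (f : V -> V) : linear f ->
  trace f = \sum_i (om (f (E i)) (F i) + om (E i) (f (F i))).
Proof.
move=> lf; have ent k l : (frame_mx *m lin1_mx f *m coframe_mx) k l =
    (f (row k frame_mx) *m coframe_mx) 0 l.
  by rewrite -(mul_lin1 _ lf) -!row_mul [RHS]mxE.
rewrite /trace -[lin1_mx f]mul1mx -(mulmx1C frame_coframe) -mulmxA.
rewrite mxtrace_mulC /mxtrace big_split_ord big_split /=; congr (_ + _); apply: eq_bigr => i _.
  by rewrite ent row_frame_l coframe_l.
by rewrite ent row_frame_r coframe_r.
Qed.

Lemma frame_ext u v : (forall i, om u (E i) = om v (E i)) ->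
  (forall i, om u (F i) = om v (F i)) -> u = v.
Proof.
move=> hE hF; rewrite (frame_expansion u) (frame_expansion v).
by apply: eq_bigr => i _; rewrite hF (omC (E i) u) hE -omC.
Qed.

Variable J : V -> V.
Hypothesis J_linear : linear J.
Hypothesis JJ : forall v, J (J v) = - v.
Hypothesis omJJ : forall u v, om (J u) (J v) = om u v.

Lemma om_Jl u v : om (J u) v = - om u (J v).
Proof. by rewrite -omJJ JJ om_opp. Qed.

(* b = om (B _, _) with B anticommuting with J, and the trace of B is twice the
   contraction of b. *)
Lemma contraction_J_anti (b : V -> V -> R) :
  (forall a u v w, b (a *: u + v) w = a * b u w + b v w) ->
  (forall u v, b u v = - b v u) -> (forall u v, b (J u) v = b u (J v)) ->
  \sum_i b (E i) (F i) = 0.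
Proof.
move=> bl bC bJ.
pose B u := \sum_i (b u (F i) *: E i - b u (E i) *: F i).
have lB : linear B.
  move=> a u v; rewrite /B scaler_sumr -big_split; apply: eq_bigr => i _ /=.
  by rewrite !bl !scalerDl scalerBr !scalerA opprD addrACA.
have br a u v w : b w (a *: u + v) = a * b w u + b w v.
  by rewrite bC bl opprD -mulrN -!bC.
have b_sumr k w (u : 'I_k -> V) : b w (\sum_i u i) = \sum_i b w (u i).
  elim: k u => [|k IH] u; last by rewrite !big_ord_recl -[u ord0]scale1r br mul1r IH scale1r.
  by rewrite !big_ord0; have := br 1 0 0 w; rewrite scale1r addr0 mul1r; lra.
have omB u v : om (B u) v = b u v.
  rewrite {2}(frame_expansion v) b_sumr /B om_sum; apply: eq_bigr => i _.
  rewrite br omD om_opp !omZ.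
  have b0 : b u 0 = 0 by have := br 1 0 0 u; rewrite scale1r addr0 mul1r; lra.
  have -> : b u (om (E i) v *: F i) = om (E i) v * b u (F i).
    by rewrite -[om (E i) v *: F i]addr0 br b0 addr0.
  rewrite (omC (F i) v); ring.
have BJ u : B (J u) = - J (B u).
  apply: frame_ext => i; rewrite om_opp om_Jl opprK !omB bJ; reflexivity.
have := trace_anticommute J_linear lB JJ BJ.
rewrite (trace_frame lB) => t0.
have : \sum_i (b (E i) (F i) + b (E i) (F i)) = 0.
  rewrite -[RHS]t0; apply: eq_bigr => i _.
  by rewrite omB (omC (E i)) omB (bC (F i)) opprK.
rewrite big_split /=; lra.
Qed.

(* [D X] stands for nabla_X' - L_X' and [N] for the Nijenhuis tensor at a point. *)
Variables (L : lmodType R) (ev : L -> V) (ad : L -> L -> L) (e f : 'I_n -> L).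
Variables (D : L -> V -> V) (N : V -> V -> V).
Hypothesis ev_e : forall i, ev (e i) = E i.
Hypothesis ev_f : forall i, ev (f i) = F i.
Hypothesis ev_linear : linear ev.
Hypothesis D_linear : forall X, linear (D X).
Hypothesis D_linear1 : forall v, linear (D ^~ v).
Hypothesis DJ : forall X v, D X (J v) = J (D X v).
Hypothesis D_skew : forall X u v, om (D X u) v = - om u (D X v).
Hypothesis N_linear : forall u, linear (N u).
Hypothesis NC : forall u v, N u v = - N v u.
Hypothesis NJ : forall u v, N u (J v) = - J (N u v).
Hypothesis D_torsion : forall X Y, D X (ev Y) - D Y (ev X) = N (ev X) (ev Y) + ev (ad X Y).
Local Notation xi := (\sum_i ad (e i) (f i)).

(** The torsion identity is used twice. It replaces D_Z E_i by D_(e_i) applied to Z'; as J D is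
    symmetric for om, this operator moves to the other argument, and the difference D_(e_i) F_i -
    D_(f_i) E_i that appears yields [e_i, f_i] by the same identity. *)
Lemma trace_JD Z : trace (fun v => J (D Z v)) = om (ev Z) (J (ev xi)) +
  \sum_i (om (J (ev (ad Z (e i)))) (F i) + om (E i) (J (ev (ad Z (f i))))).
Proof.
have lJD : linear (fun v => J (D Z v)) by move=> a u v; rewrite D_linear J_linear.
have lJN : linear (fun v => J (N (ev Z) v)) by move=> a u v; rewrite N_linear J_linear.
have JDsym X u v : om (J (D X u)) v = om u (J (D X v)).
  by rewrite om_Jl D_skew opprK DJ.
have Dexp X Y : D X (ev Y) = D Y (ev X) + N (ev X) (ev Y) + ev (ad X Y).
  by rewrite -addrA -D_torsion addrC subrK.
have tN : trace (fun v => J (N (ev Z) v)) = 0.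
  apply: (trace_anticommute J_linear lJN JJ) => v.
  by rewrite NJ (linear_opp _ J_linear).
have JD3 u v w : J (u + v + w) = J u + J v + J w.
  by rewrite -[u + v]scale1r J_linear -[u]scale1r J_linear !scale1r.
rewrite (trace_frame lJD).
have E1 i : om (J (D Z (E i))) (F i) + om (E i) (J (D Z (F i))) =
   om (ev Z) (J (D (e i) (F i))) - om (ev Z) (J (D (f i) (E i)))
   + (om (J (N (ev Z) (E i))) (F i) + om (E i) (J (N (ev Z) (F i))))
   + (om (J (ev (ad Z (e i)))) (F i) + om (E i) (J (ev (ad Z (f i))))).
  rewrite -(ev_e i) -(ev_f i) (Dexp Z (e i)) (Dexp Z (f i)) !JD3 !omD !om_addr.
  rewrite (JDsym (e i)) (omC _ (J (D (f i) _))) (JDsym (f i)); lra.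
rewrite (eq_bigr _ (fun i _ => E1 i)) !big_split /=; congr (_ + _).
move: tN; rewrite (trace_frame lJN) big_split /= => ->; rewrite addr0.
have xiE : J (ev xi) = \sum_i J (ev (ad (e i) (f i))).
  have lJev : linear (fun X => J (ev X)) by move=> a u v; rewrite ev_linear J_linear.
  pose fM := GRing.isLinear.Build _ _ _ _ _ lJev.
  pose fL : {linear L -> V} := HB.pack (fun X => J (ev X)) fM.
  exact: (linear_sum fL).
rewrite xiE om_sumr sumrN -sumrB.
have JB u v : J (u - v) = J u - J v.
  by rewrite addrC -[- v]scaleN1r J_linear scaleN1r addrC.
have JA u v : J (u + v) = J u + J v by rewrite -[u in LHS]scale1r J_linear scale1r.
have E2 i : om (ev Z) (J (D (e i) (F i))) - om (ev Z) (J (D (f i) (E i))) =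
  om (ev Z) (J (N (E i) (F i))) + om (ev Z) (J (ev (ad (e i) (f i)))).
  have := congr1 (fun v => om (ev Z) (J v)) (D_torsion (e i) (f i)).
  rewrite /= JB JA om_addr om_addr -[- J _]scaleN1r om_scaler mulN1r !ev_e !ev_f.
  by [].
rewrite (eq_bigr _ (fun i _ => E2 i)) big_split /=.
(* The form om(Z', J N(u, v)) is skew, and J passes from one of its arguments to the other, since N
   is antilinear in both. *)
rewrite (@contraction_J_anti (fun u v => om (ev Z) (J (N u v)))) ?add0r //.
- move=> a u v w; rewrite NC N_linear.
  have -> : - (a *: N w u + N w v) = a *: N u w + N v w.
    by rewrite (NC w) (NC w v) scalerN -opprD opprK.
  by rewrite J_linear om_addr om_scaler.
- move=> u v; rewrite NC (linear_opp _ J_linear) -[- J _]scaleN1r om_scaler mulN1r; reflexivity.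
- move=> u v; rewrite (NC (J u)) !NJ opprK (NC u v) !(linear_opp _ J_linear) opprK.
  reflexivity.
Qed.

Lemma sum_trace_J_curvature :
  \sum_i trace (fun v => J (D (e i) (D (f i) v) - D (f i) (D (e i) v) - D (ad (e i) (f i)) v)) =
  - om (ev xi) (J (ev xi)) -
  \sum_i (om (J (ev (ad xi (e i)))) (F i) + om (E i) (J (ev (ad xi (f i))))).
Proof.
have JB u v : J (u - v) = J u - J v.
  by rewrite addrC -[- v]scaleN1r J_linear scaleN1r addrC.
have E1 i : trace (fun v => J (D (e i) (D (f i) v) - D (f i) (D (e i) v) - D (ad (e i) (f i)) v))
   = - trace (fun v => J (D (ad (e i) (f i)) v)).
  transitivity (trace (fun v => J (D (e i) (D (f i) v)) - J (D (f i) (D (e i) v))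
     - J (D (ad (e i) (f i)) v))).
    by apply: trace_eq => v; rewrite !JB.
  rewrite !traceB.
  have lJD : linear (fun v => J (D (e i) v)) by move=> a u v; rewrite D_linear J_linear.
  rewrite (traceC (D_linear (f i)) lJD).
  have -> : trace (fun v => D (f i) (J (D (e i) v))) = trace (fun v => J (D (f i) (D (e i) v))).
    by apply: trace_eq => v; rewrite DJ.
  by rewrite subrr sub0r.
rewrite (eq_bigr _ (fun i _ => E1 i)) sumrN.
rewrite -opprD; congr (- _); rewrite -trace_JD.
have -> : trace (fun v => J (D xi v)) = trace (fun v => \sum_i J (D (ad (e i) (f i)) v)).
  apply: trace_eq => v.
  have lJD : linear (fun X => J (D X v)) by move=> a X Y; rewrite D_linear1 J_linear.
  pose fM := GRing.isLinear.Build _ _ _ _ _ lJD.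
  pose fL : {linear L -> V} := HB.pack (fun X => J (D X v)) fM.
  exact: (linear_sum fL).
rewrite trace_sum; reflexivity.
Qed.

End SymplecticFrame.

(* Only the block of h on the complement mm of ker ev contributes to its trace. *)
Lemma trace_reductive (R : realType) (n d : nat) (om : 'rV[R]_(n + n) -> 'rV[R]_(n + n) -> R)
    (ev : 'rV[R]_d -> 'rV[R]_(n + n)) (e f : 'I_n -> 'rV[R]_d) (mm : {vspace 'rV[R]_d})
    (h : 'rV[R]_d -> 'rV[R]_d) :
  (forall u v, om u v = - om v u) ->
  (forall u v w, om (u + v) w = om u w + om v w) ->
  (forall a u w, om (a *: u) w = a * om u w) ->
  (forall i j, om (ev (e i)) (ev (e j)) = 0) ->
  (forall i j, om (ev (f i)) (ev (f j)) = 0) ->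
  (forall i j, om (ev (e i)) (ev (f j)) = (i == j)%:R) ->
  linear ev -> linear h ->
  (forall i, e i \in mm) -> (forall i, f i \in mm) ->
  (forall X, X \in mm -> ev X = 0 -> X = 0) ->
  (forall X, ev X = 0 -> h X \in mm) ->
  trace h = \sum_i (om (ev (h (e i))) (ev (f i)) + om (ev (e i)) (ev (h (f i)))).
Proof.
move=> omC omD omZ omee omff omef lev lh em fm inj hm.
pose lift v := \sum_i (om v (ev (f i)) *: e i + om (ev (e i)) v *: f i).
have llift : linear lift.
  move=> a u v; rewrite /lift scaler_sumr -big_split; apply: eq_bigr => i _ /=.
  rewrite omD omZ (om_addr omC omD) (om_scaler omC omZ) !scalerDl scalerDr !scalerA.
  by rewrite addrACA.
have liftm v : lift v \in mm.
  by apply: memv_suml => i _; rewrite memvD // memvZ.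
have evD X Y : ev (X + Y) = ev X + ev Y by rewrite -[X in LHS]scale1r lev scale1r.
have ev0 : ev 0 = 0 by apply: (addrI (ev 0)); rewrite -evD !addr0.
have evZ a X : ev (a *: X) = a *: ev X by rewrite -[a *: X]addr0 lev ev0 addr0.
have evB X Y : ev (X - Y) = ev X - ev Y by rewrite evD -scaleN1r evZ scaleN1r.
have evlift v : ev (lift v) = v.
  rewrite [RHS](frame_expansion omC omD omZ omee omff omef) /lift.
  pose fM := GRing.isLinear.Build _ _ _ _ _ lev.
  pose fL : {linear 'rV[R]_d -> 'rV[R]_(n + n)} := HB.pack ev fM.
  rewrite -[LHS]/(fL _) linear_sum; apply: eq_bigr => i _.
  by rewrite /fL /= evD !evZ.
have liftev X : X \in mm -> lift (ev X) = X.
  move=> Xm; apply/eqP; rewrite -subr_eq0; apply/eqP; apply: inj.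
    by rewrite memvB.
  by rewrite evB evlift subrr.
(* The projection to the kernel of [ev] along [mm]. The part of h factoring through it contributes
   no trace: its image lies in [mm], which [k] kills. *)
pose k X := X - lift (ev X).
have lk : linear k.
  by move=> a X Y; rewrite /k lev llift scalerBr opprD addrACA.
have hD X Y : h (X + Y) = h X + h Y by rewrite -[X in LHS]scale1r lh scale1r.
have evk X : ev (k X) = 0 by rewrite evB evlift subrr.
have lift0 : lift 0 = 0 by rewrite -ev0 liftev ?mem0v.
have kk X : k (k X) = k X by rewrite {1}/k evk lift0 subr0.
have lhk : linear (fun X => h (k X)) by move=> a X Y; rewrite lk lh.
have hlift : linear (fun v => h (lift v)) by move=> a X Y; rewrite llift lh.
have t1 : trace (fun X => h (k X)) = 0.
  transitivity (trace (fun X => h (k (k X)))); first by apply: trace_eq => X; rewrite kk.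
  rewrite (traceC lk lhk).
  transitivity (trace (fun X : 'rV[R]_d => (0 : 'rV[R]_d))).
    by apply: trace_eq => X; rewrite /k (liftev _ (hm _ (evk X))) subrr.
  by rewrite /trace (_ : lin1_mx _ = 0) ?mxtrace0 //; apply/matrixP => i j; rewrite !mxE.
transitivity (trace (fun X => h (k X) + h (lift (ev X)))).
  by apply: trace_eq => X; rewrite -hD /k subrK.
rewrite traceD t1 add0r (traceC lev hlift).
have levh : linear (fun v => ev (h (lift v))) by move=> a u v; rewrite hlift lev.
rewrite (trace_frame omC omD omZ omee omff omef levh).
by apply: eq_bigr => i _; rewrite !liftev.
Qed.

(** * Index pairs and their permutations *)

Section Pairs.
Variable N : nat.

Lemma pair_ord_subproof (i : 'I_N) (b : bool) : (i * 2 + b < N * 2)%N.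
Proof. by have := ltn_ord i; case: b => /=; lia. Qed.

(** [wedge_pow] consumes its arguments in consecutive pairs, whereas a frame of the tangent space is
    listed in two halves; this numbering passes from one to the other. *)
Definition pair_ord i b : 'I_(N * 2) := Ordinal (pair_ord_subproof i b).

Lemma pair_of_subproof (a : 'I_(N * 2)) : (a./2 < N)%N.
Proof. by have := ltn_ord a; lia. Qed.

Definition pair_of a : 'I_N := Ordinal (pair_of_subproof a).

Lemma pair_ordK a : pair_ord (pair_of a) (odd a) = a.
Proof. by apply: val_inj => /=; rewrite muln2 addnC odd_double_half. Qed.

Lemma pair_of_ord i b : pair_of (pair_ord i b) = i.
Proof. by apply: val_inj => /=; rewrite muln2 addnC half_bit_double. Qed.

Lemma odd_pair_ord i b : odd (pair_ord i b) = b.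
Proof. by rewrite /= muln2 oddD odd_double /= oddb. Qed.

Lemma pair_ord_inj i b j c : pair_ord i b = pair_ord j c -> i = j /\ b = c.
Proof.
by move=> h; split; [rewrite -(pair_of_ord i b) h pair_of_ord | rewrite -(odd_pair_ord i b) h odd_pair_ord].
Qed.

Lemma double_perm_inj (p : 'S_N) : injective (fun a => pair_ord (p (pair_of a)) (odd a)).
Proof.
move=> a c /pair_ord_inj[/perm_inj h1 h2].
by rewrite -(pair_ordK a) h1 h2 pair_ordK.
Qed.

Definition double_perm (p : 'S_N) : 'S_(N * 2) := perm (@double_perm_inj p).

Lemma double_permE p i b : double_perm p (pair_ord i b) = pair_ord (p i) b.
Proof. by rewrite permE pair_of_ord odd_pair_ord. Qed.

Lemma perm_pair_ext (s t : 'S_(N * 2)) :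
  (forall i b, s (pair_ord i b) = t (pair_ord i b)) -> s = t.
Proof. by move=> h; apply/permP => a; rewrite -(pair_ordK a) h. Qed.

Lemma double_permM p q : double_perm (p * q)%g = (double_perm p * double_perm q)%g.
Proof. by apply: perm_pair_ext => i b; rewrite permM !double_permE permM. Qed.

Lemma double_perm1 : double_perm 1%g = 1%g.
Proof. by apply: perm_pair_ext => i b; rewrite double_permE !perm1. Qed.

(** A transposition of two pairs is a product of two transpositions of indices. *)
Lemma double_perm_even p : odd_perm (double_perm p) = false.
Proof.
have [ts -> _] := prod_tpermP p.
elim: ts => [|[i j] ts IH]; first by rewrite big_nil double_perm1 odd_perm1.
rewrite big_cons double_permM odd_permM IH addbF /=.
have [->|ij] := eqVneq i j; first by rewrite tperm1 double_perm1 odd_perm1.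
have -> : double_perm (tperm i j) =
    (tperm (pair_ord i false) (pair_ord j false) * tperm (pair_ord i true) (pair_ord j true))%g.
  apply: perm_pair_ext => k b; rewrite double_permE permM.
  have ne a c : (pair_ord a c == pair_ord k b) = (a == k) && (c == b).
    by apply/eqP/andP => [/pair_ord_inj[-> ->]|[/eqP-> /eqP->]].
  case: b ne => ne.
    rewrite (tpermD (z := pair_ord k true)) ?ne ?andbF //.
    case: tpermP => [->|->|ki kj]; rewrite ?tpermL ?tpermR //.
    by rewrite tpermD // ne andbT eq_sym; apply/eqP.
  case: (tpermP i j k) => [->|->|ki kj]; rewrite ?tpermL ?tpermR //.
  - by rewrite tpermD //; apply/eqP => /pair_ord_inj[].
  - by rewrite tpermD //; apply/eqP => /pair_ord_inj[].
  - by rewrite !tpermD // ne ?andbF // andbT eq_sym; apply/eqP.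
rewrite odd_permM !odd_tperm.
have ne b : pair_ord i b != pair_ord j b.
  by apply/eqP => /pair_ord_inj[h _]; rewrite h eqxx in ij.
by rewrite !ne.
Qed.

End Pairs.

(** * Wedge powers evaluated on a symplectic frame *)

Section Wedge.
Variables (R : realType) (m : nat).
Local Notation V := 'rV[R]_m.
Variable om : V -> V -> R.

(** For skew om, [form_product] is 2^N N! times the Pfaffian of the matrix of om on the vectors [v];
    here the factor of the first slot is replaced by b. *)
Definition pfaffian_sum N (b : V -> V -> R) (v : 'I_(N.+1 * 2) -> V) : R :=
  \sum_(t : 'S_(N.+1 * 2)) (-1) ^+ t *
    (b (v (t (pair_ord ord0 false))) (v (t (pair_ord ord0 true))) *
     \prod_(i < N) om (v (t (pair_ord (lift ord0 i) false))) (v (t (pair_ord (lift ord0 i) true)))).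

Definition form_product N (v : 'I_(N * 2) -> V) : R :=
  \sum_(t : 'S_(N * 2)) (-1) ^+ t *
    \prod_(i < N) om (v (t (pair_ord i false))) (v (t (pair_ord i true))).

Lemma pfaffian_sum_om N v : pfaffian_sum om v = @form_product N.+1 v.
Proof. by apply: eq_bigr => t _; rewrite big_ord_recl. Qed.

(** A permutation [s] of the last 2 N indices extends to [ext s], and composition with it merges the
    two sums over permutations into one sum counted (2 N)! times. This cancels that factorial in
    [wedge], and 2! leaves the factor 1/2. *)
Lemma wedge_form_product N (b : V -> V -> R) (W : form R m (N * 2)) c
    (v : 'I_(N.+1 * 2) -> V) :
  (forall w, W w = c * form_product w) ->
  wedge (form_of b) W v = c / 2 * pfaffian_sum b v.
Proof.
move=> WE; rewrite /wedge.
pose f (t : 'S_(N.+1 * 2)) := (-1) ^+ t *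
    (b (v (t (pair_ord ord0 false))) (v (t (pair_ord ord0 true))) *
     \prod_(i < N) om (v (t (pair_ord (lift ord0 i) false))) (v (t (pair_ord (lift ord0 i) true)))).
pose ext (s : 'S_(N * 2)) : 'S_(N.+1 * 2) := lift_perm ord0 ord0 (lift_perm ord0 ord0 s).
have extE s i c' : ext s (pair_ord (lift ord0 i) c') =
    rshift 2 (s (pair_ord i c')) :> 'I_(N.+1 * 2).
  have -> : pair_ord (lift ord0 i) c' = lift ord0 (lift ord0 (pair_ord i c')) :> 'I_(N.+1 * 2).
    by apply: val_inj; rewrite /= /bump /=; lia.
  by rewrite /ext !lift_perm_lift; apply: val_inj.
have ext0 s c' : ext s (pair_ord ord0 c') = pair_ord ord0 c'.
  case: c'.
    have -> : pair_ord ord0 true = lift ord0 ord0 :> 'I_(N.+1 * 2) by apply: val_inj.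
    by rewrite /ext lift_perm_lift lift_perm_id.
  have -> : pair_ord ord0 false = ord0 :> 'I_(N.+1 * 2) by apply: val_inj.
  by rewrite /ext lift_perm_id.
have E (t : 'S_(N.+1 * 2)) : (-1) ^+ t *
    form_of b (fun i => v (t (lshift (N * 2) i : 'I_(N.+1 * 2)))) *
    W (fun j => v (t (rshift 2 j : 'I_(N.+1 * 2)))) = c * \sum_(s : 'S_(N * 2)) f (ext s * t)%g.
  rewrite WE /form_product mulrCA; congr (c * _).
  rewrite mulr_sumr; apply: eq_bigr => s _.
  rewrite /f odd_permM /ext !odd_lift_perm -/(ext s) /= signr_addb !permM !ext0.
  have -> : \prod_(i < N) om (v ((ext s * t)%g (pair_ord (lift ord0 i) false)))
      (v ((ext s * t)%g (pair_ord (lift ord0 i) true))) =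
    \prod_(i < N) om (v (t (rshift 2 (s (pair_ord i false)))))
      (v (t (rshift 2 (s (pair_ord i true))))).
    by apply: eq_bigr => i _; rewrite !permM !extE.
  rewrite /form_of.
  have -> : (lshift (N * 2) (ord0 : 'I_2) : 'I_(N.+1 * 2)) = pair_ord ord0 false by apply: val_inj.
  have -> : (lshift (N * 2) (ord_max : 'I_2) : 'I_(N.+1 * 2)) = pair_ord ord0 true by apply: val_inj.
  move: (b _ _) (\prod_(i < N) _) ((-1) ^+ s) ((-1) ^+ t) => x y z w.
  by rewrite mulrACA [w * z]mulrC.
rewrite (eq_bigr _ (fun t _ => E t)) -mulr_sumr exchange_big /=.
have E2 s : \sum_(t : 'S_(N.+1 * 2)) f (ext s * t)%g = pfaffian_sum b v.
  by rewrite [RHS](reindex_inj (mulgI (ext s))).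
rewrite (eq_bigr _ (fun s _ => E2 s)) sumr_const -[#|_|]/(#|'S_(N * 2)|) card_Sn.
have n0 : ((N * 2)`!%:R : R) != 0 by rewrite pnatr_eq0 -lt0n fact_gt0.
rewrite -mulr_natr natrM invfM; move: (pfaffian_sum b v) => x.
have -> : (2`!)%N%:R = 2 :> R by [].
by field.
Qed.

Lemma wedge_powE N v : wedge_pow om N v = 2^-1 ^+ N * form_product v.
Proof.
elim: N v => [|N IH] v.
  rewrite expr0 mul1r /form_product (big_pred1 1%g) => [|t]; last first.
    by apply/esym/eqP/permP => -[].
  by rewrite odd_perm1 expr0 big_ord0 mulr1.
by rewrite [LHS](wedge_form_product om v IH) pfaffian_sum_om exprSr.
Qed.

(** The positive half of the standard symplectic matrix in the ordering by pairs: om on a symplectic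
    frame is this relation minus its transpose. *)
Definition even_odd N (a c : 'I_(N * 2)) : bool :=
  [&& pair_of a == pair_of c, ~~ odd a & odd c].

(* A permutation with all its pairs increasing comes from a permutation of the pairs. *)
Lemma even_odd_perm N (t : 'S_(N * 2)) :
  (forall i, even_odd (t (pair_ord i false)) (t (pair_ord i true))) ->
  odd_perm t = false.
Proof.
move=> h; pose p i := pair_of (t (pair_ord i false)).
have t0 i : t (pair_ord i false) = pair_ord (p i) false.
  have /and3P[_ /negbTE e _] := h i.
  by rewrite -[LHS]pair_ordK e.
have t1 i : t (pair_ord i true) = pair_ord (p i) true.
  have /and3P[/eqP e _ o] := h i.
  by rewrite -[LHS]pair_ordK o -e.
have pinj : injective p.
  move=> i j pij; have : t (pair_ord i false) = t (pair_ord j false) by rewrite !t0 pij.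
  by move=> /perm_inj /pair_ord_inj[].
have -> : t = double_perm (perm pinj).
  by apply: perm_pair_ext => i [|]; rewrite double_permE permE ?t0 ?t1.
exact: double_perm_even.
Qed.

Section Evaluation.
Variables (N : nat) (v : 'I_(N * 2) -> V).
Hypothesis om_v : forall a c, om (v a) (v c) = (even_odd a c)%:R - (even_odd c a)%:R.

(** Interpolates between the full sum, [k = 0], and the sum over the positive half of the matrix
    alone, [k = N]. *)
Let slot k (i : 'I_N) a c : R :=
  if (i < k)%N then (even_odd a c)%:R else om (v a) (v c).

Let S k := \sum_(t : 'S_(N * 2)) (-1) ^+ t *
  \prod_(i < N) slot k i (t (pair_ord i false)) (t (pair_ord i true)).

(** Exchanging the two entries of slot k changes the sign of the permutation, so the negative half
    of that factor contributes as much as the positive half. *)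
Lemma slot_sum_step k : (k < N)%N -> S k = 2 * S k.+1.
Proof.
move=> kN; pose i0 : 'I_N := Ordinal kN.
pose rest (t : 'S_(N * 2)) := \prod_(i < N | i != i0)
   slot k i (t (pair_ord i false)) (t (pair_ord i true)).
have D j (t : 'S_(N * 2)) : (j == k) || (j == k.+1) ->
   \prod_(i < N) slot j i (t (pair_ord i false)) (t (pair_ord i true)) =
   slot j i0 (t (pair_ord i0 false)) (t (pair_ord i0 true)) * rest t.
  move=> jk; rewrite (bigD1 i0) //=; congr (_ * _); apply: eq_bigr => i ii0.
  have ik : (i : nat) != k by [].
  rewrite /slot; congr (if _ then _ else _).
  by case/orP: jk => /eqP -> //; rewrite ltnS leq_eqVlt (negbTE ik).
pose tau := tperm (pair_ord i0 false) (pair_ord i0 true).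
have rest_tau t : rest (tau * t)%g = rest t.
  apply: eq_bigr => i ii0; rewrite !permM !tpermD //;
    apply/eqP => /pair_ord_inj[e _]; by rewrite e eqxx in ii0.
have S1 : S k.+1 = \sum_(t : 'S_(N * 2)) (-1) ^+ t *
    ((even_odd (t (pair_ord i0 false)) (t (pair_ord i0 true)))%:R * rest t).
  by apply: eq_bigr => t _; rewrite D ?eqxx ?orbT // /slot ltnSn.
have S2 : - S k.+1 = \sum_(t : 'S_(N * 2)) (-1) ^+ t *
    ((even_odd (t (pair_ord i0 true)) (t (pair_ord i0 false)))%:R * rest t).
  rewrite S1 (reindex_inj (mulgI tau)) -sumrN; apply: eq_bigr => t _ /=.
  rewrite rest_tau !permM tpermL tpermR odd_permM odd_tperm.
  have -> : pair_ord i0 false != pair_ord i0 true by apply/eqP => /pair_ord_inj[].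
  by rewrite /= signrN mulNr opprK.
have -> : S k = S k.+1 - - S k.+1.
  rewrite {1}S1 S2 -sumrB; apply: eq_bigr => t _.
  by rewrite D ?eqxx // /slot ltnn om_v mulrBl mulrBr.
by rewrite opprK mulr2n mulrDl mul1r.
Qed.

(** Once all factors are reduced to their positive halves, the surviving permutations come from
    permutations of pairs and are even: all terms are nonnegative and the identity contributes 1.
    This allows the power of om to be cancelled in the equation for s. *)
Lemma form_product_neq0 : form_product v != 0.
Proof.
have -> : form_product v = 2 ^+ N * S N.
  have -> : form_product v = S 0.
    by apply: eq_bigr => t _; congr (_ * _); apply: eq_bigr => i _.
  have : forall k, (k <= N)%N -> S 0 = 2 ^+ k * S k.
    elim=> [_|k IH kN]; first by rewrite expr0 mul1r.
    by rewrite (IH (ltnW kN)) (slot_sum_step kN) exprSr mulrA.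
  exact.
rewrite mulf_neq0 ?expf_neq0 ?pnatr_eq0 // gt_eqF //.
have SN : S N = \sum_(t : 'S_(N * 2)) (-1) ^+ t *
    \prod_(i < N) (even_odd (t (pair_ord i false)) (t (pair_ord i true)))%:R.
  by apply: eq_bigr => t _; congr (_ * _); apply: eq_bigr => i _; rewrite /slot ltn_ord.
have ge0 (t : 'S_(N * 2)) : 0 <= (-1) ^+ t *
    \prod_(i < N) (even_odd (t (pair_ord i false)) (t (pair_ord i true)))%:R :> R.
  have [/forallP h|] := boolP [forall i, even_odd (t (pair_ord i false)) (t (pair_ord i true))].
    by rewrite (even_odd_perm h) expr0 mul1r prodr_ge0.
  rewrite negb_forall => /existsP[i hi].
  by rewrite (bigD1 i) //= (negbTE hi) mul0r mulr0.
rewrite SN (bigD1 1%g) //=; apply: ltr_pwDl; last by apply: sumr_ge0.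
rewrite odd_perm1 expr0 mul1r big1 // => i _.
by rewrite !perm1 /even_odd !pair_of_ord !odd_pair_ord eqxx.
Qed.

End Evaluation.

Definition partner N (a : 'I_(N * 2)) : 'I_(N * 2) := pair_ord (pair_of a) (~~ odd a).

Lemma partnerK N : involutive (@partner N).
Proof. by move=> a; rewrite /partner pair_of_ord odd_pair_ord negbK pair_ordK. Qed.

Section Contraction.
Variables (N : nat) (b : V -> V -> R) (v : 'I_(N.+1 * 2) -> V).
Hypothesis om_v : forall a c, om (v a) (v c) = (even_odd a c)%:R - (even_odd c a)%:R.
Hypothesis bC : forall u w, b u w = - b w u.

Let diag j := b (v (pair_ord j false)) (v (pair_ord j true)).
Let X (t : 'S_(N.+1 * 2)) : R := (-1) ^+ t *
  \prod_(i < N.+1) om (v (t (pair_ord i false))) (v (t (pair_ord i true))).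

Lemma om_partner a c : c != partner a -> om (v a) (v c) = 0.
Proof.
move=> ca; rewrite om_v /even_odd.
have [pac|pac] := eqVneq (pair_of a) (pair_of c); rewrite /= ?subrr //.
suff -> : odd c = odd a by case: (odd a); rewrite subrr.
apply/eqP; apply: contraT => oac; case/eqP: ca.
by rewrite -(pair_ordK c) /partner pac; congr pair_ord; move: oac; case: (odd c); case: (odd a).
Qed.

(** For an odd index the pair is reversed, and b and om change sign together. *)
Lemma form_partner a : b (v a) (v (partner a)) = diag (pair_of a) * om (v a) (v (partner a)).
Proof.
rewrite om_v /even_odd pair_of_ord odd_pair_ord eqxx /= /diag /partner.
rewrite -{1}(pair_ordK a); case: (odd a) => /=; last by rewrite subr0 mulr1.
by rewrite sub0r mulrN1 bC.
Qed.

(** By injectivity of [t] the slots after the first exhaust all pairs but one, and the two indices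
    left over form that pair. *)
Lemma partner_slots (t : 'S_(N.+1 * 2)) :
  (forall i, t (pair_ord (lift ord0 i) true) = partner (t (pair_ord (lift ord0 i) false))) ->
  t (pair_ord ord0 true) = partner (t (pair_ord ord0 false)).
Proof.
move=> h; pose a := (t^-1)%g (partner (t (pair_ord ord0 false))).
have ta : t a = partner (t (pair_ord ord0 false)) by rewrite permKV.
rewrite -ta; congr (t _); rewrite -[RHS]pair_ordK.
case: (unliftP ord0 (pair_of a)) => [i ia|i0].
  have : t (pair_ord ord0 false) = t (pair_ord (pair_of a) (~~ odd a)).
    rewrite -[LHS]partnerK -ta -[in LHS](pair_ordK a) ia.
    case: (odd a); last by rewrite -h.
    by rewrite h partnerK.
  by move=> /perm_inj/pair_ord_inj[]; rewrite ia => /(congr1 val).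
rewrite i0; congr pair_ord; case oa: (odd a) => //.
have /(congr1 (fun c : 'I__ => odd c)) : t (pair_ord ord0 false) = partner (t (pair_ord ord0 false)).
  by rewrite -ta -(pair_ordK a) i0 oa.
by rewrite odd_pair_ord; case: (odd _).
Qed.

(** If the first slot holds a pair, b is there [diag] times om. If it does not, some other slot
    fails as well by [partner_slots], and both sides are zero. *)
Lemma pfaffian_term (t : 'S_(N.+1 * 2)) :
  (-1) ^+ t * (b (v (t (pair_ord ord0 false))) (v (t (pair_ord ord0 true))) *
     \prod_(i < N) om (v (t (pair_ord (lift ord0 i) false))) (v (t (pair_ord (lift ord0 i) true))))
  = diag (pair_of (t (pair_ord ord0 false))) * X t.
Proof.
rewrite /X big_ord_recl [RHS]mulrCA; congr (_ * _); rewrite mulrA.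
have [->|ne] := eqVneq (t (pair_ord ord0 true)) (partner (t (pair_ord ord0 false))).
  by rewrite form_partner.
have /existsP[i hi] : [exists i, t (pair_ord (lift ord0 i) true)
     != partner (t (pair_ord (lift ord0 i) false))].
  rewrite -negb_forall; apply: contra ne => /forallP h; apply/eqP.
  by apply: partner_slots => i; apply/eqP.
by rewrite (bigD1 i) //= (om_partner hi) !(mul0r, mulr0).
Qed.

Lemma form_product_term_double p (t : 'S_(N.+1 * 2)) : X (double_perm p * t)%g = X t.
Proof.
rewrite /X odd_permM double_perm_even; congr (_ * _).
rewrite [RHS](reindex_inj (@perm_inj _ p)); apply: eq_bigr => i _.
by rewrite !permM !double_permE.
Qed.

(** If every slot holds a pair, each pair occurs in exactly one slot, so the sum over slots runs
    over all pairs; otherwise [X t] is zero. *)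
Lemma sum_diag_pairs (t : 'S_(N.+1 * 2)) :
  \sum_i diag (pair_of (t (pair_ord i false))) * X t = (\sum_j diag j) * X t.
Proof.
have [/forallP h|] := boolP [forall i, t (pair_ord i true) == partner (t (pair_ord i false))].
  have inj : injective (fun i => pair_of (t (pair_ord i false))).
    move=> i j /= hij; have [oij|oij] := eqVneq (odd (t (pair_ord i false))) (odd (t (pair_ord j false))).
      have : t (pair_ord i false) = t (pair_ord j false).
        by rewrite -[LHS]pair_ordK hij oij pair_ordK.
      by move=> /perm_inj/pair_ord_inj[].
    have : t (pair_ord i false) = t (pair_ord j true).
      rewrite (eqP (h j)) -[LHS]pair_ordK hij /partner; congr pair_ord.
      by move: oij; case: (odd _); case: (odd _).
    by move=> /perm_inj/pair_ord_inj[].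
  by rewrite -mulr_suml [in RHS](reindex_inj inj).
rewrite negb_forall => /existsP[i hi].
have -> : X t = 0 by rewrite /X (bigD1 i) //= (om_partner hi) mul0r mulr0.
by rewrite mulr0 big1 // => j _; rewrite mulr0.
Qed.

(** By invariance under permutations of pairs, b may sit in any of the N + 1 slots; adding these N +
    1 equal expressions produces the sum over all pairs. *)
Lemma pfaffian_sum_contraction :
  N.+1%:R * pfaffian_sum b v = (\sum_j diag j) * form_product v.
Proof.
have E i : pfaffian_sum b v = \sum_(t : 'S_(N.+1 * 2)) diag (pair_of (t (pair_ord i false))) * X t.
  rewrite /pfaffian_sum (eq_bigr _ (fun t _ => pfaffian_term t)).
  rewrite (reindex_inj (mulgI (double_perm (tperm ord0 i)))); apply: eq_bigr => t _ /=.
  by rewrite form_product_term_double permM double_permE tpermL.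
transitivity (\sum_(t : 'S_(N.+1 * 2)) \sum_i diag (pair_of (t (pair_ord i false))) * X t).
  rewrite exchange_big /=.
  by rewrite -(eq_bigr _ (fun i _ => E i)) sumr_const card_ord mulr_natl.
by rewrite /form_product mulr_sumr; apply: eq_bigr => t _; exact: sum_diag_pairs.
Qed.

(** On a symplectic frame both sides carry the same power of 1/2, and the sum over permutations
    cancels because it is nonzero. *)
Lemma wedge_contraction s :
  s * wedge_pow om N.+1 v = N.+1%:R * wedge (form_of b) (wedge_pow om N) v ->
  s = \sum_j diag j.
Proof.
rewrite wedge_powE (wedge_form_product b v (fun w => wedge_powE w)).
rewrite [RHS]mulrCA pfaffian_sum_contraction -exprSr [LHS]mulrCA.
have c0 : (2^-1 : R) ^+ N.+1 != 0 by rewrite expf_neq0 // invr_eq0 pnatr_eq0.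
by move/(mulfI c0)/(mulIf (form_product_neq0 om_v)).
Qed.

End Contraction.

End Wedge.

(** * Homogeneous almost Kaehler manifolds *)

Section KillingFields.
Variables (R : realType) (d m : nat) (G : lie_group R d) (M : manifold R m).
Variables (act : G -> M -> M) (om : tensor2 M) (J : endo_field M).
Hypothesis om_symplectic : symplectic_form om.
Hypothesis J_compatible : compatible_acs om J.
Hypothesis act_smooth : smooth_action act.
Hypothesis act_om : preserves_form act om.
Hypothesis act_J : preserves_acs act J.
Local Notation fld := (induced_vfield act).
Local Notation JF := (endo_vfield J).
Local Notation N := (nijenhuis J).
Local Notation g := (metric om J).
Local Notation smJ := (smooth_JF J_compatible).
Local Notation smi := (smooth_induced act_smooth).
Local Notation smb := smooth_lie_bracket.

Lemma induced_lincomb a X Y : (fld (a *: X + Y)) = lincomb a (fld X) (fld Y).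
Proof. by apply/funext => q; rewrite /lincomb; exact: induced_linear. Qed.

Lemma induced_opp X q : (fld (- X)) q = - (fld X) q.
Proof.
have lin := induced_linear act q.
have := lin (-2) X X; rewrite !scaleNr !scaler_nat !mulr2n !opprD !subrK; exact.
Qed.

Lemma lie_bracket_induced X Y :
  lie_bracket (fld X) (fld Y) = (fld (- lie_alg_bracket G X Y)).
Proof.
by apply/funext => q; rewrite (induced_bracket act_smooth) induced_opp.
Qed.

Lemma has_vderive_om_killing X Y Z p : smooth_vfield Y -> smooth_vfield Z ->
  has_vderive (fld X) p (fun q => om q (Y q) (Z q))
    (om p (lie_bracket (fld X) Y p) (Z p) + om p (Y p) (lie_bracket (fld X) Z p)).
Proof.
move=> sY sZ; have smo := om_is_smooth om_symplectic.
split; first exact: (form_of_vfields smo p sY sZ).1.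
rewrite (vderive_form smo (fld X) p sY sZ) !lie_bracket_vdif.
rewrite (omBl om_symplectic) (omBr om_symplectic).
have := killing_form_in_chart act_smooth smo act_om p X (Y p) (Z p).
generalize (dif (form_in_chart om p (Y p) (Z p)) (chart p p) ((fld X) p)).
generalize (om p (vdif (fld X) p (Y p)) (Z p)) (om p (Y p) (vdif (fld X) p (Z p))).
generalize (om p (vdif Y p ((fld X) p)) (Z p)) (om p (Y p) (vdif Z p ((fld X) p))).
move=> a b c d' e'; lra.
Qed.

Lemma lie_bracket_J_killing X A p : smooth_vfield A ->
  lie_bracket (fld X) (JF A) p = J p (lie_bracket (fld X) A p).
Proof.
move=> sA; have sJ := J_is_smooth J_compatible; rewrite !lie_bracket_vdif.
rewrite (vdif_endo sJ p ((fld X) p) sA) (JB J_compatible).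
rewrite -[vdif (fld X) p (JF A p)](killing_endo_in_chart act_smooth sJ act_J p X (A p)).
generalize (dif (endo_in_chart J p (A p)) (chart p p) ((fld X) p)).
generalize (J p (vdif A p ((fld X) p))) (J p (vdif (fld X) p (A p))) => a b c.
by rewrite opprD addrACA subrr add0r.
Qed.

Lemma lie_bracket_JF_killing X A : smooth_vfield A ->
  lie_bracket (fld X) (JF A) = JF (lie_bracket (fld X) A).
Proof. by move=> sA; apply/funext => q; exact: lie_bracket_J_killing. Qed.

Lemma metric_om p u v : g p u v = om p u (J p v).
Proof.
by rewrite (om_g om_symplectic J_compatible) (JJ J_compatible)
  (gNr om_symplectic J_compatible) opprK.
Qed.

Lemma has_vderive_g_killing X Y Z p : smooth_vfield Y -> smooth_vfield Z ->
  has_vderive (fld X) p (fun q => g q (Y q) (Z q))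
    (g p (lie_bracket (fld X) Y p) (Z p) + g p (Y p) (lie_bracket (fld X) Z p)).
Proof.
move=> sY sZ; have -> : (fun q => g q (Y q) (Z q)) = (fun q => om q (Y q) (JF Z q)).
  by apply/funext => q; rewrite metric_om.
have := has_vderive_om_killing X p sY (smJ sZ).
by rewrite (lie_bracket_JF_killing X sZ) !metric_om.
Qed.

(** Linearity of brackets is available for [lincomb], so N is rewritten through it; the outer
    coefficient is 1/4 - 1 because T is added once more. *)
Lemma nijenhuis_lincomb X Y :
  let T := lincomb (-1) (lie_bracket X Y) (lincomb (-1) (JF (lie_bracket X (JF Y)))
    (lincomb (-1) (JF (lie_bracket (JF X) Y)) (lie_bracket (JF X) (JF Y)))) in
  N X Y = lincomb (4^-1 - 1) T T.
Proof.
apply/funext => q; rewrite /lincomb nijenhuisE /endo_vfield !scaleN1r.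
rewrite scalerBl scale1r subrK; congr (_ *: _).
by rewrite [RHS]addrC; congr (_ - _); rewrite [RHS]addrC; congr (_ - _); rewrite [RHS]addrC.
Qed.

(** N is built from brackets and J; L_W' is a derivation of brackets by Jacobi and commutes with
    J. *)
Lemma lie_bracket_nijenhuis_killing W Y Z p : smooth_vfield Y -> smooth_vfield Z ->
  lie_bracket (fld W) (N Y Z) p = N (lie_bracket (fld W) Y) Z p + N Y (lie_bracket (fld W) Z) p.
Proof.
move=> sY sZ; have sW := smi W; have sJY := smJ sY; have sJZ := smJ sZ.
have s1 := smb sJY sJZ; have s2 := smb sJY sZ; have s3 := smb sY sJZ; have s4 := smb sY sZ.
have sJ2 := smJ s2; have sJ3 := smJ s3.
have t2 := smooth_lincomb (-1) sJ2 s1; have t3 := smooth_lincomb (-1) sJ3 t2.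
have t4 := smooth_lincomb (-1) s4 t3.
rewrite (nijenhuis_lincomb Y Z) (lie_bracket_lincombr _ p t4 t4 sW).
rewrite (lie_bracket_lincombr _ p s4 t3 sW) (lie_bracket_lincombr _ p sJ3 t2 sW).
rewrite (lie_bracket_lincombr _ p sJ2 s1 sW).
rewrite (lie_bracket_J_killing W p s3) (lie_bracket_J_killing W p s2).
have j1 := lie_bracket_jacobi p sW sJY sJZ; have j2 := lie_bracket_jacobi p sW sJY sZ.
have j3 := lie_bracket_jacobi p sW sY sJZ; have j4 := lie_bracket_jacobi p sW sY sZ.
move: j1 j2 j3 j4.
generalize (lie_bracket (fld W) (lie_bracket (JF Y) (JF Z)) p).
generalize (lie_bracket (fld W) (lie_bracket (JF Y) Z) p).
generalize (lie_bracket (fld W) (lie_bracket Y (JF Z)) p).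
generalize (lie_bracket (fld W) (lie_bracket Y Z) p).
move=> x1 x2 x3 x4 -> -> -> ->.
rewrite (lie_bracket_JF_killing W sY) (lie_bracket_JF_killing W sZ) !nijenhuisE.
generalize (lie_bracket (fld W) Y) (lie_bracket (fld W) Z) => WY WZ.
rewrite !(JD J_compatible).
generalize (lie_bracket (JF WY) (JF Z) p) (lie_bracket (JF Y) (JF WZ) p).
generalize (J p (lie_bracket (JF WY) Z p)) (J p (lie_bracket (JF Y) WZ p)).
generalize (J p (lie_bracket WY (JF Z) p)) (J p (lie_bracket Y (JF WZ) p)).
generalize (lie_bracket WY Z p) (lie_bracket Y WZ p) => a b c d' e' f' h i.
apply/matrixP => k l; rewrite !mxE; lra.
Qed.

Variable nabla : vfield M -> vfield M -> vfield M.
Hypothesis nabla_chern : chern_connection om J nabla.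
Hypothesis induced_span : forall p u, exists X, (fld X) p = u.

Lemma induced_nondeg p u v : (forall X, g p u ((fld X) p) = g p v ((fld X) p)) -> u = v.
Proof.
move=> h; apply/eqP; rewrite -subr_eq0; apply/eqP.
have [_ _ nd _] := om_symplectic; apply: (nd p) => w.
(* Chosen so that g(u, - J w) = om(u, w). *)
have [X Xw] := induced_span p (- J p w).
have := h X; rewrite Xw !metric_om (JN J_compatible) (JJ J_compatible) opprK.
by move=> E; rewrite (omBl om_symplectic) E subrr.
Qed.

Lemma nabla_J X Y p : smooth_vfield X -> smooth_vfield Y ->
  nabla X (JF Y) p = J p (nabla X Y p).
Proof.
move=> sX sY; apply: (@induced_nondeg p) => U.
(* The torsion side of [nabla_defect_closed]; antilinearity of N in both arguments makes it change
   sign when J is applied to its first two arguments, as [defect_eq0] asks. *)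
pose n X Y Z := g p (N X Y p) (J p (Z p)) - g p (N X Z p) (J p (Y p)) + g p (N Y Z p) (J p (X p)).
have hn A B C : smooth_vfield A -> smooth_vfield B -> smooth_vfield C ->
    n (JF A) (JF B) C = - n A B C.
  move=> sA sB sC; rewrite /n.
  have := nijenhuis_Jl J_compatible p sA sC; have := nijenhuis_Jl J_compatible p sB sC.
  have := nijenhuis_Jr J_compatible p (smJ sA) sB; rewrite (nijenhuis_Jl J_compatible p sA sB).
  generalize (N (JF A) (JF B) p) (N (JF A) C p) (N (JF B) C p).
  generalize (N A B p) (N A C p) (N B C p); rewrite /endo_vfield.
  move=> a b c x y z -> -> ->.
  rewrite (JN J_compatible) !(JJ J_compatible) opprK !(gNl J om_symplectic).
  rewrite !(gNr om_symplectic J_compatible) !(gJ om_symplectic J_compatible).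
  g_lra.
have := @defect_eq0 R _ (@smooth_vfield R m M) JF (@opp_vf R m M)
  (fun X Y Z => nabla_defect om J nabla X Y Z p) n (@smooth_JF _ _ _ _ _ J_compatible)
  (JF_JF J_compatible)
  (fun X Y Z => @nabla_defect_anti _ _ _ _ _ om_symplectic J_compatible _ nabla_chern X Y Z p)
  (fun X Y Z => @nabla_defect_J _ _ _ _ _ om_symplectic J_compatible _ nabla_chern X Y Z p)
  (fun X Y Z => @nabla_defect_opp3 _ _ _ _ _ om_symplectic J_compatible nabla X Y Z p)
  (fun X Y Z => @nabla_defect_opp1 _ _ _ _ _ om_symplectic J_compatible _ nabla_chern X Y Z p)
  (fun X Y Z => @nabla_defect_nijenhuis _ _ _ _ _ om_symplectic J_compatible _ nabla_chern X Y Z p)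
  (fun X Y Z => @nabla_defect_closed _ _ _ _ _ om_symplectic J_compatible _ nabla_chern X Y Z p)
  hn X Y (fld U) sX sY (smi U).
rewrite /nabla_defect (gJ om_symplectic J_compatible); g_lra.
Qed.

End KillingFields.

(** * Curvature through D, and the scalar curvature in a frame *)

Section ScalarCurvature.
Variables (R : realType) (d n : nat) (G : lie_group R d) (M : manifold R (n.+1 + n.+1)).
Variables (act : G -> M -> M) (om : tensor2 M) (J : endo_field M).
Hypothesis om_symplectic : symplectic_form om.
Hypothesis J_compatible : compatible_acs om J.
Hypothesis act_smooth : smooth_action act.
Hypothesis act_om : preserves_form act om.
Hypothesis act_J : preserves_acs act J.
Variable nabla : vfield M -> vfield M -> vfield M.
Hypothesis nabla_chern : chern_connection om J nabla.
Hypothesis induced_span : forall p u, exists X, induced_vfield act X p = u.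
Local Notation fld := (induced_vfield act).
Local Notation JF := (endo_vfield J).
Local Notation N := (nijenhuis J).
Local Notation g := (metric om J).
Local Notation smJ := (smooth_JF J_compatible).
Local Notation smi := (smooth_induced act_smooth).
Local Notation smb := smooth_lie_bracket.
Local Notation V := 'rV[R]_(n.+1 + n.+1).
Local Notation ad := (lie_alg_bracket G).
Local Notation D := (conn_minus_lie (@lie_bracket R (n.+1 + n.+1) M) nabla fld).

Let hv_fun (X : vfield M) p f a b : has_vderive X p f a -> has_vderive X p f b -> a = b.
Proof. by move=> [_ <-] [_ <-]. Qed.

Let hv0 (X : vfield M) p f a : X p = 0 -> has_vderive X p f a -> a = 0.
Proof. by move=> X0 [_ <-]; exact: vderive0. Qed.

Let hv_zero (X Z W : vfield M) p : smooth_vfield Z -> smooth_vfield W -> Z p = 0 ->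
  has_vderive X p (fun q => g q (Z q) (W q)) (g p (lie_bracket X Z p) (W p)).
Proof.
move=> sZ sW Z0; split; last exact: (vderive_form_zero om_symplectic J_compatible).
have := form_of_vfields (om_is_smooth om_symplectic) p sZ (smJ sW) => -[+ _].
congr dfb; apply/funext => u; rewrite (metric_om om_symplectic J_compatible); reflexivity.
Qed.

Let D_zero X (Z : vfield M) p : smooth_vfield Z -> Z p = 0 -> D X Z p = 0.
Proof.
exact: (conn_minus_lie_zero hv_fun hv0 (gC om_symplectic J_compatible)
  (gDl J om_symplectic) (gZl J om_symplectic)
  (@lie_bracketC R _ M) (nijenhuisC J_compatible)
  (@has_vderive_g _ _ _ _ _ om_symplectic J_compatible _ nabla_chern)
  (@nabla_torsion _ _ _ _ _ _ nabla_chern) hv_zero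
  (@nijenhuis_zero _ _ _ _ _ J_compatible) smi
  (@induced_nondeg _ _ _ _ _ _ _ _ om_symplectic J_compatible induced_span p)).
Qed.

Let D_lincomb a X (Y Z : vfield M) p : smooth_vfield Y -> smooth_vfield Z ->
  D X (lincomb a Y Z) p = a *: D X Y p + D X Z p.
Proof.
exact: (conn_minus_lie_lc (@lie_bracket_lincombr R _ M)
  (@nabla_lincombr _ _ _ _ _ _ nabla_chern) smi).
Qed.

Let smD X (Z : vfield M) : smooth_vfield Z -> smooth_vfield (D X Z).
Proof.
exact: (S_conn_minus_lie (@smooth_lie_bracket R _ M)
   (@smooth_nabla _ _ _ _ _ _ nabla_chern) (@smooth_lincomb R _ M) smi).
Qed.

(** Tensoriality of D_X: the difference of the two fields vanishes at [p]. *)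
Let D_local X (Y Z : vfield M) p : smooth_vfield Y -> smooth_vfield Z -> Y p = Z p ->
  D X Y p = D X Z p.
Proof.
move=> sY sZ E; have s0 := smooth_lincomb (-1) sY sZ.
have Z0 : lincomb (-1) Y Z p = 0 by rewrite /lincomb E scaleN1r addrC subrr.
have := @D_zero X _ p s0 Z0; rewrite (D_lincomb (-1) X p sY sZ) scaleN1r addrC => /eqP.
by rewrite subr_eq0 => /eqP.
Qed.

Let D_skew X (Y Z : vfield M) p : smooth_vfield Y -> smooth_vfield Z ->
  g p (D X Y p) (Z p) = - g p (Y p) (D X Z p).
Proof.
exact: (conn_minus_lie_skew hv_fun (gC om_symplectic J_compatible)
  (gDl J om_symplectic) (gZl J om_symplectic)
  (@has_vderive_g _ _ _ _ _ om_symplectic J_compatible _ nabla_chern) smi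
  (@has_vderive_g_killing _ _ _ _ _ _ _ _ om_symplectic J_compatible act_smooth act_om act_J)).
Qed.

Let D_J X (Z : vfield M) p : smooth_vfield Z -> D X (JF Z) p = J p (D X Z p).
Proof.
move=> sZ; rewrite /conn_minus_lie.
rewrite (nabla_J om_symplectic J_compatible act_smooth nabla_chern induced_span p (smi X) sZ).
rewrite (lie_bracket_J_killing J_compatible act_smooth act_J X p sZ).
generalize (lie_bracket (fld X) Z p) => v; by rewrite (JB J_compatible).
Qed.

Let D_induced X Y p : D X (fld Y) p - D Y (fld X) p = N (fld X) (fld Y) p + fld (ad X Y) p.
Proof.
rewrite (conn_minus_lie_fld (@lie_bracketC R _ M) (@nabla_torsion _ _ _ _ _ _ nabla_chern) smi).
by rewrite (lie_bracket_induced act_smooth) induced_opp opprK.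
Qed.

(** Here [w] is - ad, because induced fields reverse brackets; it occurs in [curvature_killing] with
    its arguments exchanged, which restores [ad X Y]. *)
Let D_curvature X Y Z p :
  nabla (fld X) (nabla (fld Y) (fld Z)) p - nabla (fld Y) (nabla (fld X) (fld Z)) p
    - nabla (lie_bracket (fld X) (fld Y)) (fld Z) p =
  D X (D Y (fld Z)) p - D Y (D X (fld Z)) p - D (ad X Y) (fld Z) p.
Proof.
have -> : ad X Y = - ad Y X by rewrite lie_alg_bracketC.
exact: (curvature_killing (w := fun X Y => - ad X Y) hv_fun (@has_vderive_add R _ M)
  (@has_vderive_sub R _ M)
  (@smooth_lie_bracket R _ M)
  (@smooth_nabla _ _ _ _ _ _ nabla_chern) (@smooth_nijenhuis _ _ _ _ _ J_compatible)
  (gC om_symplectic J_compatible)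
  (gDl J om_symplectic) (gZl J om_symplectic)
  (@lie_bracketC R _ M) (@lie_bracket_lincombr R _ M)
  (@nabla_lincombr _ _ _ _ _ _ nabla_chern)
  (@has_vderive_g _ _ _ _ _ om_symplectic J_compatible _ nabla_chern)
  (@nabla_torsion _ _ _ _ _ _ nabla_chern) smi
  (lie_bracket_induced act_smooth)
  (@has_vderive_g_killing _ _ _ _ _ _ _ _ om_symplectic J_compatible act_smooth act_om act_J)
  (fun X Y Z p => @lie_bracket_jacobi R _ M X Y Z p)
  (@lie_bracket_nijenhuis_killing _ _ _ _ _ _ _ _ J_compatible act_smooth act_J)
  (@induced_nondeg _ _ _ _ _ _ _ _ om_symplectic J_compatible induced_span p)).
Qed.

(** Read off from the torsion identity, whose other terms are all linear, rather than from the
    brackets with J. *)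
Let N_lincombl a (X Y Z : vfield M) p : smooth_vfield X -> smooth_vfield Y -> smooth_vfield Z ->
  N (lincomb a X Y) Z p = a *: N X Z p + N Y Z p.
Proof.
move=> sX sY sZ; have sL := smooth_lincomb a sX sY.
have t A B : smooth_vfield A -> smooth_vfield B ->
    N A B p = nabla A B p - nabla B A p - lie_bracket A B p.
  move=> sA sB; rewrite (nabla_torsion nabla_chern p sA sB).
  by rewrite opprB addrC subrK.
rewrite (t _ _ sL sZ) (t _ _ sX sZ) (t _ _ sY sZ).
rewrite (nabla_lincombl nabla_chern a p sX sY sZ) (nabla_lincombr nabla_chern a p sX sY sZ).
rewrite (lie_bracket_lincombl a p sX sY sZ).
generalize (nabla X Z p) (nabla Y Z p) (nabla Z X p) (nabla Z Y p).
generalize (lie_bracket X Z p) (lie_bracket Y Z p) => x y z w x' y'.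
apply/matrixP => k l; rewrite !mxE; ring.
Qed.

Let N_local (X Y Z : vfield M) p : smooth_vfield X -> smooth_vfield Y -> smooth_vfield Z ->
  X p = Y p -> N X Z p = N Y Z p.
Proof.
move=> sX sY sZ E; have s0 := smooth_lincomb (-1) sX sY.
have Z0 : lincomb (-1) X Y p = 0 by rewrite /lincomb E scaleN1r addrC subrr.
have := nijenhuis_zero J_compatible s0 sZ Z0.
rewrite (N_lincombl (-1) p sX sY sZ).
generalize (N X Z p) (N Y Z p) => u v; rewrite scaleN1r addrC => /eqP.
by rewrite subr_eq0 => /eqP.
Qed.

Let N_localr (X Y Z : vfield M) p : smooth_vfield X -> smooth_vfield Y -> smooth_vfield Z ->
  X p = Y p -> N Z X p = N Z Y p.
Proof.
move=> sX sY sZ E.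
by rewrite (nijenhuisC J_compatible Z X) (nijenhuisC J_compatible Z Y) (N_local sX sY sZ E).
Qed.

Variable Rm : M -> V -> V -> V -> V.
Hypothesis Rm_curvature : curvature_tensor nabla Rm.
Variable s : M -> R.
Hypothesis s_scalar : hermitian_scalar_curvature om (chern_ricci_form J Rm) s.
Variables (p : M) (e f : 'I_n.+1 -> 'rV[R]_d).
Local Notation ev X := (fld X p).
Hypothesis om_ee : forall i j, om p (ev (e i)) (ev (e j)) = 0.
Hypothesis om_ff : forall i j, om p (ev (f i)) (ev (f j)) = 0.
Hypothesis om_ef : forall i j, om p (ev (e i)) (ev (f j)) = (i == j)%:R.

Let omC := om_anti om_symplectic p.
Let omD := omDl om_symplectic p.
Let omZ := omZl om_symplectic p.
Let lift v := \sum_i (om p v (ev (f i)) *: e i + om p (ev (e i)) v *: f i).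

Let ev_lift v : ev (lift v) = v.
Proof.
have lin := induced_linear act p.
pose fM := GRing.isLinear.Build _ _ _ _ _ lin.
pose fL : {linear 'rV[R]_d -> V} := HB.pack (fun X => ev X) fM.
rewrite [RHS](frame_expansion omC omD omZ om_ee om_ff om_ef v) /lift.
rewrite -[LHS]/(fL _) linear_sum; apply: eq_bigr => i _.
by rewrite linearD !linearZ.
Qed.

(** An operator on the tangent space at [p], evaluated on the extension of [v] by an induced field;
    [DpE] makes it independent of the extension, and [NpE] does the same for [Np]. *)
Let Dp X v := D X (fld (lift v)) p.
Let Np u v := N (fld (lift u)) (fld (lift v)) p.

Let DpE X (Z : vfield M) : smooth_vfield Z -> D X Z p = Dp X (Z p).
Proof. by move=> sZ; apply: (D_local X sZ (smi _)); rewrite ev_lift. Qed.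

Let NpE (X Y : vfield M) : smooth_vfield X -> smooth_vfield Y -> N X Y p = Np (X p) (Y p).
Proof.
move=> sX sY; rewrite /Np -(@N_local X _ _ _ sX (smi _) (smi _)) ?ev_lift //.
by apply: (N_localr sY (smi _) sX); rewrite ev_lift.
Qed.

Let lincomb_lift a u v : lincomb a (fld (lift u)) (fld (lift v)) p = a *: u + v.
Proof. by rewrite /lincomb !ev_lift. Qed.

Let Dp_linear X : linear (Dp X).
Proof.
move=> a u v; rewrite -(lincomb_lift a u v) -DpE; last first.
  exact: (smooth_lincomb a (smi _) (smi _)).
exact: (D_lincomb a X p (smi _) (smi _)).
Qed.

Let Dp_linear1 v : linear (Dp ^~ v).
Proof.
move=> a X Y; rewrite /Dp /conn_minus_lie induced_lincomb.
have sX := smi X; have sY := smi Y; have sv := smi (lift v).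
rewrite (nabla_lincombl nabla_chern a p sX sY sv) (lie_bracket_lincombl a p sX sY sv).
generalize (nabla (fld X) (fld (lift v)) p) (nabla (fld Y) (fld (lift v)) p).
generalize (lie_bracket (fld X) (fld (lift v)) p) (lie_bracket (fld Y) (fld (lift v)) p).
by move=> x y z w; rewrite scalerBr opprD addrACA.
Qed.

Let Np_linear u : linear (Np u).
Proof.
move=> a v w; rewrite -(lincomb_lift a v w) -{1}(ev_lift u).
have su := smi (lift u); have sv := smi (lift v); have sw := smi (lift w).
rewrite -(NpE su (smooth_lincomb a sv sw)) /Np (nijenhuisC J_compatible).
rewrite (N_lincombl a p sv sw su).
have := nijenhuisC J_compatible (fld (lift u)) (fld (lift v)) p.
have := nijenhuisC J_compatible (fld (lift u)) (fld (lift w)) p.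
generalize (N (fld (lift v)) (fld (lift u)) p) (N (fld (lift w)) (fld (lift u)) p).
by move=> x y -> ->; rewrite opprD scalerN.
Qed.

Let Np_C u v : Np u v = - Np v u.
Proof. exact: (nijenhuisC J_compatible (fld (lift u)) (fld (lift v)) p). Qed.

Let Np_J u v : Np u (J p v) = - J p (Np u v).
Proof.
have su := smi (lift u); have sv := smi (lift v).
have E : JF (fld (lift v)) p = J p v by rewrite /endo_vfield ev_lift.
rewrite -E -{1}(ev_lift u) -(NpE su (smJ sv)).
exact: (nijenhuis_Jr J_compatible p su sv).
Qed.

Let Dp_J X v : Dp X (J p v) = J p (Dp X v).
Proof.
have sv := smi (lift v).
have E : JF (fld (lift v)) p = J p v by rewrite /endo_vfield ev_lift.
rewrite -E -(DpE X (smJ sv)); exact: (D_J X p sv).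
Qed.

Let Dp_skew X u v : om p (Dp X u) v = - om p u (Dp X v).
Proof.
have su := smi (lift u); have sv := smi (lift v).
have := D_skew X p su (smJ sv).
rewrite (DpE X su) (DpE X (smJ sv)) /endo_vfield !ev_lift Dp_J.
by rewrite !(gJr om_symplectic J_compatible) => /oppr_inj.
Qed.

Let Dp_torsion X Y : Dp X (ev Y) - Dp Y (ev X) = Np (ev X) (ev Y) + ev (ad X Y).
Proof.
rewrite -(DpE X (smi Y)) -(DpE Y (smi X)) -(NpE (smi X) (smi Y)); exact: D_induced.
Qed.

Let Rm_Dp X Y v :
  Rm p (ev X) (ev Y) v = Dp X (Dp Y v) - Dp Y (Dp X v) - Dp (ad X Y) v.
Proof.
have sv := smi (lift v).
rewrite -{1}(ev_lift v) (Rm_curvature (smi X) (smi Y) sv) D_curvature.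
by rewrite (DpE X (smD Y sv)) (DpE Y (smD X sv)).
Qed.

Let ricci_anti u w : chern_ricci_form J Rm p u w = - chern_ricci_form J Rm p w u.
Proof.
rewrite /chern_ricci_form -(ev_lift u) -(ev_lift w) -traceN; apply: trace_eq => v.
rewrite !Rm_Dp (lie_alg_bracketC G (lift u)) (linear_opp _ (Dp_linear1 v)).
generalize (Dp (lift u) (Dp (lift w) v)) (Dp (lift w) (Dp (lift u) v)) => x y.
generalize (Dp (ad (lift w) (lift u)) v) => z.
by rewrite -(JN J_compatible) opprB opprB addrC opprK.
Qed.

Lemma hermitian_scalar_curvature_frame :
  let xi := \sum_i ad (e i) (f i) in
  s p = - om p (ev xi) (J p (ev xi)) -
    \sum_i (om p (J p (ev (ad xi (e i)))) (ev (f i)) + om p (ev (e i)) (J p (ev (ad xi (f i))))).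
Proof.
move=> xi.
(* The frame in the order e_0, f_0, e_1, f_1, ... that matches the pairs of [wedge_pow]. *)
pose v (a : 'I_(n.+1 * 2)) := if odd a then ev (f (pair_of a)) else ev (e (pair_of a)).
have om_v a c : om p (v a) (v c) = (even_odd a c)%:R - (even_odd c a)%:R.
  rewrite /v /even_odd; case: (odd a); case: (odd c); rewrite /= ?andbF ?andbT ?subrr ?subr0 ?sub0r //.
  by rewrite omC om_ef.
rewrite (wedge_contraction om_v ricci_anti (s_scalar p v)).
rewrite -(sum_trace_J_curvature omC omD omZ om_ee om_ff om_ef ((J_is_smooth J_compatible).1 p)
  (JJ J_compatible p) (omJJ J_compatible p) (fun=> erefl) (fun=> erefl) (induced_linear act p)
  Dp_linear Dp_linear1 Dp_J Dp_skew Np_linear Np_C Np_J Dp_torsion).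
apply: eq_bigr => i _; rewrite /v !odd_pair_ord !pair_of_ord.
by apply: trace_eq => w; rewrite Rm_Dp.
Qed.

End ScalarCurvature.

(** * The symplectic basis at x and the trace formula *)

Section SymplecticBasis.
Variables (R : realType) (d n : nat) (G : lie_group R d) (M : manifold R (n.+1 + n.+1)).
Variables (act : G -> M -> M) (om : tensor2 M) (J : endo_field M).
Hypothesis om_symplectic : symplectic_form om.
Hypothesis J_compatible : compatible_acs om J.
Hypothesis act_smooth : smooth_action act.
Hypothesis act_om : preserves_form act om.
Hypothesis act_J : preserves_acs act J.
Local Notation fld := (induced_vfield act).
Local Notation V := 'rV[R]_(n.+1 + n.+1).
Local Notation L := 'rV[R]_d.
Local Notation ad := (lie_alg_bracket G).

(* d om = 0 on induced fields, with L_X' om = 0. *)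
Lemma closed_form_induced X Y Z p :
  om p (fld (ad X Y) p) (fld Z p) - om p (fld (ad X Z) p) (fld Y p)
  + om p (fld (ad Y Z) p) (fld X p) = 0.
Proof.
have sX := smooth_induced act_smooth X; have sY := smooth_induced act_smooth Y.
have sZ := smooth_induced act_smooth Z.
have b A B w : om p (lie_bracket (fld A) (fld B) p) w = - om p (fld (ad A B) p) w.
  by rewrite (induced_bracket act_smooth A B p) (omNl om_symplectic).
have b' A B w : om p w (lie_bracket (fld A) (fld B) p) = om p (fld (ad A B) p) w.
  by rewrite (om_anti om_symplectic) b opprK.
have c A B w : om p (fld (ad A B) p) w = - om p (fld (ad B A) p) w.
  by rewrite (lie_alg_bracketC G A B) induced_opp (omNl om_symplectic).
have [_ _ _ /(_ _ _ _ sX sY sZ p)] := om_symplectic.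
rewrite (has_vderive_om_killing om_symplectic act_smooth act_om X p sY sZ).2.
rewrite (has_vderive_om_killing om_symplectic act_smooth act_om Y p sX sZ).2.
rewrite (has_vderive_om_killing om_symplectic act_smooth act_om Z p sX sY).2.
have b1 := b X Y (fld Z p); have b2 := b' X Z (fld Y p); have b3 := b Y X (fld Z p).
have b4 := b' Y Z (fld X p); have b5 := b Z X (fld Y p); have b6 := b' Z Y (fld X p).
have b7 := b X Z (fld Y p); have b8 := b Y Z (fld X p).
have c1 := c Y X (fld Z p); have c2 := c Z X (fld Y p); have c3 := c Z Y (fld X p).
move: b1 b2 b3 b4 b5 b6 b7 b8 c1 c2 c3; clear.
repeat match goal with |- context [om p ?u ?v] => generalize (om p u v); intro end.
lra.
Qed.

Lemma frame_span p (e f : 'I_n.+1 -> L) :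
  (forall i j, om p (fld (e i) p) (fld (e j) p) = 0) ->
  (forall i j, om p (fld (f i) p) (fld (f j) p) = 0) ->
  (forall i j, om p (fld (e i) p) (fld (f j) p) = (i == j)%:R) ->
  forall v, exists X, fld X p = v.
Proof.
move=> ee ff ef v.
exists (\sum_i (om p v (fld (f i) p) *: e i + om p (fld (e i) p) v *: f i)).
have lin := induced_linear act p.
pose fM := GRing.isLinear.Build _ _ _ _ _ lin.
pose fL : {linear L -> V} := HB.pack (fun X => fld X p) fM.
rewrite [RHS](frame_expansion (om_anti om_symplectic p) (omDl om_symplectic p)
  (omZl om_symplectic p) ee ff ef v).
rewrite -[LHS]/(fL _) linear_sum; apply: eq_bigr => i _.
by rewrite linearD !linearZ.
Qed.

Variables (x : M) (mm : {vspace L}) (e : 'I_(n.+1 + n.+1) -> L).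
Hypothesis e_basis : symplectic_basis (induced_form act om x) mm e.
Local Notation ev X := (fld X x).
Local Notation el i := (e (lshift n.+1 i)).
Local Notation er i := (e (rshift n.+1 i)).

Lemma symplectic_basis_ll i j : om x (ev (el i)) (ev (el j)) = 0.
Proof.
have [_ h] := e_basis.
have lt (a c : 'I_n.+1) : (a < c)%N -> om x (ev (el a)) (ev (el c)) = 0.
  move=> ac; have := h (lshift n.+1 a) (lshift n.+1 c) ac; rewrite /induced_form => -> /=.
  by rewrite ltn_eqF // ltn_addl.
case: (ltngtP i j) => [/lt //|/lt E|/val_inj ->].
  by rewrite (om_anti om_symplectic) E oppr0.
have := om_anti om_symplectic x (ev (el j)) (ev (el j)); lra.
Qed.

Lemma symplectic_basis_rr i j : om x (ev (er i)) (ev (er j)) = 0.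
Proof.
have [_ h] := e_basis.
have lt (a c : 'I_n.+1) : (a < c)%N -> om x (ev (er a)) (ev (er c)) = 0.
  move=> ac; have := h (rshift n.+1 a) (rshift n.+1 c); rewrite /= ltn_add2l => /(_ ac).
  rewrite /induced_form => -> /=.
  by rewrite -addnA eqn_add2l ltn_eqF // ltn_addl.
case: (ltngtP i j) => [/lt //|/lt E|/val_inj ->].
  by rewrite (om_anti om_symplectic) E oppr0.
have := om_anti om_symplectic x (ev (er j)) (ev (er j)); lra.
Qed.

Lemma symplectic_basis_lr i j : om x (ev (el i)) (ev (er j)) = (i == j)%:R.
Proof.
have [_ h] := e_basis.
have := h (lshift n.+1 i) (rshift n.+1 j); rewrite /= ltn_addr // => /(_ isT).
rewrite /induced_form => ->; rewrite addnC eqn_add2r eq_sym.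
by rewrite -(inj_eq val_inj) /=; case: eqP.
Qed.

Lemma symplectic_basis_mem k : e k \in mm.
Proof.
have [eb _] := e_basis; apply: (basis_mem eb); exact: codom_f.
Qed.

(** The map [lift] after [ev] fixes each basis vector of [mm], hence all of [mm], and so recovers X
    from its value at [x]. *)
Lemma ev_complement_inj X : X \in mm -> ev X = 0 -> X = 0.
Proof.
have lin := induced_linear act x.
pose fM := GRing.isLinear.Build _ _ _ _ _ lin.
pose fL : {linear L -> V} := HB.pack (fun X => ev X) fM.
pose lift v := \sum_i (om x v (ev (er i)) *: el i + om x (ev (el i)) v *: er i).
have llin : linear lift.
  move=> a u v; rewrite /lift scaler_sumr -big_split; apply: eq_bigr => i _ /=.
  rewrite (omDl om_symplectic) (omZl om_symplectic) (omDr om_symplectic) (omZr om_symplectic).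
  by rewrite !scalerDl scalerDr !scalerA addrACA.
pose gM := GRing.isLinear.Build _ _ _ _ _ llin.
pose gL : {linear V -> L} := HB.pack lift gM.
have lift_e k : lift (ev (e k)) = e k.
  rewrite -(splitK k); case: (fintype.split k) => j /=; rewrite /lift (bigD1 j) //= big1 ?addr0.
  - by rewrite symplectic_basis_lr symplectic_basis_ll eqxx scale1r scale0r addr0.
  - by move=> i ij; rewrite symplectic_basis_lr symplectic_basis_ll eq_sym (negbTE ij) !scale0r addr0.
  - by rewrite symplectic_basis_rr symplectic_basis_lr eqxx scale1r scale0r add0r.
  - by move=> i ij; rewrite symplectic_basis_rr symplectic_basis_lr (negbTE ij) !scale0r addr0.
move=> Xm X0; have [eb _] := e_basis.
have : X \in fixedSpace (linfun gL \o linfun fL)%VF.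
  have : (mm <= fixedSpace (linfun gL \o linfun fL))%VS.
    rewrite -(span_basis eb); apply/span_subvP => Y /codomP[k ->].
    by apply/fixedSpaceP; rewrite comp_lfunE !lfunE /= lift_e.
  by move/subvP; apply.
move/fixedSpaceP; rewrite comp_lfunE !lfunE /= X0 => <-.
exact: (linear0 gL).
Qed.

Hypothesis mm_complement : reductive_complement (isotropy act x) mm.

(** Evaluation kills the isotropy part of X, so here it also kills the part in [mm], which is then
    zero. *)
Lemma ev_kernel X : ev X = 0 -> lie_subalg (isotropy act x) X.
Proof.
have lin := induced_linear act x.
move=> X0; have [dec _ _] := mm_complement; have [Y [Z [kY mZ XE]]] := dec X.
suff Z0 : Z = 0 by rewrite XE Z0 addr0.
apply: ev_complement_inj => //; have := lin 1 Y Z; rewrite !scale1r -XE X0.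
by rewrite (lie_subalg_isotropy act_smooth kY) add0r => <-.
Qed.

Variable H : L -> L.
Hypothesis H_induced : induced_acs act J x mm H.

Lemma induced_acs_mem X : H X \in mm.
Proof.
have [lin Hk Hm _] := H_induced; have [dec _ _] := mm_complement.
have [Y [Z [kY mZ ->]]] := dec X.
by rewrite -[Y]scale1r lin Hk // scaler0 add0r Hm.
Qed.

Lemma ev_induced_acs X : ev (H X) = J x (ev X).
Proof.
have [lin Hk _ HJ] := H_induced; have [dec _ _] := mm_complement.
have [Y [Z [kY mZ ->]]] := dec X.
rewrite -[Y]scale1r lin Hk // scaler0 add0r HJ // (induced_linear act x).
by rewrite (lie_subalg_isotropy act_smooth kY) scaler0 add0r.
Qed.

Local Notation xi := (\sum_(i < n.+1) ad (el i) (er i)).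

(** Both traces reduce to [mm] by [trace_reductive]: ad_(H xi) sends the isotropy algebra into [mm]
    because H xi lies in [mm], and H takes all its values in [mm]. *)
Lemma trace_symplectic_basis :
  trace (fun Y => ad (H xi) Y - H (ad xi Y)) = - om x (ev xi) (J x (ev xi)) -
    \sum_i (om x (J x (ev (ad xi (el i)))) (ev (er i)) + om x (ev (el i)) (J x (ev (ad xi (er i))))).
Proof.
have [linH _ _ _] := H_induced.
have lad := lie_alg_bracket_linear.
have tr h := @trace_reductive R n.+1 d (om x) (fun X => ev X) (fun i => el i) (fun i => er i) mm h
  (om_anti om_symplectic x) (omDl om_symplectic x) (omZl om_symplectic x)
  symplectic_basis_ll symplectic_basis_rr symplectic_basis_lr (induced_linear act x).
have em i : el i \in mm by exact: symplectic_basis_mem.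
have fm i : er i \in mm by exact: symplectic_basis_mem.
rewrite traceB; congr (_ - _).
  rewrite (tr _ (lad _ _ G (H xi)) em fm ev_complement_inj); last first.
    move=> X X0; rewrite lie_alg_bracketC memvN.
    exact: (lie_subalg_complement mm_complement (ev_kernel X0) (induced_acs_mem _)).
  (* d om = 0 on H xi, e_i and f_i trades the two brackets with H xi for the single bracket
     [e_i, f_i], whose sum over i is xi. *)
  have E i : om x (ev (ad (H xi) (el i))) (ev (er i)) + om x (ev (el i)) (ev (ad (H xi) (er i)))
     = - om x (ev (ad (el i) (er i))) (J x (ev xi)).
    have := closed_form_induced (H xi) (el i) (er i) x.
    rewrite ev_induced_acs (om_anti om_symplectic x (ev (el i))).
    generalize (om x (ev (ad (H xi) (el i))) (ev (er i))).
    generalize (om x (ev (ad (H xi) (er i))) (ev (el i))).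
    generalize (om x (ev (ad (el i) (er i))) (J x (ev xi))) => a b c; lra.
  rewrite (eq_bigr _ (fun i _ => E i)) sumrN; congr (- _).
  rewrite -(om_sum (omDl om_symplectic x) (omZl om_symplectic x)); congr (om x _ _).
  have lin := induced_linear act x.
  pose fM := GRing.isLinear.Build _ _ _ _ _ lin.
  pose fL : {linear L -> V} := HB.pack (fun X => ev X) fM.
  exact/esym/(linear_sum fL).
rewrite (tr (fun Y => H (ad xi Y)) _ em fm ev_complement_inj); last first.
- by move=> X _; exact: induced_acs_mem.
- by move=> a X Y; rewrite lad linH.
by apply: eq_bigr => i _; rewrite !ev_induced_acs.
Qed.

End SymplecticBasis.

(** * Transport to an arbitrary point *)

Lemma Ad_linear (R : realType) (d : nat) (G : lie_group R d) (a : G) : linear (Ad a).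
Proof. by move=> c X Y; rewrite !AdE !tdiffE; exact: dif_is_linear. Qed.

(** The point [p] is written [act a x], with the frame Ad_a e_i, whose fields at [act a x] are the
    images under [act a] of the fields of e_i at [x]. As Ad_a respects brackets on the level of
    fields, every term is the image of the corresponding one at [x], where [trace_symplectic_basis]
    recognises the trace. *)
Theorem corollary16 (R : realType) (n d : nat)
    (M : manifold R (n.+1 + n.+1)) (om : tensor2 M) (J : endo_field M)
    (M_connected : connected [set: M])
    (om_symplectic : symplectic_form om)
    (J_compatible : compatible_acs om J)
    (G : lie_group R d) (act : G -> M -> M)
    (G_connected : connected [set: G])
    (act_smooth : smooth_action act)
    (act_transitive : transitive_action act)
    (act_om : preserves_form act om)
    (act_J : preserves_acs act J)
    (act_effective : almost_effective act)
    (x : M)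
    (K_compact : compact (isotropy act x))
    (mm : {vspace 'rV[R]_d})
    (mm_complement : reductive_complement (isotropy act x) mm)
    (H : 'rV[R]_d -> 'rV[R]_d)
    (H_induced : induced_acs act J x mm H)
    (nabla : vfield M -> vfield M -> vfield M)
    (nabla_chern : chern_connection om J nabla)
    (Rm : M -> 'rV[R]_(n.+1 + n.+1) -> 'rV[R]_(n.+1 + n.+1) ->
          'rV[R]_(n.+1 + n.+1) -> 'rV[R]_(n.+1 + n.+1))
    (Rm_curvature : curvature_tensor nabla Rm)
    (s : M -> R)
    (s_scalar : hermitian_scalar_curvature om (chern_ricci_form J Rm) s)
    (e : 'I_(n.+1 + n.+1) -> 'rV[R]_d)
    (e_basis : symplectic_basis (induced_form act om x) mm e) :
  let ad := lie_alg_bracket G in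
  let xi := \sum_(i < n.+1) ad (e (lshift n.+1 i)) (e (rshift n.+1 i)) in
  forall p : M, s p = trace (fun Y => ad (H xi) Y - H (ad xi Y)).
Proof.
move=> ad xi p.
rewrite (trace_symplectic_basis om_symplectic act_smooth act_om e_basis mm_complement H_induced).
have ll := symplectic_basis_ll om_symplectic e_basis.
have rr := symplectic_basis_rr om_symplectic e_basis.
have lr := symplectic_basis_lr e_basis.
have push a X z : induced_vfield act (Ad a X) (act a z) =
    tdiff (act a) z (induced_vfield act X z) by rewrite (Ad_induced act_smooth).
pose el (a : G) (i : 'I_n.+1) := Ad a (e (lshift n.+1 i)).
pose er (a : G) (i : 'I_n.+1) := Ad a (e (rshift n.+1 i)).
have ll' a i j : om (act a x) (induced_vfield act (el a i) (act a x))
    (induced_vfield act (el a j) (act a x)) = 0 by rewrite !push act_om ll.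
have rr' a i j : om (act a x) (induced_vfield act (er a i) (act a x))
    (induced_vfield act (er a j) (act a x)) = 0 by rewrite !push act_om rr.
have lr' a i j : om (act a x) (induced_vfield act (el a i) (act a x))
    (induced_vfield act (er a j) (act a x)) = (i == j)%:R by rewrite !push act_om lr.
have span q u : exists X, induced_vfield act X q = u.
  have [a <-] := act_transitive x q.
  exact: (frame_span om_symplectic (@ll' a) (@rr' a) (@lr' a)).
have [a <-] := act_transitive x p.
rewrite (hermitian_scalar_curvature_frame om_symplectic J_compatible act_smooth act_om act_J
  nabla_chern span Rm_curvature s_scalar (@ll' a) (@rr' a) (@lr' a)).
have xiE z : induced_vfield act (\sum_i ad (el a i) (er a i)) z = induced_vfield act (Ad a xi) z.
  have lin := induced_linear act z.
  pose fM := GRing.isLinear.Build _ _ _ _ _ lin.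
  pose fL : {linear 'rV[R]_d -> 'rV[R]_(n.+1 + n.+1)} :=
    HB.pack (fun X => induced_vfield act X z) fM.
  have linA := @Ad_linear R d G a.
  pose gM := GRing.isLinear.Build _ _ _ _ _ linA.
  pose gL : {linear 'rV[R]_d -> 'rV[R]_d} := HB.pack (Ad a) gM.
  rewrite -[LHS]/(fL _) -[Ad a xi]/(gL _) !linear_sum -[RHS]/(fL _) linear_sum.
  by apply: eq_bigr => i _; exact: (Ad_bracket_induced act_smooth).
have adE X : induced_vfield act (ad (\sum_i ad (el a i) (er a i)) (Ad a X)) (act a x) =
    tdiff (act a) x (induced_vfield act (ad xi X) x).
  (* [lie_bracket] differentiates its arguments, so [xiE] is needed at all points, as an equality of
     fields. *)
  apply: oppr_inj; rewrite -(induced_bracket act_smooth) (funext xiE).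
  by rewrite (induced_bracket act_smooth) (Ad_bracket_induced act_smooth) push.
rewrite xiE push -act_J act_om; congr (_ - _); apply: eq_bigr => i _.
by rewrite !adE !push -!act_J !act_om.
Qed.
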